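(* Let $\mathfrak g$ be a $\mathbb Z$-graded quadratic color Lie algebra with form $B$, let $\Omega'_{\mathfrak g}\in\widehat{\mathfrak U}_\varepsilon(\mathfrak g)$ be the normal-ordered Casimir element, and let $\Psi_{\mathrm{KP}}$ be the endomorphism of $\mathfrak g$ with $\psi_{\mathrm{KP}}(x,y)=B(\Psi_{\mathrm{KP}}(x),y)$. Then for every $x\in\mathfrak g$, $$L_x\Omega'_{\mathfrak g}=2\Psi_{\mathrm{KP}}(x)\quad\text{in }\widehat{\mathfrak U}_\varepsilon(\mathfrak g).$$
   Context: Fix an abelian group $\Gamma$ (additive, neutral element $0_\Gamma$) and a commutation factor $\varepsilon:\Gamma\times\Gamma\to\mathbb C^\times$, i.e. $\varepsilon$ is multiplicative in each variable and $\varepsilon(\alpha,\beta)\varepsilon(\beta,\alpha)=1$. For homogeneous $x,y$ of degrees $|x|,|y|\in\Gamma$ write $\varepsilon(x,y)=\varepsilon(|x|,|y|)$, $\varepsilon(x)=\varepsilon(x,x)$. A color Lie algebra is a $\Gamma$-graded complex vector space with a $\Gamma$-graded bilinear bracket with $[x,y]=-\varepsilon(x,y)[y,x]$ and $[x,[y,z]]=[[x,y],z]+\varepsilon(x,y)[y,[x,z]]$. $\mathbb Z$-graded quadratic color Lie algebra: a color Lie algebra $\mathfrak g=\bigoplus_{i\in\mathbb Z}\mathfrak g_i$ with each $\mathfrak g_i$ a finite-dimensional $\Gamma$-graded subspace, $[\mathfrak g_i,\mathfrak g_j]\subseteq\mathfrak g_{i+j}$, and a nondegenerate bilinear form $B$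 which is $\varepsilon$-symmetric ($B(x,y)=\varepsilon(x,y)B(y,x)$), invariant ($B([x,y],z)=B(x,[y,z])$) and satisfies $B(x,y)=0$ for bihomogeneous $x,y$ unless $\deg x+\deg y=0$ and $|x|+|y|=0_\Gamma$. Put $\mathfrak g_+=\bigoplus_{i>0}\mathfrak g_i$, $\mathfrak g_-=\bigoplus_{i\le0}\mathfrak g_i$, with projections $\pi_\pm$. $(e_a)$ is a homogeneous basis with $B$-dual basis $(e^a)$, $B(e_a,e^b)=\delta_{ab}$. $\varepsilon$-trace of a finite-rank endomorphism: $\operatorname{tr}_\varepsilon(T)=\sum_a\varepsilon(e_a)B(T(e_a),e^a)$. Kac--Peterson cocycle: $\psi_{\mathrm{KP}}(x,y)=\tfrac12\operatorname{tr}_\varepsilon(\mathrm{ad}_x\pi_-\mathrm{ad}_y\pi_+)-\tfrac12\varepsilon(x,y)\operatorname{tr}_\varepsilon(\mathrm{ad}_y\pi_-\mathrm{ad}_x\pi_+)$ for homogeneous $x,y$. $S_\varepsilon(\mathfrak g)$ is the algebra generated by $\mathfrak g$ with $xy=\varepsilon(x,y)yx$; $\mathfrak U_\varepsilon(\mathfrak g)$ is generated by $\mathfrak g$ with $xy-\varepsilon(x,y)yx=[x,y]$; similarly for $\mathfrak g_\pm$. For $F=S_\varepsilon$ or $\mathfrak U_\varepsilon$ the completion $\widehat F(\mathfrak g)$ is the direct sum over $(i,\gamma)\in\mathbb Z\times\Gamma$ of $\prod_{r\ge0}\bigoplus_{\alpha+\beta=\gamma}F(\mathfrak g_-)_{(i-r,\alpha)}\otimes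 F(\mathfrak g_+)_{(r,\beta)}$, with $F(\mathfrak g)\cong F(\mathfrak g_-)\otimes F(\mathfrak g_+)$ via multiplication; products extend to the completions. The symmetrization $Q:S_\varepsilon(\mathfrak g_\pm)\to\mathfrak U_\varepsilon(\mathfrak g_\pm)$ is $Q(x_1\cdots x_k)=\frac1{k!}\sum_{\sigma\in S_k}p'(\sigma;x_1,\dots,x_k)x_{\sigma(1)}\cdots x_{\sigma(k)}$ with $p'(\sigma;x_1,\dots,x_k)=\prod_{i<j,\ \sigma^{-1}(i)>\sigma^{-1}(j)}\varepsilon(x_i,x_j)$. The normal-ordered map $\widehat Q:\widehat S_\varepsilon(\mathfrak g)\to\widehat{\mathfrak U}_\varepsilon(\mathfrak g)$ is induced componentwise by $Q\otimes Q$. The normal-ordered Casimir element is $\Omega'_{\mathfrak g}=\widehat Q(p)$, $p=\sum_a\varepsilon(e_a)e_ae^a=\sum_ae^ae_a\in\widehat S^2_\varepsilon(\mathfrak g)$. $L_x$ is the adjoint action on $\widehat{\mathfrak U}_\varepsilon(\mathfrak g)$: $L_xu=xu-\varepsilon(x,u)ux$. *)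

(* Defs.v *)
From HB Require Import structures.
From mathcomp Require Import all_boot all_order all_algebra all_fingroup.
From mathcomp Require Import generic_quotient.
From mathcomp Require Import boolp classical_sets functions cardinality fsbigop.
From mathcomp Require Import reals.
From mathcomp Require Import complex.

Set Implicit Arguments.
Unset Strict Implicit.
Unset Printing Implicit Defensive.

Import GRing.Theory.
Local Open Scope quotient_scope.
Local Open Scope classical_set_scope.
Local Open Scope ring_scope.

(* The sums \sum_(i \in A) F i are the finitely supported sums of fsbigop     *)
(* (0 when the support is infinite); in a quadratic Z-graded color Lie        *)
(* algebra all those below have finite support.                               *)

Section Span.
Variables (K : pzRingType) (V : lmodType K).

Definition lspan (D : set V) : set V :=
  [set w | exists n (c : 'I_n -> K) (v : 'I_n -> V),
     (forall i, D (v i)) /\ w = \sum_(i < n) c i *: v i].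

Lemma lspan0 D : lspan D 0.
Proof. by exists 0%N, (fun=> 0), (fun=> 0); split; [case|rewrite big_ord0]. Qed.

Lemma lspanD D u v : lspan D u -> lspan D v -> lspan D (u + v).
Proof.
move=> [n [c [x [Dx ->]]]] [m [d [y [Dy ->]]]].
exists (n + m)%N, (fun i => match fintype.split i with inl j => c j | inr j => d j end),
  (fun i => match fintype.split i with inl j => x j | inr j => y j end).
split; first by move=> i; case: (fintype.split i).
rewrite big_split_ord /=; congr (_ + _); apply: eq_bigr => i _.
  by rewrite (unsplitK (inl i)).
by rewrite (unsplitK (inr i)).
Qed.

Lemma lspanZ D a u : lspan D u -> lspan D (a *: u).
Proof.
move=> [n [c [x [Dx ->]]]]; exists n, (fun i => a * c i), x; split=> //.
by rewrite scaler_sumr; apply: eq_bigr => i _; rewrite scalerA.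
Qed.

(* [c] is the coordinate function of [x]. *)
Definition is_basis (I : choiceType) (e : I -> V) : Prop :=
  forall x, exists! c : I -> K,
    finite_set [set i | c i != 0] /\ x = \sum_(i \in [set: I]) c i *: e i.

Fact linear0P (W : lmodType K) (f : V -> W) : linear f -> f 0 = 0.
Proof.
by move=> fl; have /= := fl (-1) 0 0; rewrite !scaleN1r !addNr.
Qed.

Fact linearDP (W : lmodType K) (f : V -> W) : linear f -> {morph f : x y / x + y}.
Proof. by move=> fl x y; have /= := fl 1 x y; rewrite !scale1r. Qed.

End Span.

Record commfactor (K : fieldType) (G : zmodType) := CommFactor {
  cf_val :> G -> G -> K;
  cf_Dl : forall a b c, cf_val (a + b) c = cf_val a c * cf_val b c;
  cf_Dr : forall a b c, cf_val a (b + c) = cf_val a b * cf_val a c;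
  cf_sym : forall a b, cf_val a b * cf_val b a = 1
}.

(* A Z-graded color Lie algebra.  The direct sum decomposition into the       *)
(* bihomogeneous subspaces g_(i, a) is given by its projections [zc_pr].      *)
Record zclie (K : fieldType) (G : zmodType) (eps : commfactor K G) := ZCLie {
  zc_sort :> lmodType K;
  zc_pr : int * G -> zc_sort -> zc_sort;
  zc_br : zc_sort -> zc_sort -> zc_sort;
  zc_pr_linear : forall k, linear (zc_pr k);
  zc_pr_pr : forall k l x, zc_pr k (zc_pr l x) = if k == l then zc_pr l x else 0;
  zc_pr_finite : forall x, finite_set [set k | zc_pr k x != 0];
  zc_pr_sum : forall x, x = \sum_(k \in [set: int * G]) zc_pr k x;
  zc_br_linearr : forall x, linear (zc_br x);
  zc_br_linearl : forall y, linear (zc_br^~ y);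
  zc_br_deg : forall k l x y, zc_pr k x = x -> zc_pr l y = y ->
    zc_pr (k + l) (zc_br x y) = zc_br x y;
  zc_br_anti : forall k l x y, zc_pr k x = x -> zc_pr l y = y ->
    zc_br x y = - (eps k.2 l.2 *: zc_br y x);
  zc_br_jacobi : forall k l x y z, zc_pr k x = x -> zc_pr l y = y ->
    zc_br x (zc_br y z) =
      zc_br (zc_br x y) z + eps k.2 l.2 *: zc_br y (zc_br x z)
}.

Definition homog (K : fieldType) (G : zmodType) (eps : commfactor K G)
  (L : zclie eps) (k : int * G) : set L := [set x | zc_pr k x = x].

Section DegreeSubalgebra.
Variables (K : fieldType) (G : zmodType) (eps : commfactor K G) (L : zclie eps).
Variable D : pred int.

Definition dsub_pred : {pred L} :=
  fun x => `[< forall k, ~~ D k.1 -> zc_pr k x = 0 >].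

Fact dsub_closed : submod_closed dsub_pred.
Proof.
split; first by apply/asboolP => k _; apply/linear0P/zc_pr_linear.
move=> a x y /asboolP hx /asboolP hy; apply/asboolP => k Dk.
by rewrite [LHS]zc_pr_linear hx// hy// scaler0 addr0.
Qed.

HB.instance Definition _ := GRing.isSubmodClosed.Build K L dsub_pred dsub_closed.

Definition dsub := {x : L | x \in dsub_pred}.
HB.instance Definition _ := SubChoice.on dsub.
HB.instance Definition _ := [SubChoice_isSubLmodule of dsub by <:].

Hypothesis addD : forall i j, D i -> D j -> D (i + j).

Fact dsub_pr_subproof k (x : dsub) : zc_pr k (val x) \in dsub_pred.
Proof.
apply/asboolP => l Dl; rewrite zc_pr_pr; case: eqP => // <-.
by have /asboolP := valP x; apply.
Qed.

Let linear_sumP (f : L -> L) (I : Type) (r : seq I) (F : I -> L) :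
  linear f -> f (\sum_(i <- r) F i) = \sum_(i <- r) f (F i).
Proof.
move=> fl; elim: r => [|i r IH]; first by rewrite !big_nil linear0P.
by rewrite !big_cons linearDP// IH.
Qed.

Fact dsub_br_subproof (x y : dsub) : zc_br (val x) (val y) \in dsub_pred.
Proof.
apply/asboolP => k Dk.
have prl := @zc_pr_linear _ _ _ L k.
have brl := @zc_br_linearl _ _ _ L; have brr := @zc_br_linearr _ _ _ L.
rewrite [val x in LHS]zc_pr_sum (linear_sumP _ _ (brl _)).
rewrite linear_sumP// big1 // => i _.
rewrite [val y in LHS]zc_pr_sum linear_sumP// linear_sumP// big1 // => j _.
have hx m : zc_pr m (zc_pr m (val x)) = zc_pr m (val x) by rewrite zc_pr_pr eqxx.
have hy m : zc_pr m (zc_pr m (val y)) = zc_pr m (val y) by rewrite zc_pr_pr eqxx.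
have [Di|Di] := boolP (D i.1); last first.
  have /asboolP/(_ _ Di) -> := valP x.
  by rewrite (linear0P (brl _)) (linear0P prl).
have [Dj|Dj] := boolP (D j.1); last first.
  have /asboolP/(_ _ Dj) -> := valP y.
  by rewrite (linear0P (brr _)) (linear0P prl).
rewrite -(zc_br_deg (hx i) (hy j)) zc_pr_pr; case: eqP => // kE.
by move: Dk; rewrite kE /= addD.
Qed.

Definition dsub_pr k (x : dsub) : dsub := exist (fun z => z \in dsub_pred) _ (dsub_pr_subproof k x).
Definition dsub_br (x y : dsub) : dsub := exist (fun z => z \in dsub_pred) _ (dsub_br_subproof x y).

Fact dsub_pr_finite x : finite_set [set k | dsub_pr k x != 0].
Proof.
apply: sub_finite_set (zc_pr_finite (val x)) => k /= ; apply: contra_neq => h.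
by apply: val_inj.
Qed.

Fact dsub_pr_sum x : x = \sum_(k \in [set: int * G]) dsub_pr k x.
Proof.
apply: val_inj; rewrite raddf_sum {1}[val x]zc_pr_sum /=.
have -> : finite_support 0 [set: int * G] (fun k => zc_pr k (val x)) =
          finite_support 0 [set: int * G] (dsub_pr^~ x); last by [].
rewrite /finite_support !unlock.
set A := (X in fset_set X); set A' := (X in _ = _ (fset_set X)).
suff -> : A = A' by [].
apply/seteqP; split=> k [_ /= h]; split=> //= e; apply: h; last exact: val_inj.
exact: (congr1 val e).
Qed.

Local Obligation Tactic := idtac.
Program Definition degsub : zclie eps :=
  @ZCLie K G eps dsub dsub_pr dsub_br _ _ dsub_pr_finite dsub_pr_sum _ _ _ _ _.
Next Obligation. by move=> k a x y; apply: val_inj; exact: zc_pr_linear. Qed.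
Next Obligation.
by move=> k l x; apply: val_inj; rewrite /= zc_pr_pr; case: eqP.
Qed.
Next Obligation. by move=> x a y z; apply: val_inj; exact: zc_br_linearr. Qed.
Next Obligation. by move=> x a y z; apply: val_inj; exact: zc_br_linearl. Qed.
Next Obligation.
move=> k l x y hx hy; apply: val_inj; apply: zc_br_deg.
  exact: (congr1 val hx).
exact: (congr1 val hy).
Qed.
Next Obligation.
move=> k l x y hx hy; apply: val_inj; apply: zc_br_anti.
  exact: (congr1 val hx).
exact: (congr1 val hy).
Qed.
Next Obligation.
move=> k l x y z hx hy; apply: val_inj; apply: zc_br_jacobi.
  exact: (congr1 val hx).
exact: (congr1 val hy).
Qed.

End DegreeSubalgebra.

Section PlusMinus.
Variables (K : fieldType) (G : zmodType) (eps : commfactor K G) (L : zclie eps).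

Fact minus_closed (i j : int) : i <= 0 -> j <= 0 -> i + j <= 0.
Proof. by move=> hi hj; rewrite -[0]addr0 Num.Theory.lerD. Qed.

Fact plus_closed (i j : int) : 0 < i -> 0 < j -> 0 < i + j.
Proof. exact: Num.Theory.addr_gt0. Qed.

Definition gminus : zclie eps := degsub L minus_closed.
Definition gplus : zclie eps := degsub L plus_closed.

Definition pi_minus (x : L) : L :=
  \sum_(k \in [set k : int * G | k.1 <= 0]) zc_pr k x.
Definition pi_plus (x : L) : L :=
  \sum_(k \in [set k : int * G | 0 < k.1]) zc_pr k x.

End PlusMinus.

(* The two algebras generated by a color Lie algebra h: S_eps(h) has the      *)
(* relations xy - eps(x,y) yx = 0, U_eps(h) has xy - eps(x,y) yx = [x,y].     *)
Variant algkind := Sym | Univ.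

Section PresentedAlgebra.
Variables (K : fieldType) (G : zmodType) (eps : commfactor K G).
Variables (F : algkind) (h : zclie eps).

Inductive aterm :=
  | Gen of h | Cst of K | Add of aterm & aterm | Mul of aterm & aterm.

Inductive acong : aterm -> aterm -> Prop :=
  | ac_refl s : acong s s
  | ac_sym s t : acong s t -> acong t s
  | ac_trans s t u : acong s t -> acong t u -> acong s u
  | ac_add s s' t t' : acong s s' -> acong t t' -> acong (Add s t) (Add s' t')
  | ac_mul s s' t t' : acong s s' -> acong t t' -> acong (Mul s t) (Mul s' t')
  | ac_addA s t u : acong (Add s (Add t u)) (Add (Add s t) u)
  | ac_addC s t : acong (Add s t) (Add t s)
  | ac_add0 s : acong (Add (Cst 0) s) s
  | ac_addN s : acong (Add (Mul (Cst (-1)) s) s) (Cst 0)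
  | ac_mulA s t u : acong (Mul s (Mul t u)) (Mul (Mul s t) u)
  | ac_mul1l s : acong (Mul (Cst 1) s) s
  | ac_mulDl s t u : acong (Mul (Add s t) u) (Add (Mul s u) (Mul t u))
  | ac_mulDr s t u : acong (Mul s (Add t u)) (Add (Mul s t) (Mul s u))
  | ac_cstD a b : acong (Cst (a + b)) (Add (Cst a) (Cst b))
  | ac_cstM a b : acong (Cst (a * b)) (Mul (Cst a) (Cst b))
  | ac_cstC a s : acong (Mul (Cst a) s) (Mul s (Cst a))
  | ac_genD x y : acong (Gen (x + y)) (Add (Gen x) (Gen y))
  | ac_genZ a x : acong (Gen (a *: x)) (Mul (Cst a) (Gen x))
  | ac_rel k l x y : homog k x -> homog l y ->
      acong (Add (Mul (Gen x) (Gen y))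
                 (Mul (Cst (- eps k.2 l.2)) (Mul (Gen y) (Gen x))))
            (match F with Sym => Cst 0 | Univ => Gen (zc_br x y) end).

HB.instance Definition _ := gen_eqMixin aterm.
HB.instance Definition _ := gen_choiceMixin aterm.

Definition acongb : rel aterm := fun s t => `[< acong s t >].

Fact acongb_equiv : equiv_class_of acongb.
Proof.
split=> [s|s t|t s u /asboolP st /asboolP tu]; first by apply/asboolP/ac_refl.
  by apply/asboolP/asboolP => /ac_sym.
by apply/asboolP; apply: ac_trans st tu.
Qed.

Canonical acongb_equivrel := EquivRelPack acongb_equiv.

Definition palg := {eq_quot acongb}.
HB.instance Definition _ := Choice.on palg.
HB.instance Definition _ := EqQuotient.on palg.

Definition pclass (s : aterm) : palg := \pi_palg%qT s.

Fact pclassP s t : acong s t <-> pclass s = pclass t.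
Proof.
by split=> [st|/eqmodP/asboolP //]; apply/eqmodP/asboolP.
Qed.

Fact reprP s : acong (repr (pclass s)) s.
Proof. by apply/pclassP; rewrite /pclass reprK. Qed.

Definition padd (u v : palg) : palg := pclass (Add (repr u) (repr v)).
Definition pmul (u v : palg) : palg := pclass (Mul (repr u) (repr v)).
Definition popp (u : palg) : palg := pclass (Mul (Cst (-1)) (repr u)).
Definition pscale (a : K) (u : palg) : palg := pclass (Mul (Cst a) (repr u)).

Fact pclassD s t : padd (pclass s) (pclass t) = pclass (Add s t).
Proof. by apply/pclassP; apply: ac_add; exact: reprP. Qed.

Fact pclassM s t : pmul (pclass s) (pclass t) = pclass (Mul s t).
Proof. by apply/pclassP; apply: ac_mul; exact: reprP. Qed.

Fact pclassZ a s : pscale a (pclass s) = pclass (Mul (Cst a) s).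
Proof. by apply/pclassP; apply: ac_mul; [exact: ac_refl|exact: reprP]. Qed.

Fact pclassN s : popp (pclass s) = pclass (Mul (Cst (-1)) s).
Proof. exact: pclassZ. Qed.

Let pE (u : palg) : u = pclass (repr u).
Proof. by rewrite /pclass reprK. Qed.

Fact paddA : associative padd.
Proof.
by move=> u v w; rewrite (pE u) (pE v) (pE w) !pclassD; apply/pclassP/ac_addA.
Qed.
Fact paddC : commutative padd.
Proof. by move=> u v; rewrite (pE u) (pE v) !pclassD; apply/pclassP/ac_addC. Qed.
Fact padd0 : left_id (pclass (Cst 0)) padd.
Proof. by move=> u; rewrite (pE u) pclassD; apply/pclassP/ac_add0. Qed.
Fact paddN : left_inverse (pclass (Cst 0)) popp padd.
Proof. by move=> u; rewrite (pE u) pclassN pclassD; apply/pclassP/ac_addN. Qed.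

HB.instance Definition _ := GRing.isZmodule.Build palg paddA paddC padd0 paddN.

Fact pmulA : associative pmul.
Proof.
by move=> u v w; rewrite (pE u) (pE v) (pE w) !pclassM; apply/pclassP/ac_mulA.
Qed.
Fact pmul1l : left_id (pclass (Cst 1)) pmul.
Proof. by move=> u; rewrite (pE u) pclassM; apply/pclassP/ac_mul1l. Qed.
Fact pmul1r : right_id (pclass (Cst 1)) pmul.
Proof.
move=> u; rewrite (pE u) pclassM; apply/pclassP.
exact: ac_trans (ac_sym (ac_cstC _ _)) (ac_mul1l _).
Qed.
Fact pmulDl : left_distributive pmul padd.
Proof.
move=> u v w; rewrite (pE u) (pE v) (pE w) !(pclassM, pclassD).
exact/pclassP/ac_mulDl.
Qed.
Fact pmulDr : right_distributive pmul padd.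
Proof.
move=> u v w; rewrite (pE u) (pE v) (pE w) !(pclassM, pclassD).
exact/pclassP/ac_mulDr.
Qed.

Fixpoint augm (s : aterm) : K :=
  match s with
  | Gen _ => 0 | Cst a => a
  | Add s t => augm s + augm t | Mul s t => augm s * augm t
  end.

Fact augmP s t : acong s t -> augm s = augm t.
Proof.
elim=> //=.
- by move=> ? ? ? _ -> _ ->.
- by move=> ? ? ? ? _ -> _ ->.
- by move=> ? ? ? ? _ -> _ ->.
- by move=> *; rewrite addrA.
- by move=> *; rewrite addrC.
- by move=> *; rewrite add0r.
- by move=> *; rewrite mulN1r addNr.
- by move=> *; rewrite mulrA.
- by move=> *; rewrite mul1r.
- by move=> *; rewrite mulrDl.
- by move=> *; rewrite mulrDr.
- by move=> *; rewrite mulrC.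
- by move=> *; rewrite addr0.
- by move=> *; rewrite mulr0.
- by move=> *; rewrite !mulr0 addr0; case: (F).
Qed.

Fact pone_neq0 : pclass (Cst 1) != 0 :> palg.
Proof. by apply/eqP => /pclassP/augmP/eqP; rewrite /= oner_eq0. Qed.

HB.instance Definition _ :=
  GRing.Zmodule_isNzRing.Build palg pmulA pmul1l pmul1r pmulDl pmulDr pone_neq0.

Fact pscaleA a b u : pscale a (pscale b u) = pscale (a * b) u.
Proof.
rewrite (pE u) !pclassZ; apply/pclassP; apply: ac_trans (ac_mulA _ _ _) _.
by apply: ac_mul; [apply/ac_sym/ac_cstM|apply: ac_refl].
Qed.
Fact pscale1 : left_id 1 pscale.
Proof. by move=> u; rewrite (pE u) pclassZ; apply/pclassP/ac_mul1l. Qed.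
Fact pscaleDr : right_distributive pscale padd.
Proof.
move=> a u v; rewrite (pE u) (pE v) !(pclassD, pclassZ).
exact/pclassP/ac_mulDr.
Qed.
Fact pscaleDl u : {morph pscale^~ u : a b / a + b >-> padd a b}.
Proof.
move=> a b; rewrite (pE u) /= !(pclassD, pclassZ); apply/pclassP.
apply: ac_trans (ac_mulDl _ _ _).
by apply: ac_mul; [apply: ac_cstD|apply: ac_refl].
Qed.

HB.instance Definition _ := GRing.Zmodule_isLmodule.Build K palg
  pscaleA pscale1 pscaleDr pscaleDl.

Fact pscaleAl (a : K) (u v : palg) : a *: (u * v) = (a *: u) * v.
Proof.
rewrite (pE u) (pE v) /GRing.scale /= /GRing.mul /= !(pclassM, pclassZ).
exact/pclassP/ac_mulA.
Qed.
HB.instance Definition _ := GRing.Lmodule_isLalgebra.Build K palg pscaleAl.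

Fact pscaleAr (a : K) (u v : palg) : a *: (u * v) = u * (a *: v).
Proof.
rewrite (pE u) (pE v) /GRing.scale /= /GRing.mul /= !(pclassM, pclassZ).
apply/pclassP; apply: ac_trans (ac_mulA _ _ _) _.
apply: ac_trans (ac_sym (ac_mulA _ _ _)).
by apply: ac_mul; [apply: ac_cstC|apply: ac_refl].
Qed.
HB.instance Definition _ := GRing.Lalgebra_isAlgebra.Build K palg pscaleAr.

Definition pgen (x : h) : palg := pclass (Gen x).

(* Meaningful when f is linear and respects the relations: then [peval f] is  *)
(* the induced algebra morphism.                                              *)
Fixpoint aeval (A : algType K) (f : h -> A) (s : aterm) : A :=
  match s with
  | Gen x => f x | Cst a => a%:A
  | Add s t => aeval f s + aeval f t | Mul s t => aeval f s * aeval f t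
  end.
Definition peval (A : algType K) (f : h -> A) (u : palg) : A := aeval f (repr u).

Definition pdeg (k : int * G) : set palg :=
  lspan [set u | exists n (d : 'I_n -> int * G) (x : 'I_n -> h),
    [/\ forall i, homog (d i) (x i), \sum_(i < n) d i = k
      & u = \prod_(i < n) pgen (x i)]].

End PresentedAlgebra.

Arguments pgen {K G eps} F {h} x.
Arguments pdeg {K G eps} F h k.

Section Symmetrization.
Variables (K : fieldType) (G : zmodType) (eps : commfactor K G) (h : zclie eps).

Definition koszul n (s : 'S_n) (d : 'I_n -> int * G) : K :=
  \prod_(i < n) \prod_(j < n | (i < j)%N && ((s^-1)%g j < (s^-1)%g i)%N)
    eps (d i).2 (d j).2.

Definition is_symmetrization (Q : palg Sym h -> palg Univ h) : Prop :=
  linear Q /\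
  forall n (d : 'I_n -> int * G) (x : 'I_n -> h),
    (forall i, homog (d i) (x i)) ->
    Q (\prod_(i < n) pgen Sym (x i)) =
      (n`!%:R : K)^-1 *:
        \sum_(s : 'S_n) koszul s d *: \prod_(i < n) pgen Univ (x (s i)).

(* There is exactly one such Q in characteristic 0: the right-hand side of    *)
(* [is_symmetrization] is multilinear and eps-symmetric in x, and products of *)
(* homogeneous elements span.                                                 *)
Definition symmetrization : palg Sym h -> palg Univ h :=
  xget (fun=> 0) is_symmetrization.

End Symmetrization.

Section Tensor.
Variables (K : fieldType) (A B : lmodType K).

Inductive tterm :=
  | TPure of A & B | TScale of K & tterm | TAdd of tterm & tterm.

Inductive tcong : tterm -> tterm -> Prop :=
  | tc_refl s : tcong s s
  | tc_sym s t : tcong s t -> tcong t s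
  | tc_trans s t u : tcong s t -> tcong t u -> tcong s u
  | tc_add s s' t t' : tcong s s' -> tcong t t' -> tcong (TAdd s t) (TAdd s' t')
  | tc_scale a s s' : tcong s s' -> tcong (TScale a s) (TScale a s')
  | tc_addA s t u : tcong (TAdd s (TAdd t u)) (TAdd (TAdd s t) u)
  | tc_addC s t : tcong (TAdd s t) (TAdd t s)
  | tc_add0 s : tcong (TAdd (TPure 0 0) s) s
  | tc_addN s : tcong (TAdd (TScale (-1) s) s) (TPure 0 0)
  | tc_scaleA a b s : tcong (TScale a (TScale b s)) (TScale (a * b) s)
  | tc_scale1 s : tcong (TScale 1 s) s
  | tc_scaleDr a s t : tcong (TScale a (TAdd s t)) (TAdd (TScale a s) (TScale a t))
  | tc_scaleDl a b s : tcong (TScale (a + b) s) (TAdd (TScale a s) (TScale b s))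
  | tc_pureDl x x' y : tcong (TPure (x + x') y) (TAdd (TPure x y) (TPure x' y))
  | tc_pureDr x y y' : tcong (TPure x (y + y')) (TAdd (TPure x y) (TPure x y'))
  | tc_pureZl a x y : tcong (TPure (a *: x) y) (TScale a (TPure x y))
  | tc_pureZr a x y : tcong (TPure x (a *: y)) (TScale a (TPure x y)).

HB.instance Definition _ := gen_eqMixin tterm.
HB.instance Definition _ := gen_choiceMixin tterm.

Definition tcongb : rel tterm := fun s t => `[< tcong s t >].

Fact tcongb_equiv : equiv_class_of tcongb.
Proof.
split=> [s|s t|t s u /asboolP st /asboolP tu]; first by apply/asboolP/tc_refl.
  by apply/asboolP/asboolP => /tc_sym.
by apply/asboolP; apply: tc_trans st tu.
Qed.

Canonical tcongb_equivrel := EquivRelPack tcongb_equiv.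

Definition tens := {eq_quot tcongb}.
HB.instance Definition _ := Choice.on tens.
HB.instance Definition _ := EqQuotient.on tens.

Definition tclass (s : tterm) : tens := \pi_tens%qT s.

Fact tclassP s t : tcong s t <-> tclass s = tclass t.
Proof.
by split=> [st|/eqmodP/asboolP //]; apply/eqmodP/asboolP.
Qed.

Fact treprP s : tcong (repr (tclass s)) s.
Proof. by apply/tclassP; rewrite /tclass reprK. Qed.

Definition tadd (u v : tens) : tens := tclass (TAdd (repr u) (repr v)).
Definition tscale (a : K) (u : tens) : tens := tclass (TScale a (repr u)).
Definition topp (u : tens) : tens := tscale (-1) u.

Fact tclassD s t : tadd (tclass s) (tclass t) = tclass (TAdd s t).
Proof. by apply/tclassP; apply: tc_add; exact: treprP. Qed.

Fact tclassZ a s : tscale a (tclass s) = tclass (TScale a s).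
Proof. by apply/tclassP; apply: tc_scale; exact: treprP. Qed.

Let tE (u : tens) : u = tclass (repr u).
Proof. by rewrite /tclass reprK. Qed.

Fact taddA : associative tadd.
Proof.
by move=> u v w; rewrite (tE u) (tE v) (tE w) !tclassD; apply/tclassP/tc_addA.
Qed.
Fact taddC : commutative tadd.
Proof. by move=> u v; rewrite (tE u) (tE v) !tclassD; apply/tclassP/tc_addC. Qed.
Fact tadd0 : left_id (tclass (TPure 0 0)) tadd.
Proof. by move=> u; rewrite (tE u) tclassD; apply/tclassP/tc_add0. Qed.
Fact taddN : left_inverse (tclass (TPure 0 0)) topp tadd.
Proof.
by move=> u; rewrite (tE u) /topp tclassZ tclassD; apply/tclassP/tc_addN.
Qed.

HB.instance Definition _ := GRing.isZmodule.Build tens taddA taddC tadd0 taddN.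

Fact tscaleA a b u : tscale a (tscale b u) = tscale (a * b) u.
Proof. by rewrite (tE u) !tclassZ; apply/tclassP/tc_scaleA. Qed.
Fact tscale1 : left_id 1 tscale.
Proof. by move=> u; rewrite (tE u) tclassZ; apply/tclassP/tc_scale1. Qed.
Fact tscaleDr : right_distributive tscale tadd.
Proof.
move=> a u v; rewrite (tE u) (tE v) !(tclassD, tclassZ).
exact/tclassP/tc_scaleDr.
Qed.
Fact tscaleDl u : {morph tscale^~ u : a b / a + b >-> tadd a b}.
Proof.
move=> a b; rewrite (tE u) /= !(tclassD, tclassZ).
exact/tclassP/tc_scaleDl.
Qed.

HB.instance Definition _ := GRing.Zmodule_isLmodule.Build K tens
  tscaleA tscale1 tscaleDr tscaleDl.

Definition tpure (x : A) (y : B) : tens := tclass (TPure x y).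

(* Meaningful when f is bilinear: then [teval f] is the induced linear map.   *)
Fixpoint teval_term (W : lmodType K) (f : A -> B -> W) (s : tterm) : W :=
  match s with
  | TPure x y => f x y
  | TScale a s => a *: teval_term f s
  | TAdd s t => teval_term f s + teval_term f t
  end.
Definition teval (W : lmodType K) (f : A -> B -> W) (u : tens) : W :=
  teval_term f (repr u).

End Tensor.

Section Completion.
Variables (K : fieldType) (G : zmodType) (eps : commfactor K G).
Variables (F : algkind) (L : zclie eps).

Definition tsplit := tens (palg F (gminus L)) (palg F (gplus L)).

Definition incl_minus : palg F (gminus L) -> palg F L :=
  peval (fun x : gminus L => pgen F (val x)).
Definition incl_plus : palg F (gplus L) -> palg F L :=
  peval (fun x : gplus L => pgen F (val x)).

Definition multmap : tsplit -> palg F L :=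
  teval (fun a b => incl_minus a * incl_plus b).

(* Inverse of [multmap], which is bijective by Poincare-Birkhoff-Witt.        *)
Definition splitmap (u : palg F L) : tsplit :=
  xget 0 [set t | multmap t = u].

(* The summand of bidegree k = (i, c) whose second factor has degree r.       *)
Definition tsdeg (k : int * G) (r : nat) : set tsplit :=
  lspan [set t | exists (al be : G) a b,
    [/\ al + be = k.2, pdeg F (gminus L) (k.1 - r%:Z, al) a,
        pdeg F (gplus L) (r%:Z, be) b & t = tpure a b]].

(* Components of t in the direct sum of the subspaces [tsdeg k r].            *)
Definition is_tcomp (t : tsplit) (f : (int * G) * nat -> tsplit) : Prop :=
  [/\ forall q, tsdeg q.1 q.2 (f q), finite_set [set q | f q != 0]
    & t = \sum_(q \in [set: (int * G) * nat]) f q].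
Definition tcomp (t : tsplit) : (int * G) * nat -> tsplit :=
  xget (fun=> 0) (is_tcomp t).

Definition hat_pred : {pred int * G -> nat -> tsplit} := fun u =>
  `[< (forall k r, tsdeg k r (u k r)) /\
      finite_set [set k | exists r, u k r != 0] >].

Fact hat_closed : submod_closed hat_pred.
Proof.
split.
  apply/asboolP; split=> [k r|]; first exact: lspan0.
  rewrite (_ : [set _ | _] = set0) //; apply/seteqP; split=> // k [r].
  by rewrite /= eqxx.
move=> a u v /asboolP[u1 u2] /asboolP[v1 v2]; apply/asboolP; split=> [k r|].
  exact: lspanD (lspanZ a (u1 k r)) (v1 k r).
have fin : finite_set ([set k | exists r, u k r != 0] `|`
                       [set k | exists r, v k r != 0]).
  by rewrite finite_setU; split.
apply: sub_finite_set fin.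
move=> k [r] /= h; have [u0|u0] := eqVneq (u k r) 0; last by left; exists r.
right; exists r; apply: contra_neq h => v0.
have -> : (a *: u + v) k r = a *: u k r + v k r by [].
by rewrite u0 v0 scaler0 addr0.
Qed.

HB.instance Definition _ :=
  GRing.isSubmodClosed.Build K _ hat_pred hat_closed.

(* The completion: an element of the summand of bidegree k is a family        *)
(* indexed by r, and only finitely many bidegrees k occur.                    *)
Definition hat := {u : int * G -> nat -> tsplit | u \in hat_pred}.
HB.instance Definition _ := SubChoice.on hat.
HB.instance Definition _ := [SubChoice_isSubLmodule of hat by <:].

(* The default value 0 plays no role: all families given to [mkhat] below     *)
(* are elements of the completion (in [hat_sum], for [quadratic_tensor]).     *)
Definition mkhat (f : int * G -> nat -> tsplit) : hat := insubd 0 f.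

Definition hat_emb (u : palg F L) : hat :=
  mkhat (fun k r => tcomp (splitmap u) (k, r)).

Definition hat_part (k : int * G) (u : hat) : hat :=
  mkhat (fun l r => if l == k then val u l r else 0).

Definition hat_mul (u v : hat) : hat :=
  mkhat (fun k t =>
    \sum_(q \in [set q : ((int * G) * (int * G)) * (nat * nat) |
                  q.1.1 + q.1.2 = k])
      tcomp (splitmap (multmap (val u q.1.1 q.2.1) * multmap (val v q.1.2 q.2.2)))
            (k, t)).

(* Sum of a family in the completion, finite in each component.               *)
Definition hat_sum (I : choiceType) (f : I -> hat) : hat :=
  mkhat (fun k r => \sum_(i \in [set: I]) val (f i) k r).

(* x u - eps(x,u) u x on bihomogeneous elements, extended bilinearly.         *)
Definition hat_adj (x : L) (u : hat) : hat :=
  \sum_(q \in [set: (int * G) * (int * G)])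
    (hat_mul (hat_emb (pgen F (zc_pr q.1 x))) (hat_part q.2 u)
     - eps q.1.2 q.2.2 *:
         hat_mul (hat_part q.2 u) (hat_emb (pgen F (zc_pr q.1 x)))).

End Completion.

Section NormalOrdering.
Variables (K : fieldType) (G : zmodType) (eps : commfactor K G) (L : zclie eps).

Definition normal_order (u : hat Sym L) : hat Univ L :=
  mkhat (fun k r =>
    teval (fun a b => tpure (symmetrization a) (symmetrization b)) (val u k r)).

End NormalOrdering.

Section Quadratic.
Variables (K : fieldType) (G : zmodType) (eps : commfactor K G) (L : zclie eps).

Definition zhomog (i : int) : set L :=
  [set x | forall k, k.1 != i -> zc_pr k x = 0].

Definition finite_dim_pieces : Prop :=
  forall i, exists n (v : 'I_n -> L),
    zhomog i `<=` lspan (range v).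

Record quadratic_form (B : L -> L -> K) : Prop := QuadraticForm {
  qf_linearr : forall x, scalar (B x);
  qf_linearl : forall y, scalar (B^~ y);
  qf_nondeg : forall x, (forall y, B x y = 0) -> x = 0;
  qf_sym : forall k l x y, homog k x -> homog l y ->
    B x y = eps k.2 l.2 * B y x;
  qf_inv : forall x y z, B (zc_br x y) z = B x (zc_br y z);
  qf_deg : forall k l x y, homog k x -> homog l y -> k + l != 0 -> B x y = 0
}.

Record dual_bases (B : L -> L -> K) (I : choiceType) (deg : I -> int * G)
    (e e' : I -> L) : Prop := DualBases {
  db_homog : forall a, homog (deg a) (e a);
  db_basis : is_basis e;
  db_dual_basis : is_basis e';
  db_dual : forall a b, B (e a) (e' b) = (a == b)%:R
}.

Variables (B : L -> L -> K) (I : choiceType) (deg : I -> int * G).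
Variables (e e' : I -> L).

Definition eps_trace (T : L -> L) : K :=
  \sum_(a \in [set: I]) eps (deg a).2 (deg a).2 * B (T (e a)) (e' a).

(* To be used for homogeneous x, y of degrees g, d in G.                      *)
Definition kac_peterson (g d : G) (x y : L) : K :=
  2%:R^-1 * eps_trace (fun z => zc_br x (pi_minus (zc_br y (pi_plus z))))
  - 2%:R^-1 * eps g d *
      eps_trace (fun z => zc_br y (pi_minus (zc_br x (pi_plus z)))).

Definition is_KP_endomorphism (Psi : L -> L) : Prop :=
  linear Psi /\
  forall k l x y, homog k x -> homog l y ->
    kac_peterson k.2 l.2 x y = B (Psi x) y.

Definition quadratic_tensor : hat Sym L :=
  hat_sum (fun a => eps (deg a).2 (deg a).2 *:
    hat_emb (pgen Sym (e a) * pgen Sym (e' a))).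

Definition casimir : hat Univ L := normal_order quadratic_tensor.

End Quadratic.

(* Main.v *)
From mathcomp Require Import all_boot all_order all_algebra all_fingroup.
From mathcomp Require Import generic_quotient zify ring.
From mathcomp Require Import boolp classical_sets functions cardinality fsbigop reals complex.
Require Import Defs.

(* Multiplication F(g_-) (x) F(g_+) -> F(g) is inverted without the           *)
(* Poincare-Birkhoff-Witt theorem: g acts on F(g_-) (x) F(g_+) by moving an   *)
(* element z to the right past F(g_-) with z x = eps(z, x) x z + [z, x], and  *)
(* letting F(g) act on 1 (x) 1 gives the inverse.                             *)
(* Let C_s be the sum of e^a e_a, and D_s the sum of [x, e^a] e_a, over the   *)
(* basis elements e_a of degree s.  By basis independence of the canonical    *)
(* element of g_s (x) g_{-s}, Omega' = C_0 + 2 \sum_{s > 0} C_s.  For x of    *)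
(* degree n, invariance of B gives [x, C_s] = D_s - D_{s+n}, so the sum       *)
(* telescopes; since D_s + D_{n-s} is the image in U(g) of the element        *)
(* d_s = \sum_a [[x, e^a], e_a] of g, what remains is \sum_{0 < s <= n} d_s   *)
(* if n >= 0 and - \sum_{n <= s < 0} d_s if n < 0.  The traces in psi_KP(x,y) *)
(* evaluate to B of the same element with y.                                  *)

(** The product of [x] with Omega' is an infinite sum, but each of its components in the completion
    involves only finitely many layers. For [x] of Z-degree n, the commutator with C_s is D_s -
    D_{s+n} ([comm_lcas], from the invariance of the canonical element, [layer_invariance]). A
    commutator with finitely many layers therefore collapses to two boundary sums of |n| terms each.
    In those at the upper end the factor from g_+ has degree above any prescribed t once the cut-off
    is large, so they have no component of index t ([ucomp_dcas0]). At the other end, layer 0 enters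
    Omega' once and each positive layer twice; this weighting makes the remaining indices symmetric
    under s -> n - s ([casimir_telescope]), and D_s + D_{n-s} is linear in g because the two
    products differ by their order and a sign ([dcas_reflect]).

    On the other side, [e a] contributes to the trace with [ad y] inside only if it has positive
    degree and [y, e_a] has degree at most 0, which for y of degree -n is the same window 0 < s <=
    n. Invariance turns each contribution into B([[x, e^a], e_a], y), and nondegeneracy identifies 2
    Psi(x) with the same sum of d_s ([KP_nonneg]); for negative n the other trace plays this part
    ([KP_neg]).

    The rest gives meaning to the objects selected by choice. That [multmap] is bijective
    ([multmapK], [split_invK]), that tensors have unique components ([tcompE]) and that the
    symmetrization exists ([symmetrizationP]) all rest on one device: a presented algebra is
    understood by letting it act on a suitable module ([is_rep]). It is used for the grading, twice
    for the splitting, and for a differential on the symmetric algebra. *)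

Set Implicit Arguments.
Unset Strict Implicit.
Unset Printing Implicit Defensive.

Import Order.TTheory GRing.Theory Num.Theory.
Local Open Scope quotient_scope.
Local Open Scope classical_set_scope.
Local Open Scope ring_scope.

(* Reflexive decision of identities between linear combinations: [lmodule]    *)
(* leaves one scalar identity per atom.                                       *)
Section LinearCombinations.
Variables (K : pzRingType) (V : lmodType K).

Inductive lexp := LVar of nat | LZero | LAdd of lexp & lexp | LOpp of lexp
  | LScale of K & lexp.

Fixpoint leval (env : seq V) (t : lexp) : V :=
  match t with
  | LVar i => nth 0 env i | LZero => 0
  | LAdd t u => leval env t + leval env u
  | LOpp t => - leval env t | LScale a t => a *: leval env t
  end.

Fixpoint lcoef (i : nat) (t : lexp) : K :=
  match t with
  | LVar j => if eqn i j then 1 else 0 | LZero => 0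
  | LAdd t u => lcoef i t + lcoef i u
  | LOpp t => - lcoef i t | LScale a t => a * lcoef i t
  end.

(** A conjunction obtained by computation, so that [split] leaves one scalar goal per atom. *)
Fixpoint lagree (n i : nat) (t u : lexp) : Prop :=
  if n is n'.+1 then lcoef i t = lcoef i u /\ lagree n' i.+1 t u else True.

Fixpoint lbound (n : nat) (t : lexp) : bool :=
  match t with
  | LVar i => (i < n)%N | LZero => true
  | LAdd t u => lbound n t && lbound n u
  | LOpp t => lbound n t | LScale a t => lbound n t
  end.

Lemma leval_coef env t : lbound (size env) t ->
  leval env t = \sum_(i < size env) lcoef i t *: nth 0 env i.
Proof.
elim: t => [j|_|t IHt u IHu|t IHt|a t IHt] /=.
- move=> jn; rewrite (bigD1 (Ordinal jn))//= -[eqn j j]/(j == j) eqxx scale1r.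
  rewrite big1 ?addr0// => i; rewrite -val_eqE /= -[eqn i j]/(val i == j).
  by move=> /negbTE ->; rewrite scale0r.
- by rewrite big1// => i _; rewrite scale0r.
- move=> /andP[/IHt -> /IHu ->]; rewrite -big_split.
  by apply: eq_bigr => i _; rewrite scalerDl.
- move=> /IHt ->; rewrite -sumrN; apply: eq_bigr => i _; by rewrite scaleNr.
- move=> /IHt ->; rewrite scaler_sumr; apply: eq_bigr => i _.
  by rewrite scalerA.
Qed.

Lemma leval_eq env t u : lbound (size env) t && lbound (size env) u ->
  lagree (size env) 0 t u -> leval env t = leval env u.
Proof.
move=> /andP[bt bu] ag; rewrite !leval_coef//; apply: eq_bigr => i _.
congr (_ *: _); move: ag; suff ag n k : lagree n k t u ->
    forall i, (k <= i < k + n)%N -> lcoef i t = lcoef i u.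
  by move/ag; apply; rewrite leq0n /= add0n.
elim: n k => [|n IH] k /=; first by move=> _ j /andP[kj]; rewrite addn0 ltnNge kj.
move=> [tu /IH h] j /andP[]; rewrite leq_eqVlt => /orP[/eqP <-//|kj].
by rewrite addnS -addSn => jn; apply: h; rewrite kj.
Qed.

End LinearCombinations.

Ltac lm_atom t l := match l with
  | context [cons t _] => l
  | context [cons ?u _] => let _ := constr:(erefl t : t = u) in l
  | _ => constr:(cons t l)
  end.
Ltac lm_atoms t l := lazymatch t with
  | GRing.add ?a ?b => let l' := lm_atoms a l in lm_atoms b l'
  | GRing.opp ?a => lm_atoms a l
  | GRing.scale ?k ?a => lm_atoms a l
  | GRing.zero => l
  | _ => lm_atom t l
  end.
Ltac lm_syntactic_index t l := lazymatch l with
  | cons t _ => constr:(O)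
  | cons _ ?l' => let n := lm_syntactic_index t l' in constr:(S n)
  end.
Ltac lm_convertible_index t l := match l with
  | cons ?u _ => let _ := constr:(erefl t : t = u) in constr:(O)
  | cons _ ?l' => let n := lm_convertible_index t l' in constr:(S n)
  end.
(** A syntactic match is preferred; a match up to conversion is also needed, because [lm_atoms]
    keeps only one of several convertible atoms. *)
Ltac lm_index t l := match l with
  | _ => lm_syntactic_index t l
  | _ => lm_convertible_index t l
  end.
Ltac lm_reify K t l := lazymatch t with
  | GRing.add ?a ?b =>
      let a' := lm_reify K a l in let b' := lm_reify K b l in
      constr:(@LAdd K a' b')
  | GRing.opp ?a => let a' := lm_reify K a l in constr:(@LOpp K a')
  | GRing.scale ?k ?a =>
      let a' := lm_reify K a l in constr:(@LScale K k a')
  | GRing.zero => constr:(@LZero K)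
  | _ => let n := lm_index t l in constr:(@LVar K n)
  end.
Ltac lmodule_over K V := lazymatch goal with
  | |- ?t = ?u =>
    let l := lm_atoms t (@nil V) in let l := lm_atoms u l in
    let t' := lm_reify K t l in let u' := lm_reify K u l in
    change (@leval K V l t' = @leval K V l u'); apply: leval_eq;
    [by []|repeat split; cbn [lcoef eqn]]
  end.
Tactic Notation "lmodule" constr(K) constr(V) := lmodule_over K V.

(** * Finitely supported sums and linear maps *)

Section FiniteSums.

Lemma fsum_seq (V : nmodType) (I : choiceType) (r : seq I) (F : I -> V) :
  uniq r -> (forall i, i \notin r -> F i = 0) ->
  \sum_(i \in [set: I]) F i = \sum_(i <- r) F i.
Proof.
move=> ur F0; have := @bigfs V 0 +%R I r xpredT F ur (fun i _ => F0 i).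
by move=> ->; congr (\sum_(_ \in _) _); apply/seteqP.
Qed.

Lemma finite_supp_seq (V : nmodType) (I : choiceType) (F : I -> V) :
  finite_set [set i | F i != 0] ->
  exists2 r : seq I, uniq r & forall i, i \notin r -> F i = 0.
Proof.
move=> fin; exists (finmap.enum_fset (fset_set [set i | F i != 0])).
  exact: finmap.fset_uniq.
move=> i; rewrite in_fset_set// notin_setE /= => /negP.
by rewrite negbK => /eqP.
Qed.

Lemma seq_finite_supp (V : nmodType) (I : choiceType) (F : I -> V) (r : seq I) :
  (forall i, i \notin r -> F i = 0) -> finite_set [set i | F i != 0].
Proof.
move=> h; apply: sub_finite_set (finite_seq r) => i /= Fi.
by apply: contra_neqT Fi => /h.
Qed.

Lemma fsum1 (V : nmodType) (I : choiceType) (i : I) (F : I -> V) :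
  (forall j, j != i -> F j = 0) -> \sum_(j \in [set: I]) F j = F i.
Proof.
move=> F0; rewrite (@fsum_seq _ _ [:: i]) ?big_seq1// => j.
by rewrite inE => /F0.
Qed.

Lemma fsum_support_cat (V : nmodType) (I : choiceType) (F G : I -> V)
    (r s : seq I) :
  (forall i, i \notin r -> F i = 0) -> (forall i, i \notin s -> G i = 0) ->
  [/\ uniq (undup (r ++ s)), (forall i, i \notin undup (r ++ s) -> F i = 0)
    & (forall i, i \notin undup (r ++ s) -> G i = 0)].
Proof.
move=> hr hs; split; first exact: undup_uniq.
  by move=> i; rewrite mem_undup mem_cat negb_or => /andP[/hr].
by move=> i; rewrite mem_undup mem_cat negb_or => /andP[_ /hs].
Qed.

End FiniteSums.

Section LinearMaps.
Variables (K : pzRingType) (V W : lmodType K) (f : V -> W).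
Hypothesis f_lin : linear f.

Lemma lin0 : f 0 = 0. Proof. exact: linear0P. Qed.
Lemma linD : {morph f : x y / x + y}. Proof. exact: linearDP. Qed.
Lemma linZ a x : f (a *: x) = a *: f x.
Proof. by have := f_lin a x 0; rewrite lin0 !addr0. Qed.
Lemma linN x : f (- x) = - f x.
Proof. by rewrite -scaleN1r linZ scaleN1r. Qed.
Lemma linB : {morph f : x y / x - y}.
Proof. by move=> x y; rewrite linD linN. Qed.
Lemma lin_sum (I : Type) (r : seq I) (P : pred I) (F : I -> V) :
  f (\sum_(i <- r | P i) F i) = \sum_(i <- r | P i) f (F i).
Proof. by apply: big_morph; [exact: linD|exact: lin0]. Qed.
Lemma lin_fsum (I : choiceType) (F : I -> V) :
  finite_set [set i | F i != 0] ->
  f (\sum_(i \in [set: I]) F i) = \sum_(i \in [set: I]) f (F i).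
Proof.
move=> /finite_supp_seq[r ur F0].
rewrite (fsum_seq ur F0) lin_sum (fsum_seq ur)// => i /F0 ->.
exact: lin0.
Qed.

End LinearMaps.

Lemma lin_comp (K : pzRingType) (U V W : lmodType K) (f : V -> W) (g : U -> V) :
  linear f -> linear g -> linear (fun x => f (g x)).
Proof. by move=> fl gl a x y; rewrite gl fl. Qed.

Lemma fsum_linear (K : pzRingType) (V W : lmodType K) (I : choiceType)
    (f : I -> V -> W) :
  (forall i, linear (f i)) ->
  (forall x, finite_set [set i | f i x != 0]) ->
  linear (fun x => \sum_(i \in [set: I]) f i x).
Proof.
move=> fl ff a x y.
have [r ur rx] := finite_supp_seq (ff x); have [s us sy] := finite_supp_seq (ff y).
have [ut tx ty] := fsum_support_cat rx sy.
rewrite (fsum_seq ut tx) (fsum_seq ut ty) (fsum_seq ut) => [|i it].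
  by rewrite scaler_sumr -big_split; apply: eq_bigr => i _; rewrite fl.
by rewrite fl tx// ty// scaler0 addr0.
Qed.

Lemma lspan_fsum (K : pzRingType) (V : lmodType K) (D : set V) (I : choiceType)
    (A : set I) (F : I -> V) :
  (forall i, lspan D (F i)) -> lspan D (\sum_(i \in A) F i).
Proof.
by move=> h; elim/big_ind: _ => //; [exact: lspan0|exact: lspanD].
Qed.

Lemma lspan_gen (K : pzRingType) (V : lmodType K) (D : set V) x :
  D x -> lspan D x.
Proof.
move=> Dx; exists 1%N, (fun=> 1), (fun=> x); split=> //.
by rewrite big_ord1 scale1r.
Qed.

Lemma lspan_ind (K : pzRingType) (V : lmodType K) (D : set V) (P : V -> Prop) :
  P 0 -> (forall a u v, P u -> P v -> P (a *: u + v)) ->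
  (forall x, D x -> P x) -> forall x, lspan D x -> P x.
Proof.
move=> P0 Pl PD x [n [c [v [Dv ->]]]].
elim/big_ind: _ => // [y z Py Pz|i _]; first by rewrite -[y]scale1r; apply: Pl.
by rewrite -[_ *: _]addr0; apply: Pl => //; apply: PD.
Qed.

Lemma snd_add (U V : nmodType) (p q : U * V) : (p + q).2 = p.2 + q.2.
Proof. by []. Qed.
Lemma fst_add (U V : nmodType) (p q : U * V) : (p + q).1 = p.1 + q.1.
Proof. by []. Qed.
Lemma snd_opp (U V : zmodType) (p : U * V) : (- p).2 = - p.2.
Proof. by []. Qed.

(** * Signs and homogeneous elements *)

Section Homogeneous.
Variables (K : fieldType) (G : zmodType) (eps : commfactor K G).

Lemma eps0r a : eps a 0 = 1.
Proof.
have /eqP : eps a 0 * eps 0 a = 1 by exact: cf_sym.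
have h : eps a 0 = eps a 0 * eps a 0 by rewrite -cf_Dr addr0.
have n0 : eps a 0 != 0.
  by apply: contra_eq_neq (cf_sym eps a 0) => ->; rewrite mul0r eq_sym oner_eq0.
by move=> _; apply: (mulfI n0); rewrite mulr1 -h.
Qed.
Lemma eps0l a : eps 0 a = 1.
Proof. by have := cf_sym eps a 0; rewrite eps0r mul1r. Qed.
Lemma eps_neq0 a b : eps a b != 0.
Proof.
by apply: contra_eq_neq (cf_sym eps a b) => ->; rewrite mul0r eq_sym oner_eq0.
Qed.
Lemma epsV a b : eps b a = (eps a b)^-1.
Proof. by apply: (mulfI (eps_neq0 a b)); rewrite cf_sym mulfV ?eps_neq0. Qed.
Lemma epsNr a b : eps a (- b) = (eps a b)^-1.
Proof.
by apply: (mulfI (eps_neq0 a b)); rewrite -cf_Dr subrr eps0r mulfV ?eps_neq0.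
Qed.
Lemma epsNl a b : eps (- a) b = (eps a b)^-1.
Proof.
by apply: (mulfI (eps_neq0 a b)); rewrite -cf_Dl subrr eps0l mulfV ?eps_neq0.
Qed.
Lemma epsaa_inv a : (eps a a)^-1 = eps a a.
Proof. by rewrite -epsV. Qed.

Variable h : zclie eps.
Implicit Types (x y : h) (k l : int * G).

Lemma homog_pr k x : homog k (zc_pr k x).
Proof. by rewrite /homog /= zc_pr_pr eqxx. Qed.
Lemma pr_homog k l x : homog k x -> zc_pr l x = if l == k then x else 0.
Proof. by rewrite /homog /= => <-; rewrite zc_pr_pr; case: eqP => // ->. Qed.
Lemma homog0 k : homog k (0 : h).
Proof. exact: (lin0 (@zc_pr_linear _ _ _ h k)). Qed.
Lemma homogL k a x y : homog k x -> homog k y -> homog k (a *: x + y).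
Proof. by rewrite /homog /= => hx hy; rewrite zc_pr_linear hx hy. Qed.
Lemma homogZ k a x : homog k x -> homog k (a *: x).
Proof. by move=> hx; rewrite -[_ *: _]addr0; apply: homogL => //; apply: homog0. Qed.
Lemma homogD k x y : homog k x -> homog k y -> homog k (x + y).
Proof. by move=> hx hy; rewrite -[x]scale1r; apply: homogL. Qed.
Lemma homog_br k l x y : homog k x -> homog l y -> homog (k + l) (zc_br x y).
Proof. exact: zc_br_deg. Qed.
Lemma homog_sum k (I : Type) (r : seq I) (P : pred I) (F : I -> h) :
  (forall i, P i -> homog k (F i)) -> homog k (\sum_(i <- r | P i) F i).
Proof. by move=> hF; elim/big_ind: _ => //; [exact: homog0|exact: homogD]. Qed.

Lemma pr_support x :
  exists2 s : seq (int * G), uniq s & forall k, k \notin s -> zc_pr k x = 0.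
Proof. exact: finite_supp_seq (zc_pr_finite x). Qed.

Lemma zclie_ind (P : h -> Prop) :
  (forall x y, P x -> P y -> P (x + y)) -> (forall k x, homog k x -> P x) ->
  forall x, P x.
Proof.
move=> PD Ph x; rewrite (zc_pr_sum x).
elim/big_ind: _ => // [|k _]; first exact: (Ph 0 0 (homog0 0)).
exact: Ph (homog_pr k x).
Qed.

(** Formulas containing signs make sense on homogeneous elements only; this is their additive
    extension through the bihomogeneous components. *)
Definition gext (W : lmodType K) (f : int * G -> h -> W) x : W :=
  \sum_(k \in [set: int * G]) f k (zc_pr k x).

Lemma gext_homog (W : lmodType K) (f : int * G -> h -> W) k x :
  (forall l, f l 0 = 0) -> homog k x -> gext f x = f k x.
Proof.
move=> fl hx; rewrite /gext (@fsum1 _ _ k) => [|l lk]; first by rewrite hx.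
by rewrite (pr_homog _ hx) (negbTE lk).
Qed.

Lemma gext_linear (W : lmodType K) (f : int * G -> h -> W) :
  (forall k, linear (f k)) -> linear (gext f).
Proof.
move=> fl; apply: fsum_linear => [k|x].
  exact: lin_comp (fl k) (@zc_pr_linear _ _ _ h k).
have [s _ sx] := pr_support x; apply: (@seq_finite_supp _ _ _ s) => k /sx ->.
exact: lin0.
Qed.

End Homogeneous.

(** * Representations and gradings of the presented algebras *)

Section PalgBasics.
Variables (K : fieldType) (G : zmodType) (eps : commfactor K G).
Variables (F : algkind) (h : zclie eps).
Local Notation palg := (palg F h).
Local Notation pgen := (pgen F).
Local Notation pclass := (@pclass K G eps F h).

(** The right-hand side of the defining relation: the symmetric algebra is treated as the enveloping
    algebra for the zero bracket, so both kinds share all proofs. *)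
Definition brk (g : zclie eps) (x y : g) : g :=
  match F with Sym => 0 | Univ => zc_br x y end.

Lemma brk_linearr (g : zclie eps) (x : g) : linear (brk x).
Proof.
move=> a y z; rewrite /brk; case: (F); first by rewrite scaler0 addr0.
exact: zc_br_linearr.
Qed.
Lemma brk_linearl (g : zclie eps) (y : g) : linear (fun x : g => brk x y).
Proof.
move=> a x z; rewrite /brk; case: (F); first by rewrite scaler0 addr0.
exact: zc_br_linearl.
Qed.
Lemma homog_brk (g : zclie eps) k l (x y : g) :
  homog k x -> homog l y -> homog (k + l) (brk x y).
Proof.
by move=> hx hy; rewrite /brk; case: (F); [exact: homog0|exact: homog_br].
Qed.
Lemma brk_anti (g : zclie eps) k l (x y : g) : homog k x -> homog l y ->
  brk x y = - (eps k.2 l.2 *: brk y x).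
Proof.
move=> hx hy; rewrite /brk; case: (F); first by rewrite scaler0 oppr0.
exact: zc_br_anti.
Qed.
Lemma brk_jacobi (g : zclie eps) k l (x y z : g) : homog k x -> homog l y ->
  brk x (brk y z) = brk (brk x y) z + eps k.2 l.2 *: brk y (brk x z).
Proof.
move=> hx hy; rewrite /brk; case: (F); first by rewrite scaler0 addr0.
exact: zc_br_jacobi.
Qed.

(** The Jacobi identity with brackets nested to the left, as they arise when an element is moved
    rightwards past two others. *)
Lemma brk_jacobir (g : zclie eps) k l m (x y z : g) :
  homog k x -> homog l y -> homog m z ->
  brk x (brk y z) = brk (brk x y) z - eps l.2 m.2 *: brk (brk x z) y.
Proof.
move=> hx hy hz; rewrite (brk_jacobi _ hx hy); congr (_ + _).
rewrite (brk_anti hy (homog_brk hx hz)) scalerN scalerA; congr (- (_ *: _)).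
by rewrite cf_Dr mulrA cf_sym mul1r.
Qed.

Lemma pclass_ind (P : palg -> Prop) : (forall s, P (pclass s)) -> forall u, P u.
Proof. by move=> Ps u; rewrite -[u]reprK; apply: Ps. Qed.

Lemma pclass_add s t : pclass (Add s t) = pclass s + pclass t :> palg.
Proof. by rewrite -pclassD. Qed.
Lemma pclass_mul s t : pclass (Mul s t) = pclass s * pclass t :> palg.
Proof. by rewrite -pclassM. Qed.
Lemma pclass_cst a : pclass (Cst h a) = a%:A :> palg.
Proof.
have -> : a%:A = pscale a (pclass (Cst h 1)) :> palg by [].
rewrite pclassZ; apply/pclassP; apply: ac_trans (ac_cstM _ _ _ _).
by rewrite mulr1; apply: ac_refl.
Qed.
Lemma pclass_scale a s : pclass (Mul (Cst h a) s) = a *: pclass s :> palg.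
Proof. by rewrite -pclassZ. Qed.

Lemma pgen_linear : linear (fun x : h => pgen x : palg).
Proof.
move=> a x y; rewrite /pgen /=.
rewrite -pclass_scale -pclass_add; apply/pclassP.
apply: ac_trans (ac_genD _ _ _) _; apply: ac_add; last exact: ac_refl.
exact: ac_genZ.
Qed.

Lemma pgen_comm k l (x y : h) : homog k x -> homog l y ->
  pgen x * pgen y = eps k.2 l.2 *: (pgen y * pgen x) + pgen (brk x y) :> palg.
Proof.
move=> hx hy.
have := ac_rel F hx hy; move=> /pclassP.
rewrite pclass_add pclass_scale !pclass_mul -!/(pgen _) => /(canRL (addrK _)).
rewrite scaleNr opprK addrC => ->; congr (_ + _).
have key F' : pclass (match F' with Sym => Cst h 0 | Univ => Gen (zc_br x y) end)
    = pclass (Gen (match F' with Sym => 0 | Univ => zc_br x y end)).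
  by case: F' => //; rewrite pclass_cst scale0r [RHS](lin0 pgen_linear).
exact: key.
Qed.

Lemma palg_ind (P : palg -> Prop) :
  P 1 -> (forall a u v, P u -> P v -> P (a *: u + v)) ->
  (forall k x u, homog k x -> P u -> P (pgen x * u)) -> forall u, P u.
Proof.
move=> P1 PL Px u.
have PD v w : P v -> P w -> P (v + w).
  by move=> Pv Pw; rewrite -[v]scale1r; apply: PL.
have PZ a v : P v -> P (a *: v).
  move=> Pv; have P0 : P 0 by rewrite -(addNr v) -scaleN1r; apply: PL.
  by rewrite -[_ *: _]addr0; apply: PL.
(* The trailing factor [v] carries the induction through products, [(s t) v] being read as
   [s (t v)]. *)
suff Pm s v : P v -> P (pclass s * v).
  by elim/pclass_ind: u => s; rewrite -[pclass s]mulr1; apply: Pm.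
elim: s v => [x|a|s IHs t IHt|s IHs t IHt] v Pv.
- have := pgen_linear; rewrite -/(pgen x) => gl.
  elim/zclie_ind: x => [x y Pxv Pyv|k x hx]; last exact: Px hx Pv.
  by rewrite (linD gl) mulrDl; apply: PD.
- by rewrite pclass_cst -scalerAl mul1r; apply: PZ.
- by rewrite pclass_add mulrDl; apply: PD; [apply: IHs|apply: IHt].
- by rewrite pclass_mul -mulrA; apply/IHs/IHt.
Qed.

End PalgBasics.

Section Representation.
Variables (K : fieldType) (G : zmodType) (eps : commfactor K G).
Variables (F : algkind) (h : zclie eps) (W : lmodType K).
Variables (P : W -> Prop) (rho : int * G -> h -> W -> W).
Local Notation palg := (palg F h).
Local Notation pgen := (pgen F).
Local Notation pclass := (@pclass K G eps F h).

(* In the application to the splitting below, [W] consists of all functions   *)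
(* of several variables, and [P] singles out the multilinear ones.            *)
Record is_rep : Prop := IsRep {
  rep_sub : forall a u v, P u -> P v -> P (a *: u + v);
  rep_stable : forall k x w, homog k x -> P w -> P (rho k x w);
  rep_linear : forall k x, linear (rho k x);
  rep_linearl : forall k w, P w -> linear (fun x => rho k x w);
  rep_comm : forall k l x y w, homog k x -> homog l y -> P w ->
    rho k x (rho l y w) =
      eps k.2 l.2 *: rho l y (rho k x w) + rho (k + l) (brk F x y) w
}.

Fixpoint act_term (s : aterm h) (w : W) : W :=
  match s with
  | Gen x => gext (fun k y => rho k y w) x
  | Cst a => a *: w
  | Add s t => act_term s w + act_term t w
  | Mul s t => act_term s (act_term t w)
  end.

Definition act (u : palg) (w : W) : W := act_term (repr u) w.

Hypothesis rep : is_rep.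

Let P_D w w' : P w -> P w' -> P (w + w').
Proof. by move=> Pw Pw'; rewrite -[w]scale1r; apply: rep_sub. Qed.

Let P_0 w : P w -> P 0.
Proof. by move=> Pw; rewrite -(addNr w) -scaleN1r; apply: (rep_sub rep). Qed.

Let P_Z a w : P w -> P (a *: w).
Proof. by move=> Pw; rewrite -[_ *: _]addr0; apply/(rep_sub rep)/P_0/Pw. Qed.

Let gen_homog k x w : P w -> homog k x -> act_term (Gen x) w = rho k x w.
Proof.
move=> Pw hx; apply: gext_homog => // l.
exact: (lin0 (rep_linearl rep l Pw)).
Qed.

Let gen_linear w : P w -> linear (fun x => act_term (Gen x) w).
Proof. by move=> Pw; apply: gext_linear => k; apply: (rep_linearl rep). Qed.

Lemma act_term_stable s w : P w -> P (act_term s w).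
Proof.
elim: s w => [x|a|s IHs t IHt|s IHs t IHt] w Pw /=.
- apply: (big_ind P) => [|v v'|k _]; first exact: P_0 Pw.
    exact: P_D.
  by apply: rep_stable => //; apply: homog_pr.
- exact: P_Z.
- by apply: P_D; [apply: IHs|apply: IHt].
- by apply/IHs/IHt.
Qed.

Lemma act_term_linear s a u v : P u -> P v ->
  act_term s (a *: u + v) = a *: act_term s u + act_term s v.
Proof.
elim: s u v => [x|b|s IHs t IHt|s IHs t IHt] u v Pu Pv.
- have Pw := rep_sub rep a Pu Pv.
  elim/zclie_ind: x => [x y hx hy|k x hx].
    rewrite !(linD (gen_linear _))// hx hy scalerDr -!addrA; congr (_ + _).
    by rewrite addrCA.
  by rewrite !(gen_homog _ hx)// (rep_linear rep).
- by rewrite /= scalerDr !scalerA [b * a]mulrC.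
- by rewrite /= IHs// IHt// scalerDr -!addrA; congr (_ + _); rewrite addrCA.
- by rewrite /= IHt// IHs//; apply: act_term_stable.
Qed.

(** The algebra axioms hold in the module by linearity of the action and stability of [P]; the
    defining relation is [rep_comm]. *)
Lemma act_term_cong s t w : acong F s t -> P w -> act_term s w = act_term t w.
Proof.
move=> st; elim: st w => {s t}.
- by [].
- by move=> s t _ IH w Pw; rewrite IH.
- by move=> s t u _ IH1 _ IH2 w Pw; rewrite IH1// IH2.
- by move=> s s' t t' _ IH1 _ IH2 w Pw /=; rewrite IH1// IH2.
- by move=> s s' t t' _ IH1 _ IH2 w Pw /=; rewrite IH2// IH1//; apply: act_term_stable.
- by move=> s t u w Pw /=; rewrite addrA.
- by move=> s t w Pw /=; rewrite addrC.
- by move=> s w Pw /=; rewrite scale0r add0r.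
- by move=> s w Pw /=; rewrite scale0r scaleN1r addNr.
- by [].
- by move=> s w Pw /=; rewrite scale1r.
- by [].
- move=> s t u w Pw /=; rewrite -[X in act_term s (X + _)]scale1r.
  by rewrite act_term_linear ?scale1r//; apply: act_term_stable.
- by move=> a b w Pw /=; rewrite scalerDl.
- by move=> a b w Pw /=; rewrite scalerA.
- move=> a s w Pw /=; rewrite -[a *: w]addr0 act_term_linear//; last exact: P_0 Pw.
  have -> : act_term s 0 = 0.
    have P0 := P_0 Pw.
    have := act_term_linear s (-1) P0 P0.
    by rewrite scaler0 addr0 scaleN1r addNr.
  by rewrite addr0.
- by move=> x y w Pw; rewrite [LHS](linD (gen_linear Pw)).
- by move=> a x w Pw; rewrite [LHS](linZ (gen_linear Pw)).
- move=> k l x y hx hy w Pw.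
  have Pgen m z v : P v -> homog m z -> P (rho m z v).
    by move=> Pv hz; apply: rep_stable.
  have -> : act_term (Add (Mul (Gen x) (Gen y))
      (Mul (Cst h (- eps k.2 l.2)) (Mul (Gen y) (Gen x)))) w =
      rho k x (rho l y w) - eps k.2 l.2 *: rho l y (rho k x w).
    have E1 m z v : P v -> homog m z -> gext (fun k y => rho k y v) z = rho m z v.
      exact: gen_homog.
    by rewrite /= (E1 l y w)// (E1 k x w)// (E1 k x)//; last (by exact: Pgen);
      rewrite (E1 l y)//; last (by exact: Pgen); rewrite scaleNr.
  rewrite (rep_comm rep hx hy Pw) addrC addKr.
  have := homog_brk F hx hy; rewrite /brk; case: (F) => hxy.
    by rewrite /= scale0r (lin0 (rep_linearl rep _ Pw)).
  by rewrite (gen_homog Pw hxy).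
Qed.

Lemma act_pclass s w : P w -> act (pclass s) w = act_term s w.
Proof. by move=> Pw; apply: act_term_cong => //; apply: reprP. Qed.

Lemma act_stable u w : P w -> P (act u w).
Proof. exact: act_term_stable. Qed.

Lemma act_linearl w : P w -> linear (act^~ w).
Proof.
move=> Pw a u v /=; elim/pclass_ind: u => s; elim/pclass_ind: v => t.
by rewrite -pclass_scale -pclass_add !act_pclass.
Qed.

Lemma act1 w : P w -> act 1 w = w.
Proof. by move=> Pw; rewrite [act _ _](act_pclass (Cst h 1))//= scale1r. Qed.

Lemma actM u v w : P w -> act (u * v) w = act u (act v w).
Proof.
move=> Pw; elim/pclass_ind: u => s; elim/pclass_ind: v => t.
by rewrite -pclass_mul !act_pclass//; apply: act_term_stable.
Qed.

Lemma act_gen k x w : homog k x -> P w -> act (pgen x) w = rho k x w.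
Proof. by move=> hx Pw; rewrite act_pclass// (gen_homog Pw hx). Qed.

End Representation.

(** * The bigrading of the presented algebras *)

Section Grading.
Variables (K : fieldType) (G : zmodType) (eps : commfactor K G).
Variables (F : algkind) (h : zclie eps).
Local Notation palg := (palg F h).
Local Notation pgen := (pgen F).
Local Notation pdeg := (pdeg F h).

Lemma pdeg1 : pdeg 0 1.
Proof.
apply: lspan_gen; exists 0%N, (fun=> 0), (fun=> 0); split; first by case.
  by rewrite big_ord0.
by rewrite big_ord0.
Qed.

Lemma pdegL k a u v : pdeg k u -> pdeg k v -> pdeg k (a *: u + v).
Proof. by move=> hu hv; apply: lspanD => //; apply: lspanZ. Qed.

Lemma pdeg0 k : pdeg k 0. Proof. exact: lspan0. Qed.

Lemma pdeg_genM k l x u : homog k x -> pdeg l u -> pdeg (k + l) (pgen x * u).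
Proof.
move=> hx; elim/lspan_ind => [|a v w hv hw|_ [n [d [y [hy <- ->]]]]].
- by rewrite mulr0; apply: pdeg0.
- by rewrite mulrDr -scalerAr; apply: pdegL.
apply: lspan_gen.
exists n.+1, (fun i => if unlift ord0 i is Some j then d j else k),
  (fun i => if unlift ord0 i is Some j then y j else x); split.
- by move=> i; case: (unliftP ord0 i).
- rewrite big_ord_recl unlift_none; congr (_ + _).
  by apply: eq_bigr => i _; rewrite liftK.
- rewrite big_ord_recl unlift_none; congr (_ * _).
  by apply: eq_bigr => i _; rewrite liftK.
Qed.

Lemma pdeg_gen k x : homog k x -> pdeg k (pgen x : palg).
Proof.
by move=> hx; rewrite -[k]addr0 -[pgen x]mulr1; apply: pdeg_genM hx pdeg1.
Qed.

Lemma pdeg_ind (P : int * G -> palg -> Prop) :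
  P 0 1 -> (forall k, P k 0) ->
  (forall k a u v, P k u -> P k v -> P k (a *: u + v)) ->
  (forall k l x u, homog k x -> P l u -> P (k + l) (pgen x * u)) ->
  forall k u, pdeg k u -> P k u.
Proof.
move=> P1 P0 PL Px k u; elim/lspan_ind => // [a v w|_ [n [d [x [hx <- ->]]]]].
  exact: PL.
elim: n d x hx => [|n IH] d x hx; first by rewrite !big_ord0.
by rewrite !big_ord_recl; apply: Px => //; apply: IH.
Qed.

Lemma pdegM k l u v : pdeg k u -> pdeg l v -> pdeg (k + l) (u * v).
Proof.
move=> hu hv; move: k u hu; apply: pdeg_ind.
- by rewrite add0r mul1r.
- by move=> k; rewrite mul0r; apply: pdeg0.
- by move=> k a u u' hu hu'; rewrite mulrDl -scalerAl; apply: pdegL.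
- by move=> k m x u hx hu; rewrite -addrA -mulrA; apply: pdeg_genM.
Qed.

(** The argument of [f] records a degree, and multiplying by a generator of degree [k] shifts it by
    [k]. Acting on the unit concentrated in degree 0 thus sorts an element by degree, which defines
    its components [acomp]. *)
Let rho (k : int * G) (x : h) (f : int * G -> palg) : int * G -> palg :=
  fun l => pgen x * f (l - k).

Let rho_rep : is_rep F (fun=> True) rho.
Proof.
split=> //.
- move=> k x a f g; apply/funext => l; rewrite /rho.
  rewrite [(a *: f + g) (l - k)](_ : _ = a *: f (l - k) + g (l - k))//.
  by rewrite mulrDr -scalerAr.
- move=> k f _ a x y; apply/funext => l.
  rewrite [RHS](_ : _ = a *: (pgen x * f (l - k)) + pgen y * f (l - k))//.
  by rewrite /rho (pgen_linear F (h:=h)) mulrDl -scalerAl.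
- move=> k l x y f hx hy _; apply/funext => m.
  rewrite [RHS](_ : _ = eps k.2 l.2 *: (pgen y * (pgen x * f (m - l - k)))
    + pgen (brk F x y) * f (m - (k + l)))//.
  rewrite /rho mulrA (pgen_comm F hx hy) mulrDl -scalerAl -mulrA.
  rewrite [m - k - l]addrAC; congr (_ + pgen _ * f _).
  by rewrite opprD addrA addrAC.
Qed.

Definition acomp (u : palg) (k : int * G) : palg :=
  act rho u (fun l => (l == 0)%:R) k.

Lemma acomp_linear k : linear (acomp^~ k).
Proof. by move=> a u v /=; rewrite /acomp (act_linearl rho_rep). Qed.

Lemma acomp1 k : acomp 1 k = (k == 0)%:R.
Proof. by rewrite /acomp (act1 rho_rep). Qed.

Lemma acomp_genM k x u l :
  homog k x -> acomp (pgen x * u) l = pgen x * acomp u (l - k).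
Proof. by move=> hx; rewrite /acomp (actM rho_rep)// (act_gen rho_rep hx). Qed.

Lemma acomp_finite u : finite_set [set k | acomp u k != 0].
Proof.
suff [s hs] : exists s : seq (int * G), forall k, k \notin s -> acomp u k = 0.
  exact: seq_finite_supp hs.
elim/palg_ind: u => [|a u v [s hs] [t ht]|k x u hx [s hs]].
- exists [:: 0] => k; rewrite inE acomp1 => /negbTE ->; exact: mulr0n.
- exists (s ++ t) => k; rewrite mem_cat negb_or => /andP[/hs ks /ht kt].
  by rewrite acomp_linear ks kt scaler0 addr0.
- exists [seq l + k | l <- s] => l; rewrite (acomp_genM _ _ hx) => lk.
  rewrite hs ?mulr0//; apply: contra lk => lk.
  by apply/mapP; exists (l - k) => //; rewrite subrK.
Qed.

Lemma acomp_deg u k : pdeg k (acomp u k).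
Proof.
elim/palg_ind: u k => [|a u v hu hv|l x u hx hu] k.
- rewrite acomp1; case: eqP => [->|_]; [exact: pdeg1|exact: pdeg0].
- by rewrite acomp_linear; apply: pdegL.
- by rewrite (acomp_genM _ _ hx) -[X in pdeg X](subrKC l); apply: pdeg_genM.
Qed.

(** Independence of the spans [pdeg k]; together with [acomp_deg] and [acomp_sum] it yields a direct
    sum decomposition. *)
Lemma acomp_pdeg k u l : pdeg k u -> acomp u l = if l == k then u else 0.
Proof.
move=> hu; move: k u hu l.
apply: (@pdeg_ind (fun k u => forall l, acomp u l = if l == k then u else 0)).
- by move=> l; rewrite acomp1; case: eqP.
- by move=> k l; rewrite (lin0 (acomp_linear l)); case: ifP.
- move=> k a u v hu hv l; rewrite acomp_linear hu hv; case: ifP => // _.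
  by rewrite scaler0 addr0.
- move=> k m x u hx hu l; rewrite (acomp_genM _ _ hx) hu.
  by rewrite subr_eq [m + k]addrC; case: ifP; rewrite ?mulr0.
Qed.

Lemma acomp_sum u : u = \sum_(k \in [set: int * G]) acomp u k.
Proof.
elim/palg_ind: u => [|a u v hu hv|k x u hx hu].
- by rewrite (@fsum1 _ _ 0) ?acomp1 ?eqxx// => k /negbTE k0; rewrite acomp1 k0.
- have := fsum_linear (@acomp_linear) (@acomp_finite).
  by move=> sl; rewrite [RHS]sl -hu -hv.
- rewrite {1}hu (@lin_fsum _ _ _ (fun v => pgen x * v)); last first.
  + exact: acomp_finite.
  + by move=> a v w; rewrite mulrDr -scalerAr.
  rewrite (@reindex_fsbigT _ _ _ _ _ (fun l => l - k)) /=; last first.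
    by exists (fun l => l + k) => l; rewrite ?addrK ?subrK.
  by apply: eq_fsbigr => l _; rewrite (acomp_genM _ _ hx).
Qed.

End Grading.

(** * Universal properties of the presented algebras and of tensor products *)

Section AlgebraMorphisms.
Variables (K : fieldType) (G : zmodType) (eps : commfactor K G).
Variables (F : algkind) (h : zclie eps) (A : algType K) (f : h -> A).
Hypothesis f_lin : linear f.
Hypothesis f_comm : forall k l x y, homog k x -> homog l y ->
  f x * f y = eps k.2 l.2 *: (f y * f x) + f (brk F x y).
Local Notation palg := (palg F h).
Local Notation pgen := (pgen F).
Local Notation pclass := (@pclass K G eps F h).

Lemma aeval_cong s t : acong F s t -> aeval f s = aeval f t.
Proof.
elim=> {s t} /=.
- by [].
- by [].
- by move=> s t u _ -> _ ->.
- by move=> s s' t t' _ -> _ ->.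
- by move=> s s' t t' _ -> _ ->.
- by move=> *; rewrite addrA.
- by move=> *; rewrite addrC.
- by move=> *; rewrite scale0r add0r.
- by move=> *; rewrite -scalerAl mul1r scaleN1r addNr scale0r.
- by move=> *; rewrite mulrA.
- by move=> *; rewrite scale1r mul1r.
- by move=> *; rewrite mulrDl.
- by move=> *; rewrite mulrDr.
- by move=> *; rewrite scalerDl.
- by move=> a b; rewrite -scalerAl mul1r scalerA.
- by move=> a s; rewrite -scalerAl -scalerAr mul1r mulr1.
- by move=> x y; rewrite (linD f_lin).
- by move=> a x; rewrite (linZ f_lin) -scalerAl mul1r.
- move=> k l x y hx hy; rewrite (f_comm hx hy) -scalerAl mul1r scaleNr.
  rewrite addrAC subrr add0r /brk.
  by case: (F) => //=; rewrite (lin0 f_lin) scale0r.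
Qed.

Lemma peval_pclass s : peval f (pclass s) = aeval f s.
Proof. by apply: aeval_cong; apply: reprP. Qed.

Lemma peval_linear : linear (@peval _ _ _ F h A f).
Proof.
move=> a u v; elim/pclass_ind: u => s; elim/pclass_ind: v => t.
by rewrite -pclass_scale -pclass_add !peval_pclass /= -scalerAl mul1r.
Qed.

Lemma pevalM u v : @peval _ _ _ F h A f (u * v) = peval f u * peval f v.
Proof.
elim/pclass_ind: u => s; elim/pclass_ind: v => t.
by rewrite -pclass_mul !peval_pclass.
Qed.

Lemma peval1 : @peval _ _ _ F h A f 1 = 1.
Proof. by rewrite [LHS](peval_pclass (Cst h 1)) /= scale1r. Qed.

Lemma peval_gen x : peval f (pgen x) = f x.
Proof. exact: peval_pclass. Qed.

End AlgebraMorphisms.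

Section TensorMaps.
Variables (K : fieldType) (A B : lmodType K).
Local Notation tens := (tens A B).

Lemma tclass_ind (P : tens -> Prop) : (forall s, P (tclass s)) -> forall t, P t.
Proof. by move=> Ps t; rewrite -[t]reprK; apply: Ps. Qed.

Lemma tclass_add s t : tclass (TAdd s t) = tclass s + tclass t :> tens.
Proof. by rewrite -tclassD. Qed.
Lemma tclass_scale a s : tclass (TScale a s) = a *: tclass s :> tens.
Proof. by rewrite -tclassZ. Qed.

Lemma tpure_linearl y : linear (fun x => tpure x y : tens).
Proof.
move=> a x x'; rewrite -tclass_scale -tclass_add; apply/tclassP.
apply: tc_trans (tc_pureDl _ _ _) _; apply: tc_add; last exact: tc_refl.
exact: tc_pureZl.
Qed.
Lemma tpure_linearr x : linear (fun y => tpure x y : tens).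
Proof.
move=> a y y'; rewrite -tclass_scale -tclass_add; apply/tclassP.
apply: tc_trans (tc_pureDr _ _ _) _; apply: tc_add; last exact: tc_refl.
exact: tc_pureZr.
Qed.

Lemma tens_ind (P : tens -> Prop) :
  (forall a u v, P u -> P v -> P (a *: u + v)) ->
  (forall x y, P (tpure x y)) -> forall t, P t.
Proof.
move=> PL Pp; apply: tclass_ind; elim=> [x y|a s IH|s IHs t IHt].
- exact: Pp.
- rewrite tclass_scale -[_ *: _]addr0; apply: (PL) => //.
  exact: Pp 0 0.
- by rewrite tclass_add -[tclass s]scale1r; apply: PL.
Qed.

Section Eval.
Variables (W : lmodType K) (f : A -> B -> W).
Hypothesis fl : forall y, linear (f^~ y).
Hypothesis fr : forall x, linear (f x).

Lemma teval_cong s t : tcong s t -> teval_term f s = teval_term f t.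
Proof.
elim=> {s t} /=.
- by [].
- by [].
- by move=> s t u _ -> _ ->.
- by move=> s s' t t' _ -> _ ->.
- by move=> a s s' _ ->.
- by move=> *; rewrite addrA.
- by move=> *; rewrite addrC.
- by move=> s; rewrite (lin0 (fr 0)) add0r.
- by move=> s; rewrite (lin0 (fr 0)) scaleN1r addNr.
- by move=> *; rewrite scalerA.
- by move=> *; rewrite scale1r.
- by move=> *; rewrite scalerDr.
- by move=> *; rewrite scalerDl.
- by move=> x x' y; rewrite (linD (fl y)).
- by move=> x y y'; rewrite (linD (fr x)).
- by move=> a x y; rewrite (linZ (fl y)).
- by move=> a x y; rewrite (linZ (fr x)).
Qed.

Lemma teval_tclass s : teval f (tclass s) = teval_term f s.
Proof. by apply: teval_cong; apply: treprP. Qed.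

Lemma teval_linear : linear (teval f).
Proof.
move=> a s t; elim/tclass_ind: s => s; elim/tclass_ind: t => t.
by rewrite -tclass_scale -tclass_add !teval_tclass.
Qed.

Lemma teval_pure x y : teval f (tpure x y) = f x y.
Proof. exact: teval_tclass. Qed.

End Eval.

Lemma tens_lin_ext (W : lmodType K) (f g : tens -> W) :
  linear f -> linear g -> (forall x y, f (tpure x y) = g (tpure x y)) -> f =1 g.
Proof.
by move=> fl gl fg; apply: tens_ind => // a u v hu hv; rewrite fl gl hu hv.
Qed.

End TensorMaps.

(** * The isomorphism F(g_-) (x) F(g_+) = F(g) *)

Section DegreeLift.
Variables (K : fieldType) (G : zmodType) (eps : commfactor K G) (L : zclie eps).
Variables (D : pred int) (addD : forall i j, D i -> D j -> D (i + j)).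
Local Notation g := (degsub L addD).

Lemma degval_linear : linear (fun x : g => val x : L).
Proof. by []. Qed.

Lemma degval_brk F (x y : g) : val (brk F x y) = brk F (val x : L) (val y : L).
Proof. by rewrite /brk; case: F. Qed.

Lemma homog_degval k (x : g) : homog k x <-> homog k (val x : L).
Proof.
split=> hx; first exact: (congr1 val hx).
by apply: val_inj; exact: hx.
Qed.

Lemma homog_deg0 k (x : g) : ~~ D k.1 -> homog k x -> x = 0.
Proof.
move=> Dk /homog_degval hx; apply: val_inj; rewrite /= -hx.
by have /asboolP := valP x; apply.
Qed.

(* [0] when the degree of [k] is not in [D].                                  *)
Definition deglift (k : int * G) (z : L) : g := insubd 0 (zc_pr k z).

Lemma deglift_val k z : val (deglift k z) = if D k.1 then zc_pr k z else 0.
Proof.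
rewrite /deglift val_insubd; case: ifPn => [/asboolP h|/asboolP h].
  by case: ifPn => // Dk; rewrite -(h k Dk) zc_pr_pr eqxx.
case: ifPn => // Dk; case: h => l Dl; rewrite zc_pr_pr; case: eqP => // lk.
by rewrite lk Dk in Dl.
Qed.

Lemma deglift_linear k : linear (deglift k).
Proof.
move=> a x y; apply: val_inj; rewrite [RHS](degval_linear a).
rewrite !deglift_val; case: ifP => _; first exact: zc_pr_linear.
by rewrite scaler0 addr0.
Qed.

Lemma deglift_homog k (x : g) : homog k x -> deglift k (val x) = x.
Proof.
move=> hx; apply: val_inj; rewrite deglift_val.
case: ifPn => Dk; first by have /homog_degval := hx.
by rewrite (homog_deg0 Dk hx).
Qed.

Lemma homog_deglift k (z : L) : homog k (deglift k z).
Proof.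
apply/homog_degval; rewrite deglift_val; case: ifP => _; last exact: homog0.
exact: homog_pr.
Qed.

End DegreeLift.

Section Splitting.
Variables (K : fieldType) (G : zmodType) (eps : commfactor K G).
Variables (F : algkind) (L : zclie eps).
Local Notation gm := (gminus L).
Local Notation gp := (gplus L).
Local Notation Um := (palg F gm).
Local Notation Up := (palg F gp).
Local Notation M := (tsplit F L).
Local Notation liftm := (deglift (@minus_closed) ).
Local Notation liftp := (deglift (@plus_closed)).
Local Notation pgen := (pgen F).

Lemma incl_val_comm (D : pred int) (addD : forall i j, D i -> D j -> D (i + j)) k l
    (x y : degsub L addD) : homog k x -> homog l y ->
  pgen (val x : L) * pgen (val y : L) =
  eps k.2 l.2 *: (pgen (val y : L) * pgen (val x : L)) + pgen (val (brk F x y) : L)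
    :> palg F L.
Proof.
by move=> /homog_degval hx /homog_degval hy; rewrite degval_brk; apply: pgen_comm.
Qed.

Let vgen_lin (D : pred int) (addD : forall i j, D i -> D j -> D (i + j)) :
  linear (fun x : degsub L addD => pgen (val x : L) : palg F L).
Proof. by apply: lin_comp; [exact: pgen_linear|exact: degval_linear]. Qed.

Lemma incl_minus_linear : linear (@incl_minus _ _ _ F L).
Proof. apply: peval_linear; [exact: vgen_lin|exact: incl_val_comm]. Qed.
Lemma incl_plus_linear : linear (@incl_plus _ _ _ F L).
Proof. apply: peval_linear; [exact: vgen_lin|exact: incl_val_comm]. Qed.
Lemma incl_minusM u v : @incl_minus _ _ _ F L (u * v) = incl_minus u * incl_minus v.
Proof. apply: pevalM; [exact: vgen_lin|exact: incl_val_comm]. Qed.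
Lemma incl_plusM u v : @incl_plus _ _ _ F L (u * v) = incl_plus u * incl_plus v.
Proof. apply: pevalM; [exact: vgen_lin|exact: incl_val_comm]. Qed.
Lemma incl_minus1 : @incl_minus _ _ _ F L 1 = 1.
Proof. apply: peval1; [exact: vgen_lin|exact: incl_val_comm]. Qed.
Lemma incl_plus1 : @incl_plus _ _ _ F L 1 = 1.
Proof. apply: peval1; [exact: vgen_lin|exact: incl_val_comm]. Qed.
Lemma incl_minus_gen (x : gm) : incl_minus (pgen x : Um) = pgen (val x : L).
Proof. apply: peval_gen; [exact: vgen_lin|exact: incl_val_comm]. Qed.
Lemma incl_plus_gen (x : gp) : incl_plus (pgen x : Up) = pgen (val x : L).
Proof. apply: peval_gen; [exact: vgen_lin|exact: incl_val_comm]. Qed.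

Let mult_l b : linear (fun a => @incl_minus _ _ _ F L a * incl_plus b).
Proof. by move=> c u v; rewrite incl_minus_linear mulrDl -scalerAl. Qed.
Let mult_r a : linear (fun b => @incl_minus _ _ _ F L a * incl_plus b).
Proof. by move=> c u v; rewrite incl_plus_linear mulrDr -scalerAr. Qed.

Lemma multmap_linear : linear (@multmap _ _ _ F L).
Proof. exact: teval_linear mult_l mult_r. Qed.
Lemma multmap_pure a b : multmap (tpure a b : M) = incl_minus a * incl_plus b.
Proof. exact: teval_pure mult_l mult_r a b. Qed.

Definition lmul (a : Um) : M -> M := teval (fun a' b => tpure (a * a') b).

Let lmul_l a b : linear (fun a' => tpure (a * a') b : M).
Proof. by move=> c u v; rewrite mulrDr -scalerAr (tpure_linearl b c). Qed.
Let lmul_r a a' : linear (fun b => tpure (a * a') b : M).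
Proof. exact: tpure_linearr. Qed.

Lemma lmul_linear a : linear (lmul a).
Proof. exact: teval_linear (lmul_l a) (lmul_r a). Qed.
Lemma lmul_pure a a' b : lmul a (tpure a' b) = tpure (a * a') b.
Proof. exact: teval_pure (lmul_l a) (lmul_r a) a' b. Qed.
Lemma lmul_linearl m : linear (lmul^~ m).
Proof.
move=> c a a'; move: m; apply: tens_lin_ext => [||x y].
- exact: lmul_linear.
- move=> d u v; rewrite !lmul_linear; lmodule K M; ring.
- by rewrite !lmul_pure mulrDl -scalerAl (tpure_linearl y c).
Qed.
Lemma lmulM a a' m : lmul (a * a') m = lmul a (lmul a' m).
Proof.
move: m; apply: tens_lin_ext => [||x y]; first exact: lmul_linear.
  exact: lin_comp (lmul_linear a) (lmul_linear a').
by rewrite !lmul_pure mulrA.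
Qed.
Lemma lmul1 m : lmul 1 m = m.
Proof.
by move: m; apply: tens_lin_ext => [||x y] //; [exact: lmul_linear|rewrite lmul_pure mul1r].
Qed.

Local Notation W := (int * G -> L -> Up -> M).

(* [rho] lets g_- act on functions [f k z b], thought of as "z a b" for z of  *)
(* bidegree [k] and varying a in F(g_-), by the rule                          *)
(* z x a = eps(z, x) x z a + [z, x] a.                                        *)
Let rho (al : int * G) (x : gm) (f : W) : W := fun k z b =>
  eps k.2 al.2 *: lmul (pgen x) (f k z b)
  + f (k + al) (brk F (zc_pr k z) (val x : L)) b.

Let bilin (f : W) := (forall k b, linear (fun z => f k z b)) /\
  (forall k z, linear (f k z)).

(** The relation between two generators of g_- holds by the Jacobi identity and multiplicativity of
    [eps]. *)
Let rho_rep : is_rep F bilin rho.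
Proof.
split.
- move=> a u v [u1 u2] [v1 v2]; split.
    move=> k b c x y.
    rewrite [LHS](_ : _ = a *: u k (c *: x + y) b + v k (c *: x + y) b)//.
    rewrite (u1 k b) (v1 k b) [RHS](_ : _ = c *: (a *: u k x b + v k x b) +
      (a *: u k y b + v k y b))//.
    lmodule K M; ring.
  move=> k z c x y.
  rewrite [LHS](_ : _ = a *: u k z (c *: x + y) + v k z (c *: x + y))//.
  rewrite (u2 k z) (v2 k z) [RHS](_ : _ = c *: (a *: u k z x + v k z x) +
    (a *: u k z y + v k z y))//.
  lmodule K M; ring.
- move=> al x f hx [f1 f2]; split.
    move=> k b c y z; rewrite /rho (f1 k b) lmul_linear zc_pr_linear.
    rewrite brk_linearl (f1 (k + al) b).
    lmodule K M; ring.
  move=> k z c b b'; rewrite /rho (f2 k z) lmul_linear (f2 (k + al)).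
  lmodule K M; ring.
- move=> al x a f f'; apply/funext => k; apply/funext => z; apply/funext => b.
  rewrite [RHS](_ : _ = a *: rho al x f k z b + rho al x f' k z b)//.
  rewrite /rho [(a *: f + f') k z b](_ : _ = a *: f k z b + f' k z b)//.
  rewrite [(a *: f + f') (k + al) _ b](_ : _ =
    a *: f (k + al) (brk F (zc_pr k z) (val x : L)) b +
    f' (k + al) (brk F (zc_pr k z) (val x : L)) b)//.
  rewrite lmul_linear; lmodule K M; ring.
- move=> al f [f1 f2] a x x'.
  apply/funext => k; apply/funext => z; apply/funext => b.
  rewrite [RHS](_ : _ = a *: rho al x f k z b + rho al x' f k z b)//.
  rewrite /rho pgen_linear lmul_linearl degval_linear brk_linearr (f1 _ b).
  lmodule K M; ring.
move=> al be x y f hx hy [f1 f2].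
apply/funext => k; apply/funext => z; apply/funext => b.
rewrite [RHS](_ : _ = eps al.2 be.2 *: rho be y (rho al x f) k z b +
  rho (al + be) (brk F x y) f k z b)//.
set zk := zc_pr k z.
have hz : homog k zk by exact: homog_pr.
move/homog_degval: (hx) => hvx; move/homog_degval: (hy) => hvy.
(* The projection inside [rho] makes the relation true for arbitrary [z]; on a bracket of
   homogeneous elements a second projection changes nothing. *)
have prx : zc_pr (k + al) (brk F zk (val x : L)) = brk F zk (val x : L).
  exact: homog_brk.
have pry : zc_pr (k + be) (brk F zk (val y : L)) = brk F zk (val y : L).
  exact: homog_brk.
rewrite /rho -/zk prx pry degval_brk (brk_jacobir F hz hvx hvy).
rewrite (linB (f1 _ b)) (linZ (f1 _ b)) !(linD (lmul_linear _)) !(linZ (lmul_linear _)).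
rewrite -!lmulM (pgen_comm F hx hy) (linD (lmul_linearl _)) (linZ (lmul_linearl _)).
rewrite [k + be + al]addrAC [k + (al + be)]addrA !snd_add !cf_Dr !cf_Dl.
have e1 := cf_sym eps al.2 be.2; lmodule K M; ring: e1.
Qed.

(** The product [z a b] at [a = 1]: in degree at most 0, [z] becomes the left factor, and in
    positive degree it multiplies [b]. *)
Let base : W := fun k z b =>
  if k.1 <= 0 then tpure (pgen (liftm k z)) b else tpure 1 (pgen (liftp k z) * b).

Let base_bilin : bilin base.
Proof.
split=> [k b|k z] a x y; rewrite /base; case: ifP => _.
- by rewrite deglift_linear pgen_linear (tpure_linearl b a).
- rewrite deglift_linear pgen_linear mulrDl -scalerAl.
  by rewrite (tpure_linearr 1 a).
- by rewrite (tpure_linearr _ a).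
- by rewrite mulrDr -scalerAr (tpure_linearr 1 a).
Qed.

Let ext (a : Um) : W := act rho a base.

Let ext_bilin a : bilin (ext a).
Proof. exact: act_stable rho_rep _ _ base_bilin. Qed.

Let ext_linear k z b : linear (fun a => ext a k z b).
Proof. by move=> c u v; rewrite /ext (act_linearl rho_rep base_bilin). Qed.

(* Corresponds to left multiplication by [z] in F(g).                         *)
Definition gact (k : int * G) (z : L) : M -> M :=
  teval (fun a b => ext a k z b).

Lemma gact_linear k z : linear (gact k z).
Proof.
apply: teval_linear => [b|a]; first exact: ext_linear.
by have [_] := ext_bilin a; apply.
Qed.

Let gact_pure k z a b : gact k z (tpure a b) = ext a k z b.
Proof.
apply: teval_pure => [b'|a']; first exact: ext_linear.
by have [_] := ext_bilin a'; apply.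
Qed.

Lemma gact_linearl k m : linear (fun z => gact k z m).
Proof.
move=> c x y; move: m; apply: tens_lin_ext => [||a b].
- exact: gact_linear.
- by move=> d u v; rewrite !gact_linear; lmodule K M; ring.
- by rewrite !gact_pure; have [-> _] := ext_bilin a.
Qed.

Lemma gact_lmul k z al (x : gm) m : homog al x ->
  gact k z (lmul (pgen x) m) = eps k.2 al.2 *: lmul (pgen x) (gact k z m)
    + gact (k + al) (brk F (zc_pr k z) (val x : L)) m.
Proof.
move=> hx; move: m; apply: tens_lin_ext => [||a b].
- exact: lin_comp (gact_linear k z) (lmul_linear _).
- by move=> d u v; rewrite !gact_linear lmul_linear; lmodule K M; ring.
rewrite lmul_pure !gact_pure /ext (actM rho_rep _ _ base_bilin).
by rewrite (act_gen rho_rep hx)//; apply: ext_bilin.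
Qed.

Lemma gact_minus1 k (x : gm) b : homog k x ->
  gact k (val x : L) (tpure 1 b) = tpure (pgen x) b.
Proof.
move=> hx; rewrite gact_pure /ext (act1 rho_rep base_bilin) /base.
(* An element of g_- homogeneous of positive degree is zero, so both sides vanish in the remaining
   case. *)
case: ifPn => k0; first by rewrite deglift_homog.
rewrite (homog_deg0 k0 hx) !(lin0 (@deglift_linear _ _ _ _ _ _ _)).
rewrite !(lin0 (@pgen_linear _ _ _ _ _)) mul0r.
by rewrite (lin0 (tpure_linearr _)) (lin0 (tpure_linearl _)).
Qed.

Lemma gact_plus1 k (x : gp) b : homog k x ->
  gact k (val x : L) (tpure 1 b) = tpure 1 (pgen x * b).
Proof.
move=> hx; rewrite gact_pure /ext (act1 rho_rep base_bilin) /base.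
case: ifPn => k0; last by rewrite deglift_homog.
have nk : ~~ (0 < k.1) by rewrite -leNgt.
rewrite (homog_deg0 nk hx) !(lin0 (@deglift_linear _ _ _ _ _ _ _)).
rewrite !(lin0 (@pgen_linear _ _ _ _ _)) mul0r.
by rewrite (lin0 (tpure_linearr _)) (lin0 (tpure_linearl _)).
Qed.

Lemma lmul_ind (P : M -> Prop) :
  (forall a u v, P u -> P v -> P (a *: u + v)) ->
  (forall b, P (tpure 1 b)) ->
  (forall k (x : gm) m, homog k x -> P m -> P (lmul (pgen x) m)) ->
  forall m, P m.
Proof.
move=> PL P1 Px; apply: tens_ind => // a b; elim/palg_ind: a => //.
  by move=> c u v hu hv; rewrite (tpure_linearl b c); apply: PL.
by move=> k x a hx IH; rewrite -lmul_pure; apply: Px hx IH.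
Qed.

(** Both sides agree on 1 (x) b and pass a generator of g_- by the same rule, which for left
    multiplication is the relation in F(g_-). *)
Lemma gact_minus k (x : gm) m : homog k x -> gact k (val x : L) m = lmul (pgen x) m.
Proof.
move=> hx; elim/lmul_ind: m k x hx => [c u v hu hv|b|l y m hy IH] k x hx.
- by rewrite gact_linear lmul_linear hu// hv.
- by rewrite gact_minus1// lmul_pure mulr1.
rewrite (gact_lmul _ _ _ hy) IH//.
have /homog_degval hvx := hx.
rewrite hvx -degval_brk IH; last exact: homog_brk.
rewrite -!lmulM (pgen_comm F hx hy).
by rewrite (linD (lmul_linearl _)) (linZ (lmul_linearl _)).
Qed.

(** If y has degree at most 0, it acts by left multiplication and the claim is [gact_lmul];
    antisymmetry covers x of degree at most 0. For two positive degrees the proof is by induction on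
    the first tensor factor: on 1 (x) b the claim is the relation in F(g_+). Passing a generator z
    of g_- produces [x, z] and [y, z], whose degrees may have any sign, and the Jacobi identity
    combines the terms. *)
Lemma gact_comm k l x y m : homog k x -> homog l y ->
  gact k x (gact l y m) =
    eps k.2 l.2 *: gact l y (gact k x m) + gact (k + l) (brk F x y) m.
Proof.
have lift_m k' (x' : L) : homog k' x' -> k'.1 <= 0 -> val (liftm k' x') = x'.
  by move=> hx' k0; rewrite deglift_val k0.
have lift_p k' (x' : L) : homog k' x' -> 0 < k'.1 -> val (liftp k' x') = x'.
  by move=> hx' k0; rewrite deglift_val k0.
have comm_r k' l' x' y' m' : homog k' x' -> homog l' y' -> l'.1 <= 0 ->
    gact k' x' (gact l' y' m') =
    eps k'.2 l'.2 *: gact l' y' (gact k' x' m') + gact (k' + l') (brk F x' y') m'.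
  move=> hx' hy' l0; rewrite -(lift_m _ _ hy' l0).
  have hl := homog_deglift (@minus_closed) l' y'.
  by rewrite !gact_minus// (gact_lmul _ _ _ hl) hx'.
have comm_l k' l' x' y' m' : homog k' x' -> homog l' y' -> k'.1 <= 0 ->
    gact k' x' (gact l' y' m') =
    eps k'.2 l'.2 *: gact l' y' (gact k' x' m') + gact (k' + l') (brk F x' y') m'.
  move=> hx' hy' k0; rewrite (comm_r _ _ _ _ _ hy' hx' k0).
  rewrite (brk_anti F hx' hy') (linN (gact_linearl _ _)) (linZ (gact_linearl _ _)).
  rewrite [l' + k']addrC.
  by have e1 := cf_sym eps k'.2 l'.2; lmodule K M; ring: e1.
move=> hx hy.
have [l0|l0] := leP l.1 0; first exact: comm_r.
have [k0|k0] := leP k.1 0; first exact: comm_l.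
elim/lmul_ind: m k l x y hx hy k0 l0 => [c u v hu hv|b|j z m hz IH] k l x y hx hy k0 l0.
- rewrite !gact_linear hu// hv//; lmodule K M; ring.
- rewrite -(lift_p _ _ hx k0) -(lift_p _ _ hy l0).
  have hk := homog_deglift (@plus_closed) k x.
  have hl := homog_deglift (@plus_closed) l y.
  rewrite -degval_brk !gact_plus1//; last exact: homog_brk.
  rewrite !mulrA (pgen_comm F hk hl) mulrDl -scalerAl.
  by rewrite (linD (tpure_linearr _)) (linZ (tpure_linearr _)).
have comm_all k' l' x' y' : homog k' x' -> homog l' y' ->
    gact k' x' (gact l' y' m) =
    eps k'.2 l'.2 *: gact l' y' (gact k' x' m) + gact (k' + l') (brk F x' y') m.
  move=> hx' hy'; have [l0'|l0'] := leP l'.1 0; first exact: comm_r.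
  have [k0'|k0'] := leP k'.1 0; first exact: comm_l.
  exact: IH.
have hvz : homog j (val z : L) by apply/homog_degval.
have hxz := homog_brk F hx hvz; have hyz := homog_brk F hy hvz.
have hxy := homog_brk F hx hy.
rewrite !(gact_lmul _ _ _ hz) hx hy hxy !(linD (gact_linear _ _)) !(linZ (gact_linear _ _)).
rewrite !(gact_lmul _ _ _ hz) hx hy.
rewrite (comm_all _ _ _ _ hx hy) (comm_all _ _ _ _ hx hyz).
rewrite (comm_all _ _ _ _ hxz hy).
rewrite (brk_jacobi F _ hx hy) (linD (gact_linearl _ _)).
rewrite (brk_anti F hxz hy) (linN (gact_linearl _ _)) !(linZ (gact_linearl _ _)).
rewrite (linD (lmul_linear _)) (linZ (lmul_linear _)).
rewrite [k + j + l]addrAC [k + (l + j)]addrA !snd_add !cf_Dr !cf_Dl.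
have e1 := cf_sym eps l.2 j.2.
by lmodule K M; ring: e1.
Qed.

Let gact_rep : is_rep F (fun=> True) gact.
Proof.
split=> //; [exact: gact_linear|move=> k m _; exact: gact_linearl|].
by move=> k l x y m hx hy _; apply: gact_comm.
Qed.

Definition split_inv (u : palg F L) : M := act gact u (tpure 1 1).

Lemma split_inv_linear : linear split_inv.
Proof. exact: act_linearl gact_rep _ _. Qed.

Let act_minus a m : act gact (incl_minus a) m = lmul a m.
Proof.
elim/palg_ind: a => [|c u v hu hv|k x u hx IH].
- by rewrite incl_minus1 lmul1 (act1 gact_rep).
- by rewrite incl_minus_linear lmul_linearl (act_linearl gact_rep)// hu hv.
rewrite incl_minusM incl_minus_gen (actM gact_rep)// lmulM IH.
have /homog_degval hvx := hx.
by rewrite (act_gen gact_rep hvx)// gact_minus.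
Qed.

Let act_plus b b' : act gact (incl_plus b) (tpure 1 b') = tpure 1 (b * b').
Proof.
elim/palg_ind: b => [|c u v hu hv|k x u hx IH].
- by rewrite incl_plus1 mul1r (act1 gact_rep).
- rewrite incl_plus_linear mulrDl -scalerAl (act_linearl gact_rep)// hu hv.
  by rewrite (tpure_linearr 1 c).
rewrite incl_plusM incl_plus_gen (actM gact_rep)// IH.
have /homog_degval hvx := hx.
by rewrite (act_gen gact_rep hvx)// gact_plus1// mulrA.
Qed.

(** On 1 (x) 1 the part from F(g_+) acts within the second factor, and the part from F(g_-) then
    multiplies the first. *)
Lemma multmapK : cancel (@multmap _ _ _ F L) split_inv.
Proof.
move=> t; move: t; apply: tens_lin_ext => [||a b] //.
  exact: lin_comp split_inv_linear multmap_linear.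
rewrite multmap_pure /split_inv (actM gact_rep)// act_minus act_plus.
by rewrite lmul_pure !mulr1.
Qed.

Lemma multmap_gact k z m : homog k z ->
  multmap (gact k z m) = pgen z * multmap m.
Proof.
elim/lmul_ind: m k z => [c u v hu hv|b|l x m hx IH] k z hz.
- by rewrite gact_linear !multmap_linear hu// hv// mulrDr -scalerAr.
- rewrite multmap_pure incl_minus1 mul1r; have [k0|k0] := leP k.1 0.
    have -> : z = val (liftm k z) by rewrite deglift_val k0.
    rewrite gact_minus1; last exact: homog_deglift.
    by rewrite multmap_pure incl_minus_gen.
  have -> : z = val (liftp k z) by rewrite deglift_val k0.
  rewrite gact_plus1; last exact: homog_deglift.
  by rewrite multmap_pure incl_minus1 mul1r incl_plusM incl_plus_gen.
have hvx : homog l (val x : L) by apply/homog_degval.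
have multmap_lmul m' : multmap (lmul (pgen x) m') = pgen (val x : L) * multmap m'.
  move: m'; apply: tens_lin_ext => [||a b].
  - exact: lin_comp multmap_linear (lmul_linear _).
  - by move=> c u v; rewrite multmap_linear mulrDr -scalerAr.
  - by rewrite lmul_pure !multmap_pure incl_minusM incl_minus_gen mulrA.
rewrite (gact_lmul _ _ _ hx) hz multmap_linear !multmap_lmul IH//.
rewrite (IH _ _ (homog_brk F hz hvx)) !mulrA (pgen_comm F hz hvx) mulrDl.
by rewrite -scalerAl.
Qed.

(** By [multmap_gact], [multmap] carries the action of F(g) to left multiplication, and it sends 1
    (x) 1 to 1. *)
Lemma split_invK : cancel split_inv (@multmap _ _ _ F L).
Proof.
move=> u; rewrite -[RHS]mulr1 /split_inv.
have <- : multmap (tpure 1 1 : M) = 1.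
  by rewrite multmap_pure incl_minus1 incl_plus1 mulr1.
elim/palg_ind: u (tpure 1 1 : M) => [|c u v hu hv|k x u hx IH] m.
- by rewrite mul1r (act1 gact_rep).
- by rewrite (act_linearl gact_rep)// multmap_linear hu hv mulrDl -scalerAl.
by rewrite (actM gact_rep)// (act_gen gact_rep hx)// multmap_gact// IH mulrA.
Qed.

Lemma splitmapE : @splitmap _ _ _ F L = split_inv.
Proof.
apply/funext => u; rewrite /splitmap; case: xgetP => [t _ <-|].
  by rewrite multmapK.
by move=> /(_ (split_inv u)); rewrite /= split_invK.
Qed.

Lemma splitmap_linear : linear (@splitmap _ _ _ F L).
Proof. by rewrite splitmapE; apply: split_inv_linear. Qed.

Lemma splitmapK t : splitmap (multmap t) = t :> M.
Proof. by rewrite splitmapE multmapK. Qed.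

End Splitting.

(** * Components of the split algebra *)

Section TensorGrading.
Variables (K : fieldType) (G : zmodType) (eps : commfactor K G).
Variables (F : algkind) (L : zclie eps).
Local Notation gm := (gminus L).
Local Notation gp := (gplus L).
Local Notation Um := (palg F gm).
Local Notation Up := (palg F gp).
Local Notation M := (tsplit F L).
Local Notation pgen := (pgen F).
Implicit Types (q : (int * G) * nat) (t : M).

(** The index [q] fixes both Z-degrees and the total degree in G; the degree [be] of the second
    factor stays free and is summed over in [tproj]. *)
Let proj_term q (a : Um) (b : Up) (be : G) : M :=
  tpure (acomp a (q.1.1 - q.2%:Z, q.1.2 - be)) (acomp b (q.2%:Z, be)).

Let proj_term0 q a b : exists s : seq G,
  forall be, be \notin s -> acomp b (q.2%:Z, be) = 0 /\ proj_term q a b be = 0.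
Proof.
have [s _ sb] := finite_supp_seq (acomp_finite b).
exists [seq k.2 | k <- s] => be hbe.
have b0 : acomp b (q.2%:Z, be) = 0.
  by apply: sb; apply: contra hbe => hbe; apply/mapP; exists (q.2%:Z, be).
by rewrite /proj_term b0 (lin0 (tpure_linearr _)).
Qed.

Let proj_finite q a b : finite_set [set be | proj_term q a b be != 0].
Proof.
by have [s hs] := proj_term0 q a b; apply: (@seq_finite_supp _ _ _ s) => be /hs[].
Qed.

Definition tproj q : M -> M :=
  teval (fun a b => \sum_(be \in [set: G]) proj_term q a b be).

Let proj_linearl q b : linear (fun a => \sum_(be \in [set: G]) proj_term q a b be).
Proof.
apply: fsum_linear => [be|a]; last exact: proj_finite.
by move=> c a a'; rewrite /proj_term acomp_linear (tpure_linearl _ c).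
Qed.

Let proj_linearr q a : linear (fun b => \sum_(be \in [set: G]) proj_term q a b be).
Proof.
apply: fsum_linear => [be|b]; last exact: proj_finite.
by move=> c b b'; rewrite /proj_term acomp_linear (tpure_linearr _ c).
Qed.

Lemma tproj_linear q : linear (tproj q).
Proof. exact: teval_linear. Qed.

Lemma tsdeg_pure k r al be a b : al + be = k.2 ->
  pdeg F gm (k.1 - r%:Z, al) a -> pdeg F gp (r%:Z, be) b ->
  tsdeg k r (tpure a b : M).
Proof. by move=> *; apply: lspan_gen; exists al, be, a, b; split. Qed.

Lemma tproj_tsdeg k r t q : tsdeg k r t ->
  tproj q t = if q == (k, r) then t else 0.
Proof.
elim/lspan_ind => [|c u v hu hv|_ [al [be [a [b [ab ha hb ->]]]]]].
- by rewrite (lin0 (tproj_linear q)) if_same.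
- by rewrite tproj_linear hu hv; case: ifP => // _; rewrite scaler0 addr0.
rewrite /tproj teval_pure /=; last 2 first.
- exact: proj_linearl.
- exact: proj_linearr.
rewrite (@fsum1 _ _ be) => [|be' bb].
  rewrite /proj_term (acomp_pdeg _ hb) (acomp_pdeg _ ha) !xpair_eqE eqxx andbT.
  case: q => -[i c] s /=; rewrite !xpair_eqE; case: (s =P r) => [->|sr]; last first.
    have -> : (s%:Z == r%:Z) = false by apply/eqP => -[].
    by rewrite andbF (lin0 (tpure_linearr _)).
  rewrite eqxx !andbT (inj_eq (addIr _)).
  case: k ab {ha} => j d /= <-; rewrite subr_eq xpair_eqE.
  by case: ifP => // _; rewrite (lin0 (tpure_linearl _)).
rewrite /proj_term (acomp_pdeg _ hb) xpair_eqE (negbTE bb) andbF.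
by rewrite (lin0 (tpure_linearr _)).
Qed.

(** The pieces [tsdeg k r] have a natural number [r], so they exhaust all tensors only because
    F(g_+) has no negative degrees. *)
Lemma pdeg_plus_ge0 k (b : Up) : pdeg F gp k b -> ~~ (0 <= k.1) -> b = 0.
Proof.
move: k b; apply: pdeg_ind => // [k a u v hu hv k0|k l x u hx hu kl].
  by rewrite hu// hv// scaler0 addr0.
have [k0|k0] := boolP (0 < k.1); last first.
  by rewrite (homog_deg0 k0 hx) (lin0 (@pgen_linear _ _ _ _ _)) mul0r.
rewrite hu ?mulr0//; apply: contra kl => l0.
by rewrite fst_add addr_ge0// ltW.
Qed.

Lemma tproj_is_tcomp t : is_tcomp t (tproj^~ t).
Proof.
have PL c u v : is_tcomp u (tproj^~ u) -> is_tcomp v (tproj^~ v) ->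
    is_tcomp (c *: u + v) (tproj^~ (c *: u + v)).
  move=> [u1 u2 u3] [v1 v2 v3]; split.
  - by move=> q; rewrite tproj_linear; exact: lspanD (lspanZ c (u1 q)) (v1 q).
  - have [r _ ru] := finite_supp_seq u2; have [s _ sv] := finite_supp_seq v2.
    have [_ tu tv] := fsum_support_cat ru sv.
    apply: (@seq_finite_supp _ _ _ (undup (r ++ s))) => q hq.
    by rewrite tproj_linear tu// tv// scaler0 addr0.
  rewrite {1}u3 {1}v3; have [r _ ru] := finite_supp_seq u2.
  have [s _ sv] := finite_supp_seq v2; have [us tu tv] := fsum_support_cat ru sv.
  rewrite !(fsum_seq us)// => [|q hq].
    by rewrite scaler_sumr -big_split; apply: eq_bigr => q _; rewrite tproj_linear.
  by rewrite tproj_linear tu// tv// scaler0 addr0.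
have Pdeg k r u : tsdeg k r u -> is_tcomp u (tproj^~ u).
  move=> hu; have E q := tproj_tsdeg q hu; split.
  - by move=> q; rewrite E; case: eqP => [->|_] //; apply: lspan0.
  - apply: (@seq_finite_supp _ _ _ [:: (k, r)]) => q.
    by rewrite inE => /negbTE qk; rewrite E qk.
  - by rewrite (@fsum1 _ _ (k, r)) => [|q /negbTE qk]; rewrite E ?eqxx// qk.
have P0 : is_tcomp 0 (tproj^~ 0) by apply: (Pdeg 0 0%N); apply: lspan0.
have Psum (J : choiceType) (f : J -> M) :
    (forall j, is_tcomp (f j) (tproj^~ (f j))) ->
    is_tcomp (\sum_(j \in [set: J]) f j) (tproj^~ (\sum_(j \in [set: J]) f j)).
  move=> hf; apply: (big_ind (fun u => is_tcomp u (tproj^~ u))) => // u v hu hv.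
  by rewrite -[u]scale1r; apply: PL.
elim/tens_ind: t => // a b; rewrite (acomp_sum a).
rewrite (lin_fsum (tpure_linearl b)); last exact: acomp_finite.
apply: (Psum) => k; rewrite (acomp_sum b).
rewrite (lin_fsum (tpure_linearr _)); last exact: acomp_finite.
apply: Psum => l; have hb := acomp_deg b l.
have [l0|l0] := boolP (0 <= l.1); last first.
  by rewrite (pdeg_plus_ge0 hb l0) (lin0 (tpure_linearr _)).
apply: (@Pdeg (k + l) `|l.1|%N); apply: (@tsdeg_pure _ _ k.2 l.2) => //.
  rewrite gez0_abs// fst_add addrK -surjective_pairing; exact: acomp_deg.
by rewrite gez0_abs// -surjective_pairing.
Qed.

(** [tproj q] isolates the term of index [q] in any decomposition, so the one selected by [xget] is
    unique. *)
Lemma tcompE t : tcomp t = tproj^~ t.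
Proof.
rewrite /tcomp; case: xgetP => [f _ [f1 f2 f3]|/(_ (tproj^~ t))]; last first.
  by case; apply: tproj_is_tcomp.
apply/funext => q; rewrite {1}f3 (lin_fsum (tproj_linear q))//.
rewrite (@fsum1 _ _ q) => [|p pq]; rewrite (tproj_tsdeg q (f1 _)).
  by rewrite -surjective_pairing eqxx.
by rewrite -surjective_pairing eq_sym (negbTE pq).
Qed.

Definition ucomp (u : palg F L) q : M := tcomp (splitmap u) q.

Lemma ucomp_linear q : linear (ucomp^~ q).
Proof.
by move=> c u v; rewrite /ucomp splitmap_linear !tcompE tproj_linear.
Qed.

Lemma ucomp_deg u q : tsdeg q.1 q.2 (ucomp u q).
Proof. by rewrite /ucomp tcompE; have [] := tproj_is_tcomp (splitmap u). Qed.

Lemma ucomp_finite u : finite_set [set q | ucomp u q != 0].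
Proof. by rewrite /ucomp tcompE; have [] := tproj_is_tcomp (splitmap u). Qed.

Lemma ucomp_tsdeg k r t q : tsdeg k r t ->
  ucomp (multmap t) q = if q == (k, r) then t else 0.
Proof. by move=> ht; rewrite /ucomp splitmapK tcompE (tproj_tsdeg _ ht). Qed.

End TensorGrading.

(** * Position of products in the split algebra *)

Section Pieces.
Variables (K : fieldType) (G : zmodType) (eps : commfactor K G).
Variables (F : algkind) (L : zclie eps).
Local Notation U := (palg F L).
Local Notation pgen := (pgen F).
Implicit Types (x : L) (v : U) (k : int * G).

(** A left factor of degree at most 0 keeps [r] and a right factor of positive degree raises it by
    that degree; products in another order have to be rearranged by commutators. *)
Definition in_piece k r v :=
  exists2 t : tsplit F L, tsdeg k r t & multmap t = v.

Lemma ucomp_piece k r v q : in_piece k r v ->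
  ucomp v q = if q == (k, r) then splitmap v else 0.
Proof. by move=> [t ht <-]; rewrite (ucomp_tsdeg _ ht) splitmapK. Qed.

Lemma ucomp_piece0 k r v l t : in_piece k r v -> t != r -> ucomp v (l, t) = 0.
Proof.
by move=> /ucomp_piece -> tr; rewrite xpair_eqE (negbTE tr) andbF.
Qed.

Lemma pieceL k r a u v : in_piece k r u -> in_piece k r v -> in_piece k r (a *: u + v).
Proof.
move=> [s hs <-] [t ht <-]; exists (a *: s + t); last exact: multmap_linear.
exact: lspanD (lspanZ a hs) ht.
Qed.

Lemma piece0 k r : in_piece k r 0.
Proof.
by exists 0; [exact: lspan0|exact: lin0 (@multmap_linear _ _ _ F L)].
Qed.

Lemma piece1 : in_piece 0 0 1.
Proof.
exists (tpure 1 1); last by rewrite multmap_pure incl_minus1 incl_plus1 mulr1.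
by apply: (@tsdeg_pure _ _ _ _ _ _ _ 0 0); rewrite ?addr0//; apply: pdeg1.
Qed.

Lemma piece_mull p k r x v : homog p x -> p.1 <= 0 -> in_piece k r v ->
  in_piece (p + k) r (pgen x * v).
Proof.
move=> hx p0 [t ht <-]; move: t ht; apply: lspan_ind => [|a u w hu hw|_ [al [be [a [b [ab ha hb ->]]]]]].
- by rewrite (lin0 (@multmap_linear _ _ _ F L)) mulr0; apply: piece0.
- by rewrite multmap_linear mulrDr -scalerAr; apply: pieceL.
pose x' := deglift (@minus_closed) p x.
exists (tpure (pgen x' * a) b); last first.
  by rewrite !multmap_pure incl_minusM incl_minus_gen deglift_val p0 hx mulrA.
apply: (@tsdeg_pure _ _ _ _ _ _ _ (p.2 + al) be) => //.
  by rewrite -addrA ab.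
rewrite fst_add -addrA.
exact: (pdeg_genM (homog_deglift (@minus_closed) p x) ha).
Qed.

Lemma piece_mulr q k r x v : homog q x -> 0 < q.1 -> in_piece k r v ->
  in_piece (k + q) (r + `|q.1|)%N (v * pgen x).
Proof.
move=> hx q0 [t ht <-]; move: t ht; apply: lspan_ind => [|a u w hu hw|_ [al [be [a [b [ab ha hb ->]]]]]].
- by rewrite (lin0 (@multmap_linear _ _ _ F L)) mul0r; apply: piece0.
- by rewrite multmap_linear mulrDl -scalerAl; apply: pieceL.
pose x' := deglift (@plus_closed) q x.
exists (tpure a (b * pgen x')); last first.
  by rewrite !multmap_pure incl_plusM incl_plus_gen deglift_val q0 hx mulrA.
have rE : (r + `|q.1|)%N%:Z = r%:Z + q.1 by rewrite PoszD gtz0_abs.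
apply: (@tsdeg_pure _ _ _ _ _ _ _ al (be + q.2)).
- by rewrite addrA ab.
- by rewrite rE fst_add opprD addrACA subrr addr0.
rewrite rE.
exact: (pdegM hb (pdeg_gen F (homog_deglift (@plus_closed) q x))).
Qed.

Lemma piece_gen k x : homog k x ->
  in_piece k (if k.1 <= 0 then 0%N else `|k.1|%N) (pgen x).
Proof.
move=> hx; have := piece1; case: leP => k0 h.
  by have := piece_mull hx k0 h; rewrite addr0 mulr1.
by have := piece_mulr hx k0 h; rewrite add0r mul1r.
Qed.

End Pieces.

Lemma lt_neq_absz (t : nat) (z : int) : t%:Z < z -> t != `|z|%N.
Proof. by lia. Qed.

Section Vanishing.
Variables (K : fieldType) (G : zmodType) (eps : commfactor K G) (L : zclie eps).
Local Notation g := (pgen Univ).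
Variables (p q : int * G) (u w : L).
Hypotheses (hu : homog p u) (hw : homog q w) (p0 : p.1 <= 0) (q0 : 0 < q.1).

Lemma piece_mul : in_piece (p + q) `|q.1|%N (g u * g w : palg Univ L).
Proof.
by apply: (piece_mull hu p0); have := piece_gen Univ hw; rewrite leNgt q0.
Qed.

Variables (k : int * G) (x : L) (l : int * G) (t : nat).
Hypotheses (hx : homog k x) (tq : t%:Z < q.1) (tkq : t%:Z < k.1 + q.1).

Let vanish k' r (v : palg Univ L) : in_piece k' r v -> t != r -> ucomp v (l, t) = 0.
Proof. exact: ucomp_piece0. Qed.

Lemma ucomp_mul0 : ucomp (g u * g w : palg Univ L) (l, t) = 0.
Proof. exact: (vanish piece_mul (lt_neq_absz tq)). Qed.

Let gt_piece : 0 < k.1 -> in_piece (k + q) (absz (k.1 + q.1)) (g x * g w : palg Univ L).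
Proof.
move=> k0; have := piece_gen Univ hx; rewrite leNgt k0 /= => hp.
have := piece_mulr hw q0 hp.
by rewrite (_ : (`|k.1| + `|q.1|)%N = absz (k.1 + q.1))//; lia.
Qed.

Let w_piece : in_piece q `|q.1|%N (g w : palg Univ L).
Proof. by have := piece_gen Univ hw; rewrite leNgt q0. Qed.

(** A positive [x] is moved past [u], leaving [u x w] and [[x, u] w]; the hypothesis puts [[x, u]]
    in g_-, so the second factors have degrees [k.1 + q.1] and [q.1], both above [t]. *)
Lemma ucomp_mull0 : k.1 + p.1 <= 0 ->
  ucomp (g x * (g u * g w) : palg Univ L) (l, t) = 0.
Proof.
move=> kp0; have [k0|k0] := leP k.1 0.
  exact: (vanish (piece_mull hx k0 piece_mul) (lt_neq_absz tq)).
rewrite mulrA (pgen_comm Univ hx hu) mulrDl -scalerAl -mulrA.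
rewrite (ucomp_linear (l, t)).
rewrite (vanish (piece_mull hu p0 (gt_piece k0)) (lt_neq_absz tkq)) scaler0 add0r.
exact: (vanish (piece_mull (homog_br hx hu) kp0 w_piece) (lt_neq_absz tq)).
Qed.

(** For [x] of degree at most 0 it is moved left past [w]; the bracket [[w, x]] remains in g_+
    because its degree exceeds [t]. *)
Lemma ucomp_mulr0 : ucomp ((g u * g w) * g x : palg Univ L) (l, t) = 0.
Proof.
have [k0|k0] := leP k.1 0; last first.
  apply: (vanish (piece_mulr hx k0 piece_mul)).
  rewrite (_ : (`|q.1| + `|k.1|)%N = absz (k.1 + q.1)); first exact: lt_neq_absz.
  by move: k0 q0; lia.
rewrite -mulrA (pgen_comm Univ hw hx) mulrDr -scalerAr (ucomp_linear (l, t)).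
rewrite (vanish (piece_mull hu p0 (piece_mull hx k0 w_piece)) (lt_neq_absz tq)).
rewrite scaler0 add0r; have := piece_gen Univ (homog_br hw hx).
rewrite leNgt fst_add addrC (le_lt_trans _ tkq)//= => hp.
exact: (vanish (piece_mull hu p0 hp) (lt_neq_absz tkq)).
Qed.

End Vanishing.

(** * Existence of the symmetrization *)

Lemma sum_lift_perm (V : nmodType) n (f : 'S_n.+1 -> V) :
  \sum_s f s = \sum_(i < n.+1) \sum_(t : 'S_n) f (lift_perm ord0 i t).
Proof.
rewrite pair_big /=; apply: reindex; apply: onW_bij.
apply: inj_card_bij => [[i s] [j t] /= st|].
  have ij : i = j by rewrite -(lift_perm_id ord0 i s) st lift_perm_id.
  congr (_, _) => //; apply/permP => k; apply: (@lift_inj _ i).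
  by rewrite -(lift_perm_lift ord0 i s) st ij lift_perm_lift.
by rewrite card_prod card_ord !card_Sn factS.
Qed.

Section SymmetrizationExists.
Variables (K : fieldType) (G : zmodType) (eps : commfactor K G) (h : zclie eps).
Local Notation S := (palg Sym h).
Local Notation U := (palg Univ h).
Local Notation T := (tens h S).

Definition symm_sum n (d : 'I_n -> int * G) (x : 'I_n -> h) : U :=
  \sum_(s : 'S_n) koszul eps s d *: \prod_(i < n) pgen Univ (x (s i)).

(** The sign for moving the factor of index [i] to the front. *)
Let front n (d : 'I_n -> int * G) (i : 'I_n) : K :=
  \prod_(j < n | (j < i)%N) eps (d j).2 (d i).2.

Lemma koszul_lift_perm n (d : 'I_n.+1 -> int * G) i (t : 'S_n) :
  koszul eps (lift_perm ord0 i t) d =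
    front d i * koszul eps t (fun j => d (lift i j)).
Proof.
rewrite /koszul lift_permV /front.
rewrite (bigD1_ord i)//= [X in X * _ = _]big1 ?mul1r => [|j]; last first.
  by rewrite lift_perm_id ltn0 andbF.
rewrite [X in _ = X * _]big_mkcond [X in _ = X * _](bigD1_ord i)//= ltnn mul1r.
rewrite -big_split /=.
apply: eq_bigr => k _; rewrite big_mkcond (bigD1_ord i)//= lift_perm_id.
rewrite lift_perm_lift /= andbT; congr (_ * _).
rewrite [RHS]big_mkcond; apply: eq_bigr => l _.
rewrite lift_perm_lift; congr (if _ && _ then _ else _).
  by rewrite /= /bump; lia.
Qed.

Lemma symm_sumS n (d : 'I_n.+1 -> int * G) (x : 'I_n.+1 -> h) :
  symm_sum d x = \sum_(i < n.+1) front d i *: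
    (pgen Univ (x i) * symm_sum (fun j => d (lift i j)) (fun j => x (lift i j))).
Proof.
rewrite /symm_sum sum_lift_perm; apply: eq_bigr => i _.
rewrite mulr_sumr scaler_sumr; apply: eq_bigr => t _.
rewrite koszul_lift_perm -scalerA -scalerAr; congr (_ *: (_ *: _)).
rewrite big_ord_recl lift_perm_id; congr (_ * _).
by apply: eq_bigr => j _; rewrite lift_perm_lift.
Qed.

Lemma symm_sum0 (d : 'I_0 -> int * G) x : symm_sum d x = 1.
Proof.
have perm0 (s : 'S_0) : s = 1%g by apply/permP => -[].
rewrite /symm_sum (big_pred1 1%g) => [|s]; last by rewrite /= (perm0 s) eqxx.
by rewrite /koszul !big_ord0 scale1r.
Qed.

Let twist (k : int * G) : h -> h := gext (fun l y => eps k.2 l.2 *: y).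

Let twist_linear k : linear (twist k).
Proof.
by apply: gext_linear => l a x y; rewrite scalerDr !scalerA [a * _]mulrC.
Qed.

Let twist_homog k l y : homog l y -> twist k y = eps k.2 l.2 *: y.
Proof. by move=> hy; apply: gext_homog => // m; rewrite scaler0. Qed.

(** Left multiplication by [x] on h (x) S, with the sign for passing [x] over the first factor. *)
Let tmulx (k : int * G) (x : h) : T -> T :=
  teval (fun y v => tpure (twist k y) (pgen Sym x * v)).

Let tm_l k x v : linear (fun y => tpure (twist k y) (pgen Sym x * v) : T).
Proof. by move=> a y z; rewrite twist_linear (tpure_linearl _ a). Qed.
Let tm_r k x y : linear (fun v => tpure (twist k y) (pgen Sym x * v) : T).
Proof. by move=> a u v; rewrite mulrDr -scalerAr (tpure_linearr _ a). Qed.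
Let tmulx_linear k x : linear (tmulx k x).
Proof. by apply: teval_linear => [v|y]; [exact: tm_l|exact: tm_r]. Qed.
Let tmulx_pure k x y v :
  tmulx k x (tpure y v) = tpure (twist k y) (pgen Sym x * v).
Proof. by apply: teval_pure => [w|z]; [exact: tm_l|exact: tm_r]. Qed.
Let tmulx_linearl k w : linear (fun x => tmulx k x w).
Proof.
move=> a x x'; move: w; apply: tens_lin_ext => [||y v].
- exact: tmulx_linear.
- by move=> b u v; rewrite !tmulx_linear; lmodule K T; ring.
by rewrite !tmulx_pure pgen_linear mulrDl -scalerAl (tpure_linearr _ a).
Qed.

Let tmulx_comm k l x y w : homog k x -> homog l y ->
  tmulx k x (tmulx l y w) = eps k.2 l.2 *: tmulx l y (tmulx k x w).
Proof.
move=> hx hy; move: w; apply: tens_lin_ext => [||z v].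
- exact: lin_comp (tmulx_linear _ _) (tmulx_linear _ _).
- by move=> b u v; rewrite !tmulx_linear; lmodule K T; ring.
elim/zclie_ind: z => [z z' hz hz'|m z hz].
  rewrite (linD (tpure_linearl _)) !(linD (tmulx_linear _ _)) hz hz'.
  by rewrite scalerDr.
rewrite !tmulx_pure !(twist_homog _ hz) !(linZ (twist_linear _)).
rewrite !(twist_homog _ hz) !mulrA (pgen_comm Sym hx hy) (lin0 (@pgen_linear _ _ _ _ _)).
rewrite addr0 -scalerAl !(linZ (tpure_linearl _)) (linZ (tpure_linearr _)).
by lmodule K T; ring.
Qed.

(** The first coordinate remembers the product itself, so that the second can follow the Leibniz
    rule recorded in [diff_genM]. *)
Let rho (k : int * G) (x : h) (w : S * T) : S * T :=
  (pgen Sym x * w.1, tpure x w.1 + tmulx k x w.2).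

Let rho_rep : is_rep Sym (fun=> True) rho.
Proof.
split=> //.
- move=> k x a u v; rewrite /rho; congr (_, _) => /=.
    by rewrite mulrDr -scalerAr.
  rewrite (tpure_linearr x a) tmulx_linear; lmodule K T; ring.
- move=> k w _ a x y; rewrite /rho; congr (_, _) => /=.
    by rewrite pgen_linear mulrDl -scalerAl.
  rewrite (tpure_linearl _ a) tmulx_linearl; lmodule K T; ring.
move=> k l x y w hx hy _; rewrite /rho; congr (_, _) => /=.
  by rewrite !mulrA (pgen_comm Sym hx hy) mulrDl -scalerAl.
rewrite !(linD (tmulx_linear _ _)) !tmulx_pure (tmulx_comm _ hx hy).
rewrite (twist_homog k hy) (twist_homog l hx) !(linZ (tpure_linearl _)).
rewrite (lin0 (tmulx_linearl _ _)) (lin0 (tpure_linearl _)).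
have e1 := cf_sym eps k.2 l.2; lmodule K T; ring: e1.
Qed.

(* The differential x_1...x_n |-> \sum_i +/- x_i (x) x_1..x_{i-1} x_{i+1}..x_n. *)
Let diff (s : S) : T := (act rho s (1, 0)).2.

Let diff_linear : linear diff.
Proof. by move=> a u v; rewrite /diff (act_linearl rho_rep). Qed.

Let diff1 : diff 1 = 0.
Proof. by rewrite /diff (act1 rho_rep). Qed.

Let act_fst s : (act rho s (1, 0)).1 = s.
Proof.
elim/palg_ind: s => [|a u v hu hv|k x u hx hu].
- by rewrite (act1 rho_rep).
- by rewrite (act_linearl rho_rep)//= hu hv.
- by rewrite (actM rho_rep)// (act_gen rho_rep hx)//= hu.
Qed.

Let diff_genM k x s : homog k x ->
  diff (pgen Sym x * s) = tpure x s + tmulx k x (diff s).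
Proof.
by move=> hx; rewrite /diff (actM rho_rep)// (act_gen rho_rep hx)//= act_fst.
Qed.

Let diff_prod n (d : 'I_n.+1 -> int * G) (x : 'I_n.+1 -> h) :
  (forall i, homog (d i) (x i)) ->
  diff (\prod_(i < n.+1) pgen Sym (x i)) =
    \sum_(i < n.+1) front d i *:
      tpure (x i) (\prod_(j < n) pgen Sym (x (lift i j))).
Proof.
have front0 m (d' : 'I_m.+1 -> int * G) : front d' ord0 = 1.
  by rewrite /front big1.
elim: n d x => [|n IH] d x hx; rewrite big_ord_recl (diff_genM _ (hx _)).
  rewrite big_ord0 diff1 (lin0 (tmulx_linear _ _)) addr0.
  by rewrite big_ord1 front0 scale1r big_ord0.
rewrite (IH (fun i => d (lift ord0 i)))// (lin_sum (tmulx_linear _ _)).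
rewrite [RHS]big_ord_recl; congr (_ + _).
  by rewrite front0 scale1r.
apply: eq_bigr => i _; rewrite (linZ (tmulx_linear _ _)) tmulx_pure.
rewrite (twist_homog _ (hx _)) (linZ (tpure_linearl _)) scalerA.
congr (_ *: tpure _ _).
  by rewrite /front [RHS]big_mkcond big_ord_recl /= -big_mkcond mulrC.
rewrite [RHS]big_ord_recl; congr (_ * _).
  by congr (pgen Sym (x _)); apply: val_inj.
apply: eq_bigr => j _; congr (pgen Sym (x _)); apply: val_inj => /=.
by rewrite /bump; lia.
Qed.

(* [diff] lowers the length of a product by one, so the [n]-th map vanishes   *)
(* on products of length other than [n] and the symmetrization is their sum.  *)
Fixpoint symm_part (n : nat) : S -> U :=
  if n is n'.+1 then
    fun s => n%:R^-1 *: teval (fun x v => pgen Univ x * symm_part n' v) (diff s)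
  else @peval _ _ _ Sym h U (fun=> 0).

Let part_l n v : linear (fun x => pgen Univ x * symm_part n v).
Proof. by move=> a x y; rewrite pgen_linear mulrDl -scalerAl. Qed.

Let zero_lin : linear (fun _ : h => 0 : U).
Proof. by move=> a x y; rewrite scaler0 addr0. Qed.

Let zero_comm : forall k l (x y : h), homog k x -> homog l y ->
  (0 : U) * 0 = eps k.2 l.2 *: (0 * 0) + 0.
Proof. by move=> *; rewrite mul0r scaler0 addr0. Qed.

Lemma symm_part_linear n : linear (symm_part n).
Proof.
elim: n => [|n IH] /=; first exact: peval_linear zero_lin zero_comm.
have part_r x : linear (fun v => pgen Univ x * symm_part n v).
  by move=> b u' v'; rewrite IH mulrDr -scalerAr.
move=> a u v.
rewrite diff_linear (teval_linear (part_l n) part_r) scalerDr !scalerA.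
by rewrite [a * _]mulrC.
Qed.

Let part_r n x : linear (fun v => pgen Univ x * symm_part n v).
Proof. by move=> b u' v'; rewrite symm_part_linear mulrDr -scalerAr. Qed.

(** The recursion [symm_sumS], which singles out the leading factor, matches [diff_prod] term by
    term; the factors 1/n accumulate to 1/n!. *)
Lemma symm_part_prod m n (d : 'I_n -> int * G) (x : 'I_n -> h) :
  (forall i, homog (d i) (x i)) ->
  symm_part m (\prod_(i < n) pgen Sym (x i)) =
    if m == n then (n`!%:R : K)^-1 *: symm_sum d x else 0.
Proof.
elim: m n d x => [|m IH] [|n] d x hx.
- rewrite big_ord0 /= (peval1 zero_lin zero_comm) fact0 invr1 scale1r.
  by rewrite symm_sum0.
- rewrite big_ord_recl [LHS](pevalM zero_lin zero_comm).
  by rewrite (peval_gen zero_lin zero_comm) mul0r.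
- rewrite big_ord0 /= diff1 (lin0 (teval_linear (part_l m) (part_r m))).
  by rewrite scaler0.
rewrite /= (diff_prod hx) (lin_sum (teval_linear (part_l m) (part_r m))) eqSS.
under eq_bigr => i _.
  rewrite (linZ (teval_linear (part_l m) (part_r m))).
  rewrite (teval_pure (part_l m) (part_r m)) (IH _ (fun j => d (lift i j)))//.
  over.
case: eqP => [->|_]; last first.
  by rewrite big1 ?scaler0// => i _; rewrite mulr0 scaler0.
rewrite symm_sumS factS natrM invfM -scalerA; congr (_ *: _).
rewrite scaler_sumr; apply: eq_bigr => i _.
by rewrite -scalerAr !scalerA mulrC.
Qed.

Lemma palg_prod_ind F (P : palg F h -> Prop) :
  P 0 -> (forall a u v, P u -> P v -> P (a *: u + v)) ->
  (forall n (d : 'I_n -> int * G) (x : 'I_n -> h),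
     (forall i, homog (d i) (x i)) -> P (\prod_(i < n) pgen F (x i))) ->
  forall u, P u.
Proof.
move=> P0 PL Pp u; rewrite (acomp_sum u); apply: (big_ind P) => // [v w Pv Pw|k _].
  by rewrite -[v]scale1r; apply: PL.
have := acomp_deg u k; elim/lspan_ind => // _ [n [d [x [hx _ ->]]]].
exact: Pp hx.
Qed.

Lemma symm_part_finite s : finite_set [set n | symm_part n s != 0].
Proof.
suff [r hr] : exists r : seq nat, forall n, n \notin r -> symm_part n s = 0.
  exact: seq_finite_supp hr.
elim/palg_prod_ind: s => [|a u v [r hr] [t ht]|n d x hx].
- by exists [::] => n _; apply: lin0; apply: symm_part_linear.
- exists (r ++ t) => n; rewrite mem_cat negb_or => /andP[/hr un /ht vn].
  by rewrite symm_part_linear un vn scaler0 addr0.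
- by exists [:: n] => m; rewrite inE => /negbTE mn; rewrite (symm_part_prod _ hx) mn.
Qed.

(** [xget] returns a valid map as soon as there is one, and the sum of all [symm_part n], finite on
    each element, is such a map. *)
Lemma symmetrizationP : is_symmetrization (@symmetrization _ _ _ h).
Proof.
rewrite /symmetrization; case: xgetP => // /(_ (fun s =>
  \sum_(n \in [set: nat]) symm_part n s))[]; split.
  by apply: fsum_linear; [exact: symm_part_linear|exact: symm_part_finite].
move=> n d x hx; rewrite (@fsum1 _ _ n) => [|m /negbTE mn].
  by rewrite (symm_part_prod _ hx) eqxx.
by rewrite (symm_part_prod _ hx) mn.
Qed.

Lemma symmetrization_linear : linear (@symmetrization _ _ _ h).
Proof. by have [] := symmetrizationP. Qed.

Let sym_prod n (d : 'I_n -> int * G) (x : 'I_n -> h) :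
    (forall i, homog (d i) (x i)) ->
  symmetrization (\prod_(i < n) pgen Sym (x i)) = (n`!%:R)^-1 *: symm_sum d x.
Proof. by have [_] := symmetrizationP; apply. Qed.

Lemma symmetrization1 : symmetrization (1 : S) = 1.
Proof.
have := @sym_prod 0 (fun=> 0) (fun=> 0); rewrite big_ord0 symm_sum0 invr1 scale1r.
by apply; case.
Qed.

Lemma symmetrization_gen k (x : h) : homog k x ->
  symmetrization (pgen Sym x) = pgen Univ x.
Proof.
move=> hx; have := @sym_prod 1 (fun=> k) (fun=> x) (fun=> hx).
rewrite big_ord1 symm_sumS big_ord1 symm_sum0 mulr1 /front big1; last by case.
by rewrite invr1 !scale1r.
Qed.

Lemma symmetrization_gen2 k l (x y : h) : homog k x -> homog l y ->
  symmetrization (pgen Sym x * pgen Sym y) = 2%:R^-1 *: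
    (pgen Univ x * pgen Univ y + eps k.2 l.2 *: (pgen Univ y * pgen Univ x)).
Proof.
move=> hx hy.
have hxy (i : 'I_2) : homog (if i == ord0 then k else l) (if i == ord0 then x else y).
  by case: ifP.
have := sym_prod hxy; rewrite big_ord_recl big_ord1 /= => ->.
rewrite symm_sumS big_ord_recl big_ord1 !symm_sumS !big_ord1 !symm_sum0 !mulr1.
rewrite /front !(big_mkcond (fun j : 'I__ => (j < _)%N)) /=.
rewrite !big_ord_recl !big_ord0 /= !mulr1 !scale1r.
by [].
Qed.

End SymmetrizationExists.

(** * Products in the completion *)

Lemma fsum_reindex (V : nmodType) (I J : choiceType) (h : J -> I) (F : I -> V) :
  injective h -> (forall i, ~ range h i -> F i = 0) ->
  \sum_(i \in [set: I]) F i = \sum_(j \in [set: J]) F (h j).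
Proof.
move=> hI F0; rewrite -(fsbig_widen (range h) setT) => [|//|i [_ /F0] //].
apply: reindex_fsbig; split; [by move=> j _; exists j|by move=> ? ? _ _ /hI|].
by move=> i [j _ <-]; exists j.
Qed.

Section HatComputations.
Variables (K : fieldType) (G : zmodType) (eps : commfactor K G).
Variables (F : algkind) (L : zclie eps).
Local Notation M := (tsplit F L).
Local Notation pgen := (pgen F).
Implicit Types (u v : hat F L) (x : L).

Lemma val_mkhat (f : int * G -> nat -> M) (s : seq (int * G)) :
  (forall k r, tsdeg k r (f k r)) -> (forall k r, k \notin s -> f k r = 0) ->
  val (mkhat f) = f.
Proof.
move=> fd fs; rewrite /mkhat insubdK//; apply/asboolP; split=> //.
apply: sub_finite_set (finite_seq s) => k [r] /= fkr.
by apply: contra_neqT fkr => /fs.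
Qed.

Lemma hat_ext u v : (forall k r, val u k r = val v k r) -> u = v.
Proof. by move=> uv; apply: val_inj; apply/funext => k; apply/funext => r. Qed.

Lemma hat_deg u k r : tsdeg k r (val u k r).
Proof. by have /asboolP[] := valP u. Qed.

Lemma mkhat0 f : (forall k r, f k r = 0) -> mkhat f = 0 :> hat F L.
Proof.
move=> f0; apply: hat_ext => k r.
rewrite (@val_mkhat _ [::]) => [|l s|l s _]; rewrite ?f0//; exact: lspan0.
Qed.

Lemma hat_emb_val (u0 : palg F L) k r : val (hat_emb u0 : hat F L) k r = ucomp u0 (k, r).
Proof.
have [s _ hs] := finite_supp_seq (ucomp_finite u0).
rewrite (@val_mkhat _ [seq q.1 | q <- s]) => // [l t|l t lt].
  exact: (ucomp_deg u0 (l, t)).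
by apply: hs; apply: contra lt => lt; apply/mapP; exists (l, t).
Qed.

Lemma hat_emb_linear : linear (@hat_emb _ _ _ F L).
Proof.
by move=> a u v; apply: hat_ext => k r; rewrite !hat_emb_val ucomp_linear -!hat_emb_val.
Qed.

Lemma hat_part_val k u l r :
  val (hat_part k u) l r = if l == k then val u l r else 0.
Proof.
rewrite (@val_mkhat _ [:: k])// => [m s|m s].
  by case: ifP => _; [exact: hat_deg|exact: lspan0].
by rewrite inE => /negbTE ->.
Qed.

Let ucomp0 q : ucomp (0 : palg F L) q = 0.
Proof. exact: lin0 (ucomp_linear q). Qed.

Let multmap0 : multmap (0 : M) = 0.
Proof. exact: lin0 (@multmap_linear _ _ _ F L). Qed.

Lemma hat_mul0 u : hat_mul u 0 = 0.
Proof.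
apply: mkhat0 => k r; apply: fsbig1 => q _; rewrite -/(ucomp _ _).
by rewrite [val 0 _ _]/(0 : M) multmap0 mulr0 ucomp0.
Qed.

Lemma hat_mul0r u : hat_mul 0 u = 0.
Proof.
apply: mkhat0 => k r; apply: fsbig1 => q _; rewrite -/(ucomp _ _).
by rewrite [val 0 _ _]/(0 : M) multmap0 mul0r ucomp0.
Qed.

Lemma ucomp_pgen k l t x : homog k x -> l != k -> ucomp (pgen x : palg F L) (l, t) = 0.
Proof.
move=> /(piece_gen F)/ucomp_piece -> lk.
by rewrite xpair_eqE (negbTE lk).
Qed.

(** A generator occupies a single piece and [v] a single bidegree, so the sum over pairs of
    components collapses to one over [r]. *)
Lemma hat_mul_genl k x v l t : homog k x ->
  (forall l r, l != 0 -> val v l r = 0) ->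
  val (hat_mul (hat_emb (pgen x)) v) l t = if l == k then
    \sum_(r \in [set: nat]) ucomp (pgen x * multmap (val v 0 r)) (k, t) else 0.
Proof.
move=> hx v0; have [t0] := piece_gen F hx; set r0 := if _ then _ else _ => ht xE.
pose g l t := if l == k then
    \sum_(r \in [set: nat]) ucomp (pgen x * multmap (val v 0 r)) (k, t) else 0.
rewrite /hat_mul [X in mkhat X](_ : _ = g) /g; last first.
  apply/funext => l'; apply/funext => t'.
  rewrite fsbig_mkcond (@fsum_reindex _ _ _ (fun r : nat => ((k, 0), (r0, r)))) /=.
  - case: eqP => [->|lk]; last first.
      apply: fsbig1 => r _; rewrite /patch; case: ifPn => //.
      by rewrite inE /= addr0 => /esym.
    apply: eq_fsbigr => r _; rewrite /patch ifT; last by rewrite inE /= addr0.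
    by rewrite hat_emb_val -xE (ucomp_tsdeg _ ht) eqxx.
  - by move=> r s [].
  move=> [[l1 l2] [r1 r2]] hq; rewrite /patch; case: ifP => // _ /=.
  rewrite -/(ucomp _ _) hat_emb_val -xE (ucomp_tsdeg _ ht).
  case: eqP => [[lE rE]|_]; last by rewrite multmap0 mul0r ucomp0.
  have [l20|l20] := eqVneq l2 0; last by rewrite v0// multmap0 mulr0 ucomp0.
  by case: hq; exists r2 => //; rewrite lE rE l20.
rewrite (@val_mkhat _ [:: k])// => [l' r|l' r].
  case: eqP => [->|_]; last exact: lspan0.
  by apply: lspan_fsum => s; apply: (ucomp_deg _ (k, r)).
by rewrite inE => /negbTE ->.
Qed.

Lemma hat_mul_genr k x v l t : homog k x ->
  (forall l r, l != 0 -> val v l r = 0) ->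
  val (hat_mul v (hat_emb (pgen x))) l t = if l == k then
    \sum_(r \in [set: nat]) ucomp (multmap (val v 0 r) * pgen x) (k, t) else 0.
Proof.
move=> hx v0; have [t0] := piece_gen F hx; set r0 := if _ then _ else _ => ht xE.
pose g l t := if l == k then
    \sum_(r \in [set: nat]) ucomp (multmap (val v 0 r) * pgen x) (k, t) else 0.
rewrite /hat_mul [X in mkhat X](_ : _ = g) /g; last first.
  apply/funext => l'; apply/funext => t'.
  rewrite fsbig_mkcond (@fsum_reindex _ _ _ (fun r : nat => ((0, k), (r, r0)))) /=.
  - case: eqP => [->|lk]; last first.
      apply: fsbig1 => r _; rewrite /patch; case: ifPn => //.
      by rewrite inE /= add0r => /esym.
    apply: eq_fsbigr => r _; rewrite /patch ifT; last by rewrite inE /= add0r.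
    by rewrite hat_emb_val -xE (ucomp_tsdeg _ ht) eqxx.
  - by move=> r s [].
  move=> [[l1 l2] [r1 r2]] hq; rewrite /patch; case: ifP => // _ /=.
  rewrite -/(ucomp _ _) hat_emb_val -xE (ucomp_tsdeg _ ht).
  case: eqP => [[lE rE]|_]; last by rewrite multmap0 mulr0 ucomp0.
  have [l10|l10] := eqVneq l1 0; last by rewrite v0// multmap0 mul0r ucomp0.
  by case: hq; exists r1 => //; rewrite lE rE l10.
rewrite (@val_mkhat _ [:: k])// => [l' r|l' r].
  case: eqP => [->|_]; last exact: lspan0.
  by apply: lspan_fsum => s; apply: (ucomp_deg _ (k, r)).
by rewrite inE => /negbTE ->.
Qed.

(** In each component both products are cut off at the same [N]; their difference is then a
    component of a finite sum of commutators in F(g), where telescoping applies. *)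
Lemma hat_commutator k x v z : homog k x ->
  (forall l r, l != 0 -> val v l r = 0) ->
  (forall l t, l != k -> ucomp z (l, t) = 0) ->
  (forall t, exists N, (forall r, (N <= r)%N ->
       ucomp (pgen x * multmap (val v 0 r)) (k, t) = 0 /\
       ucomp (multmap (val v 0 r) * pgen x) (k, t) = 0) /\
     ucomp (\sum_(r < N)
       (pgen x * multmap (val v 0 r) - multmap (val v 0 r) * pgen x)) (k, t)
     = ucomp z (k, t)) ->
  hat_mul (hat_emb (pgen x)) v - hat_mul v (hat_emb (pgen x)) = hat_emb z.
Proof.
move=> hx v0 z0 hN; apply: hat_ext => l t.
rewrite [LHS](_ : _ = val (hat_mul (hat_emb (pgen x)) v) l t
  - val (hat_mul v (hat_emb (pgen x))) l t)//.
rewrite (hat_mul_genl _ _ hx v0) (hat_mul_genr _ _ hx v0) hat_emb_val.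
case: eqP => [->|/eqP lk]; last by rewrite subr0 z0.
have [N [NE <-]] := hN t.
have trunc (f : nat -> M) : (forall r, (N <= r)%N -> f r = 0) ->
    \sum_(r \in [set: nat]) f r = \sum_(r < N) f r.
  move=> f0; rewrite (fsum_seq (iota_uniq 0 N)) => [|r].
    by rewrite -(big_mkord xpredT f) /index_iota subn0.
  by rewrite mem_iota /= add0n -leqNgt => /f0.
rewrite !trunc => [|r /NE[]//|r /NE[]//].
rewrite (lin_sum (ucomp_linear _)) -sumrB; apply: eq_bigr => r _.
by rewrite (linB (ucomp_linear _)).
Qed.

(** As eps(., 0) = 1, the adjoint action on bidegree 0 is the plain commutator. *)
Lemma hat_adj_deg0 x v : (forall l r, l != 0 -> val v l r = 0) ->
  hat_adj x v = \sum_(k \in [set: int * G])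
    (hat_mul (hat_emb (pgen (zc_pr k x))) v
     - hat_mul v (hat_emb (pgen (zc_pr k x)))).
Proof.
move=> v0; have partE l : hat_part l v = if l == 0 then v else 0.
  apply: hat_ext => m r; rewrite hat_part_val; case: (eqVneq l 0) => [->|l0].
    by case: (eqVneq m 0) => // /v0 ->.
  by case: (eqVneq m l) => // ->; rewrite v0.
rewrite /hat_adj (@fsum_reindex _ _ _ (fun k : int * G => (k, 0))) /=.
- by apply: eq_fsbigr => k _; rewrite partE eqxx eps0r scale1r.
- by move=> k l [].
move=> [k l] hq; rewrite partE /=; case: eqP => [l0|_].
  by case: hq; exists k => //; rewrite l0.
by rewrite hat_mul0 hat_mul0r scaler0 subr0.
Qed.

End HatComputations.

(** * Dual bases and the Kac-Peterson cocycle *)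

Section QuadraticIdentities.
Variables (K : fieldType) (G : zmodType) (eps : commfactor K G) (L : zclie eps).
Variables (B : L -> L -> K) (B_quadratic : quadratic_form B).
Implicit Types (x y z : L) (k l : int * G).

Let B_r x : linear (B x : L -> K^o).
Proof. exact: qf_linearr B_quadratic x. Qed.
Let B_l y : linear (B^~ y : L -> K^o).
Proof. exact: qf_linearl B_quadratic y. Qed.

Lemma qfDl x y z : B (x + y) z = B x z + B y z. Proof. exact: (linD (B_l z)). Qed.
Lemma qfDr x y z : B x (y + z) = B x y + B x z. Proof. exact: (linD (B_r x)). Qed.
Lemma qfZl a x y : B (a *: x) y = a * B x y. Proof. exact: (linZ (B_l y)). Qed.
Lemma qfZr a x y : B x (a *: y) = a * B x y. Proof. exact: (linZ (B_r x)). Qed.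
Lemma qfNl x y : B (- x) y = - B x y. Proof. exact: (linN (B_l y)). Qed.
Lemma qfNr x y : B x (- y) = - B x y. Proof. exact: (linN (B_r x)). Qed.
Lemma qf0l y : B 0 y = 0. Proof. exact: (lin0 (B_l y)). Qed.
Lemma qf_suml (J : Type) (r : seq J) (P : pred J) (F : J -> L) y :
  B (\sum_(j <- r | P j) F j) y = \sum_(j <- r | P j) B (F j) y.
Proof. exact: (lin_sum (B_l y)). Qed.

Lemma qf_pr k x y : homog k x -> B x (zc_pr (- k) y) = B x y.
Proof.
move=> hx; rewrite [in RHS](zc_pr_sum y).
rewrite [RHS](lin_fsum (B_r x) (zc_pr_finite y)) (@fsum1 _ _ (- k))// => l lk.
rewrite (qf_deg B_quadratic hx (homog_pr l y))//.
by apply: contra lk; rewrite addrC addr_eq0.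
Qed.

Variables (I : choiceType) (deg : I -> int * G) (e e' : I -> L).
Hypothesis e_dual : dual_bases B deg e e'.

(** A component of [e' a] in any other degree is orthogonal to every basis vector, hence zero. *)
Lemma dual_basis_homog a : homog (- deg a) (e' a).
Proof.
have key k : k != - deg a -> zc_pr k (e' a) = 0.
  move=> ka; apply: (qf_nondeg B_quadratic) => y.
  suff Bz z : B z (zc_pr k (e' a)) = 0.
    elim/zclie_ind: y => [y z hy hz|l y hy]; first by rewrite qfDr hy hz addr0.
    by rewrite (qf_sym B_quadratic (homog_pr k _) hy) Bz mulr0.
  have [c [[fc zE] _]] := db_basis e_dual z.
  have fin : finite_set [set b | c b *: e b != 0].
    apply: sub_finite_set fc => b /=; apply: contra_neq => ->; exact: scale0r.
  rewrite zE [LHS](lin_fsum (B_l _) fin); apply: fsbig1 => b _.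
  rewrite qfZl; have hb := db_homog e_dual b.
  have [kb|kb] := eqVneq k (- deg b); last first.
    rewrite (qf_deg B_quadratic hb (homog_pr k _)) ?mulr0//.
    by apply: contra kb; rewrite addrC addr_eq0.
  rewrite kb (qf_pr _ hb) (db_dual e_dual); case: eqP => [ba|]; last by rewrite mulr0.
  by rewrite kb ba eqxx in ka.
by rewrite /homog /= [RHS](zc_pr_sum (e' a)) (@fsum1 _ _ (- deg a)).
Qed.

Let basis_scale (v : I -> L) (c : I -> K) :
  finite_set [set a | c a != 0] -> finite_set [set a | c a *: v a != 0].
Proof.
by move=> fc; apply: sub_finite_set fc => b /=; apply: contra_neq => ->; rewrite scale0r.
Qed.

Let coord_r (f : L -> K^o) (v : I -> L) (c : I -> K) b :
  linear f -> finite_set [set a | c a != 0] ->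
  (forall a, a != b -> f (v a) = 0) -> f (v b) = 1 ->
  f (\sum_(a \in [set: I]) c a *: v a) = c b.
Proof.
move=> fl fc f0 f1; rewrite (lin_fsum fl (basis_scale v fc)) (@fsum1 _ _ b).
  by rewrite (linZ fl) f1; exact: mulr1.
by move=> a ab; rewrite (linZ fl) f0// scaler0.
Qed.

Lemma basis_expansion z : z = \sum_(a \in [set: I]) B z (e' a) *: e a /\
  finite_set [set a | B z (e' a) != 0].
Proof.
have [c [[fc zE] _]] := db_basis e_dual z.
have cE a : B z (e' a) = c a.
  rewrite zE; apply: (coord_r (f := fun z => B z (e' a))) => //.
    by move=> b ba; rewrite (db_dual e_dual) (negbTE ba).
  by rewrite (db_dual e_dual) eqxx.
split; last by apply: sub_finite_set fc => a /=; rewrite cE.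
by rewrite [LHS]zE; apply: eq_fsbigr => a _; rewrite cE.
Qed.

Lemma dual_basis_expansion z : z = \sum_(a \in [set: I]) B (e a) z *: e' a /\
  finite_set [set a | B (e a) z != 0].
Proof.
have [c [[fc zE] _]] := db_dual_basis e_dual z.
have cE a : B (e a) z = c a.
  rewrite zE; apply: (coord_r (f := B (e a))) => //.
    by move=> b ba; rewrite (db_dual e_dual) eq_sym (negbTE ba).
  by rewrite (db_dual e_dual) eqxx.
split; last by apply: sub_finite_set fc => a /=; rewrite cE.
by rewrite [LHS]zE; apply: eq_fsbigr => a _; rewrite cE.
Qed.

Hypothesis fin_dim : finite_dim_pieces L.

(** If m basis vectors lie in the span of n vectors, the identity matrix B(e_a, e^b) of size m
    factors through K^n, so m <= n. *)
Lemma finite_layer (s : int) : finite_set [set a | (deg a).1 = s].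
Proof.
have [n [v hv]] := fin_dim s; apply: contrapT => inf.
have [A sA cA] := infinite_set_fset n.+1 inf.
pose t := in_tuple (finmap.enum_fset A).
set m := size (finmap.enum_fset A) in t.
have lin_v z : lspan (range v) z -> exists c : 'I_n -> K, z = \sum_j c j *: v j.
  elim/lspan_ind => [|b u w [c ->] [d ->]|_ [j _ <-]].
  - by exists (fun=> 0); rewrite big1// => j _; rewrite scale0r.
  - exists (fun j => b * c j + d j); rewrite scaler_sumr -big_split.
    by apply: eq_bigr => j _; rewrite scalerDl scalerA.
  - exists (fun i => (i == j)%:R); rewrite (bigD1 j)//= eqxx scale1r big1 ?addr0//.
    by move=> i /negbTE ->; rewrite scale0r.
have layer i : zhomog s (e (tnth t i)).
  move=> k ks; rewrite (pr_homog _ (db_homog e_dual _)); case: eqP => // kE.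
  have dE := sA (tnth t i) (mem_tnth i t).
  by rewrite -dE kE eqxx in ks.
have [c cE] := choice (fun i => lin_v _ (hv _ (layer i))).
suff : (m <= n)%N by rewrite leqNgt; move/negP; apply.
apply: (@mulmx1_min _ _ _ (\matrix_(i, j) c i j)
  (\matrix_(j, i) B (v j) (e' (tnth t i)))).
apply/matrixP => i i'; rewrite !mxE.
transitivity (B (e (tnth t i)) (e' (tnth t i'))).
  by rewrite cE qf_suml; apply: eq_bigr => j _; rewrite !mxE qfZl.
rewrite (db_dual e_dual); congr (nat_of_bool _)%:R.
by apply/eqP/eqP => [/(@tuple_uniqP _ _ t (finmap.fset_uniq A))//|->].
Qed.

Definition layer (s : int) : seq I := finmap.enum_fset (fset_set [set a | (deg a).1 = s]).

Lemma layer_uniq s : uniq (layer s).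
Proof. exact: finmap.fset_uniq. Qed.

Lemma mem_layer s a : (a \in layer s) = ((deg a).1 == s).
Proof.
by rewrite in_fset_set ?mem_setE; [apply/idP/eqP; rewrite inE|exact: finite_layer].
Qed.

Lemma layer_expansion k z s : homog k z -> k.1 = s ->
  z = \sum_(a <- layer s) B z (e' a) *: e a.
Proof.
move=> hz ks; rewrite [LHS](proj1 (basis_expansion z)).
apply: (fsum_seq (layer_uniq s)) => a; rewrite mem_layer => as_.
rewrite (qf_deg B_quadratic hz (dual_basis_homog a)) ?scale0r//.
apply: contra as_; rewrite subr_eq0 => /eqP <-; exact/eqP.
Qed.

Lemma layer_dual_expansion k z s : homog k z -> k.1 = - s ->
  z = \sum_(a <- layer s) B (e a) z *: e' a.
Proof.
move=> hz ks; rewrite [LHS](proj1 (dual_basis_expansion z)).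
apply: (fsum_seq (layer_uniq s)) => a; rewrite mem_layer => as_.
rewrite (qf_deg B_quadratic (db_homog e_dual a) hz) ?scale0r//.
by apply: contra as_; rewrite addr_eq0 => /eqP ->; rewrite /= ks opprK.
Qed.

Lemma qf_dual_sym a b :
  B (e' b) (e' a) = eps (deg a).2 (deg a).2 * B (e' a) (e' b).
Proof.
have ha := dual_basis_homog a; have hb := dual_basis_homog b.
have [ab|ab] := eqVneq (- deg b - deg a) 0; last first.
  rewrite (qf_deg B_quadratic hb ha ab) (qf_deg B_quadratic ha hb) ?mulr0//.
  by rewrite addrC.
rewrite (qf_sym B_quadratic hb ha); congr (_ * _).
by move: ab => /subr0_eq ->; rewrite epsNr epsaa_inv.
Qed.

Section Bilinear.
Variables (W : lmodType K) (f : L -> L -> W).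
Hypothesis fl : forall y, linear (f^~ y).
Hypothesis fr : forall x, linear (f x).

(* Both sides are the canonical element of g_s (x) g_{-s}.                    *)
Lemma layer_swap s :
  \sum_(a <- layer s) eps (deg a).2 (deg a).2 *: f (e a) (e' a) =
  \sum_(b <- layer (- s)) f (e' b) (e b).
Proof.
transitivity (\sum_(b <- layer (- s)) \sum_(a <- layer s)
    B (e' b) (e' a) *: f (e a) (e b)); last first.
  apply: eq_big_seq => b; rewrite mem_layer => /eqP bs.
  rewrite [in RHS](layer_expansion (s := s) (dual_basis_homog b)) ?bs/= ?bs ?opprK//.
  by rewrite (lin_sum (fl _)); apply: eq_bigr => a _; rewrite (linZ (fl _)).
rewrite exchange_big; apply: eq_big_seq => a; rewrite mem_layer => /eqP as_.
rewrite [in LHS](layer_expansion (s := - s) (dual_basis_homog a)) /= ?as_//.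
rewrite (lin_sum (fr _)) scaler_sumr; apply: eq_bigr => b _.
by rewrite (linZ (fr _)) scalerA -qf_dual_sym.
Qed.

(* The canonical element of g (x) g is killed by [x].                         *)
Lemma layer_invariance k x s : homog k x ->
  \sum_(a <- layer s) eps (deg a).2 k.2 *: f (e' a) (zc_br x (e a)) =
  - \sum_(b <- layer (s + k.1)) f (zc_br x (e' b)) (e b).
Proof.
move=> hx.
transitivity (\sum_(a <- layer s) \sum_(b <- layer (s + k.1))
    - (B (e a) (zc_br x (e' b)) *: f (e' a) (e b))).
  apply: eq_big_seq => a; rewrite mem_layer => /eqP as_.
  have ha := db_homog e_dual a.
  rewrite [in LHS](layer_expansion (s := s + k.1) (homog_br hx ha)); last first.
    by rewrite fst_add as_ addrC.
  rewrite (lin_sum (fr _)) scaler_sumr; apply: eq_bigr => b _.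
  rewrite (linZ (fr _)) scalerA -scaleNr; congr (_ *: _).
  rewrite -(qf_inv B_quadratic) (zc_br_anti ha hx) qfNl qfZl opprK.
  by [].
rewrite exchange_big -sumrN; apply: eq_big_seq => b; rewrite mem_layer => /eqP bs.
rewrite [in RHS](layer_dual_expansion (s := s) (homog_br hx (dual_basis_homog b))).
  by rewrite (lin_sum (fl _)) -sumrN; apply: eq_bigr => a _; rewrite (linZ (fl _)).
by rewrite fst_add /= bs opprD addrCA subrr addr0.
Qed.

End Bilinear.

(** * Commutators with the layers of the Casimir element *)

Section Commutator.
Variables (k : int * G) (x : L) (hx : homog k x).
Local Notation U := (palg Univ L).
Local Notation g := (pgen Univ).

(** This is C_s; [dcas] and [bcas] are D_s and d_s. *)
Definition lcas (s : int) : U := \sum_(a <- layer s) g (e' a) * g (e a).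
Definition dcas (s : int) : U := \sum_(a <- layer s) g (zc_br x (e' a)) * g (e a).
Definition bcas (s : int) : L := \sum_(a <- layer s) zc_br (zc_br x (e' a)) (e a).

Let gg_l y : linear (fun z => g z * g y : U).
Proof. by move=> a u v; rewrite pgen_linear mulrDl -scalerAl. Qed.
Let gg_r z : linear (fun y => g z * g y : U).
Proof. by move=> a u v; rewrite pgen_linear mulrDr -scalerAr. Qed.

(** Passing [x] through e^a e_a leaves [x, e^a] e_a and eps(x, e^a) e^a [x, e_a]; the latter add up
    to -D_{s+n} by [layer_invariance]. *)
Lemma comm_lcas s : g x * lcas s - lcas s * g x = dcas s - dcas (s + k.1).
Proof.
rewrite /dcas -(layer_invariance gg_l gg_r s hx) mulr_sumr mulr_suml -sumrB.
rewrite -big_split; apply: eq_bigr => a _ /=.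
rewrite mulrA (pgen_comm Univ hx (dual_basis_homog a)) mulrDl -scalerAl.
rewrite -[g (e' a) * g x * _]mulrA (pgen_comm Univ hx (db_homog e_dual a)) mulrDr -scalerAr scalerDr scalerA.
rewrite epsNr mulVf ?eps_neq0// scale1r -epsV mulrA.
by rewrite /brk; lmodule K U; ring.
Qed.

(** Up to signs, [layer_invariance] writes -D_{n-s} as the sum of e^b [x, e_b] over degree -s, and
    [layer_swap] as that of e_a [x, e^a] over degree s. Subtracted from D_s, these are commutators
    of [x, e^a] with e_a. *)
Lemma dcas_reflect s : dcas s + dcas (k.1 - s) = g (bcas s).
Proof.
(* [layer_swap] applies to bilinear maps, so the sign depending on the degree of the first argument
   is absorbed in a linear map. *)
pose tw := gext (fun l (y : L) => eps k.2 l.2 *: y).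
have tw_lin : linear tw by apply: gext_linear => l a u v; lmodule K L; ring.
have tw_h l y : homog l y -> tw y = eps k.2 l.2 *: y.
  by move=> hy; apply: gext_homog => // m; rewrite scaler0.
have f_l y : linear (fun z => g (tw z) * g (zc_br x y) : U).
  by move=> a u v; rewrite tw_lin; apply: gg_l.
have f_r z : linear (fun y => g (tw z) * g (zc_br x y) : U).
  by move=> a u v; rewrite zc_br_linearr; apply: gg_r.
have := layer_swap f_l f_r s.
have -> : \sum_(b <- layer (- s)) g (tw (e' b)) * g (zc_br x (e b)) =
    - dcas (k.1 - s).
  rewrite addrC -(layer_invariance gg_l gg_r (- s) hx); apply: eq_bigr => b _.
  rewrite (tw_h _ _ (dual_basis_homog b)) (linZ (@pgen_linear _ _ _ _ _)) -scalerAl.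
  by rewrite epsNr -epsV.
move=> /(congr1 -%R); rewrite opprK => <-; rewrite -sumrN /dcas /bcas.
rewrite (lin_sum (@pgen_linear _ _ _ _ _)) -big_split; apply: eq_bigr => a _ /=.
have ha := db_homog e_dual a.
rewrite (pgen_comm Univ (homog_br hx (dual_basis_homog a)) ha).
rewrite (tw_h _ _ ha) (linZ (@pgen_linear _ _ _ _ _)) -scalerAl scalerA.
rewrite snd_add cf_Dl epsNl epsaa_inv /brk.
by lmodule K U; ring.
Qed.

Lemma bcas_homog s : homog k (bcas s).
Proof.
apply: homog_sum => a _.
have := homog_br (homog_br hx (dual_basis_homog a)) (db_homog e_dual a).
by rewrite subrK.
Qed.

End Commutator.

End QuadraticIdentities.

(** * Evaluation of the traces in the Kac-Peterson cocycle *)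

Section KacPeterson.
Variables (K : fieldType) (G : zmodType) (eps : commfactor K G) (L : zclie eps).
Variables (B : L -> L -> K) (B_quadratic : quadratic_form B).
Variables (I : choiceType) (deg : I -> int * G) (e e' : I -> L).
Hypothesis e_dual : dual_bases B deg e e'.
Hypothesis fin_dim : finite_dim_pieces L.
Implicit Types (x y z : L) (k l : int * G).

Local Notation layer := (layer deg).
Let ha a : homog (deg a) (e a) := db_homog e_dual a.
Let ha' a : homog (- deg a) (e' a) := dual_basis_homog B_quadratic e_dual a.

Lemma pi_plus_homog k z : homog k z -> pi_plus z = if 0 < k.1 then z else 0.
Proof.
move=> hz; rewrite /pi_plus fsbig_mkcond (@fsum1 _ _ k) => [|l lk].
  rewrite /patch hz; case: ifPn; [rewrite inE /= => -> //|].
  by rewrite notin_setE /=; case: ifP.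
by rewrite /patch; case: ifP => // _; rewrite (pr_homog _ hz) (negbTE lk).
Qed.

Lemma pi_minus_homog k z : homog k z -> pi_minus z = if k.1 <= 0 then z else 0.
Proof.
move=> hz; rewrite /pi_minus fsbig_mkcond (@fsum1 _ _ k) => [|l lk].
  rewrite /patch hz; case: ifPn; [rewrite inE /= => -> //|].
  by rewrite notin_setE /=; case: ifP.
by rewrite /patch; case: ifP => // _; rewrite (pr_homog _ hz) (negbTE lk).
Qed.

Let pi_minus0 : pi_minus (0 : L) = 0.
Proof. by apply: fsbig1 => k _; apply: (lin0 (@zc_pr_linear _ _ _ L k)). Qed.

(** [e a] survives [pi_plus] in positive degree, and [[y, e a]] survives [pi_minus] in degree at
    most 0. *)
Let br_pi x l y a : homog l y ->
  zc_br x (pi_minus (zc_br y (pi_plus (e a)))) =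
    if 0 < (deg a).1 <= - l.1 then zc_br x (zc_br y (e a)) else 0.
Proof.
move=> hy; rewrite (pi_plus_homog (ha a)); case: ifP => /= _; last first.
  rewrite (lin0 (@zc_br_linearr _ _ _ L y)) pi_minus0.
  exact: (lin0 (@zc_br_linearr _ _ _ L x)).
rewrite (pi_minus_homog (homog_br hy (ha a))) fst_add -lerBrDl sub0r.
by case: ifP => // _; apply: (lin0 (@zc_br_linearr _ _ _ L x)).
Qed.

(** Invariance and antisymmetry rotate [y] out of the inner bracket into the second slot of [B]. *)
Let term1 k l x y a : homog k x -> homog l y ->
  eps (deg a).2 (deg a).2 * B (zc_br x (zc_br y (e a))) (e' a) =
  B (zc_br (zc_br x (e' a)) (e a)) y.
Proof.
move=> hx hy.
have hxa := homog_br hx (ha' a).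
rewrite (zc_br_anti hx (homog_br hy (ha a))) (qfNl B_quadratic) (qfZl B_quadratic).
rewrite (qf_inv B_quadratic) (qf_inv B_quadratic).
rewrite (zc_br_anti (ha a) hxa) (qfNr B_quadratic) (qfZr B_quadratic).
rewrite (qf_sym B_quadratic hy (homog_br hxa (ha a))).
rewrite subrK !snd_add snd_opp !cf_Dr epsNr (epsV eps k.2 (deg a).2) (epsV eps k.2 l.2).
have n1 := eps_neq0 eps k.2 (deg a).2; have n2 := eps_neq0 eps k.2 l.2.
have n3 := eps_neq0 eps (deg a).2 (deg a).2.
by field; rewrite n1 n2 n3.
Qed.

Let term2 k l x y a : homog k x -> homog l y ->
  eps k.2 l.2 *
    (eps (deg a).2 (deg a).2 * B (zc_br y (zc_br x (e a))) (e' a)) =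
  eps (deg a).2 (deg a).2 * B (zc_br (zc_br x (e a)) (e' a)) y.
Proof.
move=> hx hy; rewrite (term1 a hy hx).
have hya := homog_br hy (ha' a); have hxa := homog_br hx (ha a).
rewrite (qf_sym B_quadratic (homog_br hya (ha a)) hx).
rewrite (zc_br_anti hya (ha a)) (qfNr B_quadratic) (qfZr B_quadratic).
rewrite -(qf_inv B_quadratic) (zc_br_anti hy (ha' a)) (qfNr B_quadratic).
rewrite (qfZr B_quadratic) -(qf_inv B_quadratic).
rewrite subrK !snd_add snd_opp !cf_Dl epsNl epsNr epsaa_inv (epsV eps k.2 l.2).
have n1 := eps_neq0 eps l.2 (deg a).2; have n2 := eps_neq0 eps k.2 l.2.
by field; rewrite n1 n2.
Qed.

Lemma layer_fsum (V : nmodType) (F : I -> V) m :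
  \sum_(a \in [set: I]) (if 0 < (deg a).1 <= m%:Z then F a else 0) =
  \sum_(s < m) \sum_(a <- layer s.+1%:Z) F a.
Proof.
pose r := undup (flatten [seq layer s.+1%:Z | s <- iota 0 m]).
have mem_r a s : (s < m)%N -> (deg a).1 = s.+1%:Z -> a \in r.
  move=> sm as_; rewrite mem_undup; apply/flattenP; exists (layer s.+1%:Z).
    by apply/mapP; exists s => //; rewrite mem_iota.
  by rewrite (mem_layer B_quadratic e_dual fin_dim); apply/eqP.
have splitF a : (if 0 < (deg a).1 <= m%:Z then F a else 0) =
    \sum_(s < m) (if (deg a).1 == s.+1%:Z then F a else 0).
  case: ifPn => [|am]; last first.
    apply/esym; apply: big1 => s _; case: eqP => // as_.
    by move: am; rewrite as_ /= lez_nat ltn_ord.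
  case: (deg a).1 => [[|s]|s] //=; rewrite lez_nat => sm.
  rewrite (bigD1 (Ordinal sm))//= eqxx big1 ?addr0// => j js.
  rewrite ifF//; apply: contraNF js => /eqP [sj]; apply/eqP/val_inj.
  by rewrite /= sj.
have ur : uniq r := undup_uniq _.
rewrite (fsum_seq ur) => [|a ar]; last first.
  rewrite splitF big1// => s _; case: eqP => // as_.
  by rewrite (mem_r a s) in ar.
under eq_bigr => a _ do rewrite splitF.
rewrite exchange_big; apply: eq_bigr => s _ /=.
rewrite -(fsum_seq (F := fun a => if (deg a).1 == s.+1%:Z then F a else 0) ur)
  => [|a ar]; last first.
  by case: eqP => // as_; rewrite (mem_r a s) in ar.
rewrite (fsum_seq (layer_uniq deg s.+1%:Z)) => [|a].
  by apply: eq_big_seq => a; rewrite (mem_layer B_quadratic e_dual fin_dim) => ->.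
by rewrite (mem_layer B_quadratic e_dual fin_dim) => /negbTE ->.
Qed.

(** The window found by [br_pi] is bounded by [- l.1]; this equals [k.1] when [k + l = 0], and
    otherwise all terms vanish by degree. *)
Let trace1 k l x y : homog k x -> homog l y ->
  eps_trace B deg e e' (fun z => zc_br x (pi_minus (zc_br y (pi_plus z)))) =
  \sum_(a \in [set: I]) (if 0 < (deg a).1 <= k.1
    then B (zc_br (zc_br x (e' a)) (e a)) y else 0).
Proof.
move=> hx hy; apply: eq_fsbigr => a _; rewrite (br_pi _ _ hy).
transitivity (if 0 < (deg a).1 <= - l.1
    then B (zc_br (zc_br x (e' a)) (e a)) y else 0).
  by case: ifP => _; [rewrite (term1 a hx hy)|rewrite (qf0l B_quadratic) mulr0].
have [kl|kl] := eqVneq (k + l) 0.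
  by have -> : k.1 = - l.1 by move/addr0_eq: kl => <- /=; rewrite opprK.
have hd := homog_br (homog_br hx (ha' a)) (ha a); rewrite subrK in hd.
by rewrite (qf_deg B_quadratic hd hy kl) !if_same.
Qed.

Let trace2 k l x y : homog k x -> homog l y ->
  eps k.2 l.2 *
    eps_trace B deg e e' (fun z => zc_br y (pi_minus (zc_br x (pi_plus z)))) =
  \sum_(a \in [set: I]) (if 0 < (deg a).1 <= - k.1
    then eps (deg a).2 (deg a).2 * B (zc_br (zc_br x (e a)) (e' a)) y else 0).
Proof.
move=> hx hy; rewrite mulr_fsumr; apply: eq_fsbigr => a _.
rewrite (br_pi _ _ hx); case: ifP => _; first exact: term2.
by rewrite (qf0l B_quadratic) !mulr0.
Qed.

Hypothesis char0 : [pchar K] =i pred0.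
Variable Psi : L -> L.
Hypothesis Psi_KP : is_KP_endomorphism B deg e e' Psi.

Let two_neq0 : 2%:R != 0 :> K.
Proof. by have /pcharf0P -> := char0. Qed.

Let KP_unique k x z : homog k x ->
  (forall l y, homog l y -> 2%:R * kac_peterson B deg e e' k.2 l.2 x y = B z y) ->
  2%:R *: Psi x = z.
Proof.
move=> hx hz; apply/subr0_eq/(qf_nondeg B_quadratic) => y.
elim/zclie_ind: y => [y y' hy hy'|l y hy].
  by rewrite (qfDr B_quadratic) hy hy' addr0.
rewrite (qfDl B_quadratic) (qfNl B_quadratic) (qfZl B_quadratic).
have [_ KP] := Psi_KP; rewrite -(KP k l x y hx hy) (hz l y hy).
exact: subrr.
Qed.

Let KP_sums k l x y : homog k x -> homog l y ->
  2%:R * kac_peterson B deg e e' k.2 l.2 x y =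
  \sum_(a \in [set: I]) (if 0 < (deg a).1 <= k.1
    then B (zc_br (zc_br x (e' a)) (e a)) y else 0) -
  \sum_(a \in [set: I]) (if 0 < (deg a).1 <= - k.1
    then eps (deg a).2 (deg a).2 * B (zc_br (zc_br x (e a)) (e' a)) y else 0).
Proof.
move=> hx hy; rewrite -(trace1 hx hy) -(trace2 hx hy) /kac_peterson.
by rewrite -mulrA -mulrBr mulrA mulfV ?mul1r.
Qed.

Let empty_sum (V : nmodType) (F : I -> V) (n : int) : n <= 0 ->
  \sum_(a \in [set: I]) (if 0 < (deg a).1 <= n then F a else 0) = 0.
Proof.
move=> n0; apply: fsbig1 => a _; case: ifP => // /andP[a0 an].
by have := lt_le_trans a0 (le_trans an n0); rewrite ltxx.
Qed.

(** The window of the second trace is empty, and the first runs over the layers 1, ..., m. *)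
Lemma KP_nonneg k x m : homog k x -> k.1 = m%:Z ->
  2%:R *: Psi x = \sum_(s < m) bcas deg e e' x s.+1%:Z.
Proof.
move=> hx km; apply: (KP_unique hx) => l y hy; rewrite (KP_sums hx hy).
rewrite [X in _ - X]empty_sum ?subr0; last by rewrite km oppr_le0.
rewrite km layer_fsum (qf_suml B_quadratic); apply: eq_bigr => s _.
by rewrite (qf_suml B_quadratic).
Qed.

(** Now the first trace is empty; [layer_swap] turns the terms [[x, e_a], e^a] of degree s in the
    second into those of d_{-s}. *)
Lemma KP_neg k x m : homog k x -> k.1 = - m%:Z ->
  2%:R *: Psi x = - \sum_(s < m) bcas deg e e' x (- s.+1%:Z).
Proof.
move=> hx km; apply: (KP_unique hx) => l y hy; rewrite (KP_sums hx hy).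
rewrite [X in X - _]empty_sum ?sub0r; last by rewrite km oppr_le0.
rewrite km opprK layer_fsum (qfNl B_quadratic) (qf_suml B_quadratic).
congr (- _); apply: eq_bigr => s _.
have f_l z : linear (fun u => zc_br (zc_br x u) z).
  by move=> a u v; rewrite zc_br_linearr zc_br_linearl.
have f_r u : linear (fun z => zc_br (zc_br x u) z).
  exact: zc_br_linearr.
rewrite /bcas -(layer_swap B_quadratic e_dual fin_dim f_l f_r) (qf_suml B_quadratic).
by apply: eq_bigr => a _; rewrite (qfZl B_quadratic).
Qed.

End KacPeterson.

(** * Telescoping sums *)

Section Telescoping.
Variables (K : comPzRingType) (V : lmodType K).

Lemma sum_rotate (F : nat -> V) m :
  \sum_(s < m) F s + F m = F 0%N + \sum_(s < m) F s.+1.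
Proof.
have := erefl (\sum_(0 <= s < m.+1) F s).
by rewrite {1}big_nat_recr // big_nat_recl // !big_mkord.
Qed.

Lemma sum_shift (F : nat -> V) (m N : nat) :
  \sum_(r < N) (F r - F (r + m)%N) =
  \sum_(s < m) F s - \sum_(s < m) F (N + s)%N.
Proof.
elim: N => [|N IH]; first by rewrite big_ord0 subrr.
rewrite big_ord_recr /= IH -addrA; congr (_ + _).
have := sum_rotate (fun s => F (N + s)%N) m; rewrite addn0 => /(canRL (addrK _)) ->.
under [in RHS]eq_bigr do rewrite addSnnS.
by lmodule K V; ring.
Qed.

Lemma sum_reflect (F : int -> V) (m : nat) :
  \sum_(s < m) F (m%:Z - s.+1%:Z) = \sum_(s < m) F s%:Z.
Proof.
rewrite [RHS](reindex_inj rev_ord_inj) /=; apply: eq_bigr => s _; congr F.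
by have := ltn_ord s; lia.
Qed.

(** The lower boundary gives 2 (F 1 + ... + F m) + F 0 - F m, that is, F 1 + ... + F m together with
    F 0 + ... + F (m-1). These are exchanged by s -> m - s, which produces the pairs for
    [dcas_reflect]. *)
Lemma casimir_telescope (F : int -> V) (m N : nat) :
  F 0 - F m%:Z + \sum_(r < N) (F r.+1%:Z - F (r.+1%:Z + m%:Z)) *+ 2 =
  \sum_(s < m) (F s.+1%:Z + F (m%:Z - s.+1%:Z))
  - (\sum_(s < m) F (N + s).+1%:Z) *+ 2.
Proof.
rewrite [in RHS]big_split /= sum_reflect.
have := sum_shift (fun r => F r.+1%:Z) m N; rewrite sumrMnl => ->.
have := sum_rotate (fun s => F s%:Z) m => /(canLR (addKr _)) <-.
by rewrite !mulr2n; lmodule K V; ring.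
Qed.

End Telescoping.

(** * The normal-ordered Casimir element *)

Section Casimir.
Variables (K : fieldType) (G : zmodType) (eps : commfactor K G) (L : zclie eps).
Hypothesis char0 : [pchar K] =i pred0.
Variables (B : L -> L -> K) (B_quadratic : quadratic_form B).
Variables (I : choiceType) (deg : I -> int * G) (e e' : I -> L).
Hypothesis e_dual : dual_bases B deg e e'.
Hypothesis fin_dim : finite_dim_pieces L.

Local Notation layer := (layer deg).
Local Notation g := (pgen Univ).
Local Notation U := (palg Univ L).
Local Notation sq := (@symmetrization K G eps).
Local Notation eps2 a := (eps (deg a).2 (deg a).2).
Let ha a : homog (deg a) (e a) := db_homog e_dual a.
Let ha' a : homog (- deg a) (e' a) := dual_basis_homog B_quadratic e_dual a.
Let in_layer := mem_layer B_quadratic e_dual fin_dim.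

Let two_neq0 : 2%:R != 0 :> K.
Proof. by have /pcharf0P -> := char0. Qed.

Let eps2_sq a : eps2 a * eps2 a = 1.
Proof. exact: cf_sym. Qed.

Definition qtens : tsplit Sym L -> tsplit Univ L :=
  teval (fun a b => tpure (sq a) (sq b)).

Let qtens_l b : linear (fun a : palg Sym (gminus L) =>
  tpure (sq a) (sq b) : tsplit Univ L).
Proof. by move=> c u v; rewrite symmetrization_linear (tpure_linearl _ c). Qed.
Let qtens_r a : linear (fun b : palg Sym (gplus L) =>
  tpure (sq a) (sq b) : tsplit Univ L).
Proof. by move=> c u v; rewrite symmetrization_linear (tpure_linearr _ c). Qed.

Lemma qtens_linear : linear qtens.
Proof. exact: teval_linear qtens_l qtens_r. Qed.
Lemma qtens_pure a b : qtens (tpure a b) = tpure (sq a) (sq b).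
Proof. exact: teval_pure qtens_l qtens_r _ _. Qed.

(** The normally ordered form of e_a e^a: the factor of negative degree stands on the left, and in
    degree 0 both factors lie in g_- and are symmetrized. *)
Definition normal_term (a : I) : U :=
  if 0 < (deg a).1 then eps2 a *: (g (e' a) * g (e a))
  else if (deg a).1 < 0 then g (e a) * g (e' a)
  else 2%:R^-1 *: (g (e a) * g (e' a) + eps2 a *: (g (e' a) * g (e a))).

Let eps_dual a : eps (deg a).2 (- deg a).2 = eps2 a.
Proof. by rewrite snd_opp epsNr epsaa_inv. Qed.

Lemma casimir_term a : exists t : tsplit Sym L,
  [/\ tsdeg 0 `|(deg a).1|%N t,
      multmap t = pgen Sym (e a) * pgen Sym (e' a),
      tsdeg 0 `|(deg a).1|%N (qtens t) & multmap (qtens t) = normal_term a].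
Proof.
pose lm k x := deglift (@minus_closed) k (x : L).
pose lp k x := deglift (@plus_closed) k (x : L).
have pure_deg F k u v : k.1 <= 0 -> pdeg F (gminus L) k u ->
    pdeg F (gplus L) (- k) v -> tsdeg 0 `|k.1|%N (tpure u v : tsplit F L).
  move=> k0 hu hv; apply: (@tsdeg_pure _ _ _ _ _ _ _ k.2 (- k.2)).
  - exact: subrr.
  - by rewrite lez0_abs// opprK add0r -surjective_pairing.
  - by rewrite lez0_abs.
rewrite /normal_term; case: (ltgtP (deg a).1 0) => a0.
- exists (tpure (pgen Sym (lm (deg a) (e a))) (pgen Sym (lp (- deg a) (e' a)))).
  have a0' : 0 < (- deg a).1 by rewrite /= oppr_gt0.
  have hm : homog (deg a) (lm (deg a) (e a)) by exact: homog_deglift.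
  have hp : homog (- deg a) (lp (- deg a) (e' a)) by exact: homog_deglift.
  rewrite qtens_pure (symmetrization_gen hm) (symmetrization_gen hp).
  split.
  + by apply: pure_deg (ltW a0) _ _; apply: pdeg_gen.
  + by rewrite multmap_pure incl_minus_gen incl_plus_gen !deglift_val (ltW a0) a0' ha ha'.
  + by apply: pure_deg (ltW a0) _ _; apply: pdeg_gen.
  + by rewrite multmap_pure incl_minus_gen incl_plus_gen !deglift_val (ltW a0) a0' ha ha'.
- exists (eps2 a *: tpure (pgen Sym (lm (- deg a) (e' a))) (pgen Sym (lp (deg a) (e a)))).
  have a0' : (- deg a).1 <= 0 by rewrite /= oppr_le0 ltW.
  have hm : homog (- deg a) (lm (- deg a) (e' a)) by exact: homog_deglift.
  have hp : homog (deg a) (lp (deg a) (e a)) by exact: homog_deglift.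
  have absE : `|(deg a).1|%N = `|(- deg a).1|%N by rewrite /= abszN.
  rewrite (linZ qtens_linear) qtens_pure.
  rewrite (symmetrization_gen hm) (symmetrization_gen hp).
  rewrite !(linZ (@multmap_linear _ _ _ _ _)) !multmap_pure !incl_minus_gen !incl_plus_gen.
  rewrite !deglift_val a0' a0 ha ha' absE; split=> //.
  + by apply/lspanZ/(pure_deg _ (- deg a) _ _ a0'); rewrite ?opprK; apply: pdeg_gen.
  + rewrite [RHS](pgen_comm Sym (ha a) (ha' a)) eps_dual.
    by rewrite (lin0 (@pgen_linear _ _ _ _ _)) addr0.
  + by apply/lspanZ/(pure_deg _ (- deg a) _ _ a0'); rewrite ?opprK; apply: pdeg_gen.
(* Degree 0 belongs to g_-, so both factors go into the left tensor factor and the index of the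
   piece is 0. *)
have a0r : (deg a).1 <= 0 by rewrite a0.
have a0' : (- deg a).1 <= 0 by rewrite /= a0.
have hm : homog (deg a) (lm (deg a) (e a)) by exact: homog_deglift.
have hp : homog (- deg a) (lm (- deg a) (e' a)) by exact: homog_deglift.
have vm : val (lm (deg a) (e a)) = e a by rewrite deglift_val a0r ha.
have vp : val (lm (- deg a) (e' a)) = e' a by rewrite deglift_val a0' ha'.
exists (tpure (pgen Sym (lm (deg a) (e a)) * pgen Sym (lm (- deg a) (e' a))) 1).
rewrite qtens_pure (symmetrization_gen2 hm hp) symmetrization1//.
rewrite !multmap_pure !incl_plus1 !mulr1 (linZ (@incl_minus_linear _ _ _ _ _)).
rewrite (linD (@incl_minus_linear _ _ _ _ _)) (linZ (@incl_minus_linear _ _ _ _ _)).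
rewrite !incl_minusM !incl_minus_gen vm vp eps_dual a0; split=> //.
- apply: (@tsdeg_pure _ _ _ _ _ _ _ 0 0); rewrite ?addr0 ?subr0//; last exact: pdeg1.
  by have := pdegM (pdeg_gen Sym hm) (pdeg_gen Sym hp); rewrite subrr.
- apply: (@tsdeg_pure _ _ _ _ _ _ _ 0 0); rewrite ?addr0 ?subr0//; last exact: pdeg1.
  have h1 := pdegM (pdeg_gen Univ hm) (pdeg_gen Univ hp).
  have h2 := pdegM (pdeg_gen Univ hp) (pdeg_gen Univ hm).
  rewrite subrr in h1; rewrite addNr in h2.
  by apply: lspanZ; apply: lspanD h1 _; apply: lspanZ.
Qed.

(** The indices contributing to the component [r] of the Casimir element; [r = 0] is separate so
    that layer 0 is not listed twice. *)
Let shell (r : nat) : seq I :=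
  if r is 0%N then layer 0 else layer r%:Z ++ layer (- r%:Z).

Let mem_shell r a : (a \in shell r) = (`|(deg a).1|%N == r).
Proof.
case: r => [|r]; first by rewrite in_layer absz_eq0.
by rewrite mem_cat !in_layer; apply/idP/eqP; lia.
Qed.

Let shell_uniq r : uniq (shell r).
Proof.
case: r => [|r]; first exact: layer_uniq.
rewrite cat_uniq !layer_uniq andbT /=; apply/hasPn => a; rewrite !in_layer.
by move=> /eqP ->.
Qed.

Lemma casimir_shell :
  (forall l r, l != 0 -> val (casimir deg e e') l r = 0) /\
  forall r, multmap (val (casimir deg e e') 0 r) =
    \sum_(a <- shell r) eps2 a *: normal_term a.
Proof.
have [t ht] := choice casimir_term.
pose f (l : int * G) (r : nat) : tsplit Sym L :=
  if l == 0 then \sum_(a <- shell r) eps2 a *: t a else 0.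
have ucompE a l r : ucomp (pgen Sym (e a) * pgen Sym (e' a) : palg Sym L) (l, r) =
    if (l, r) == (0, `|(deg a).1|%N) then t a else 0.
  by have [h1 <- _ _] := ht a; rewrite (ucomp_tsdeg _ h1).
have termE a l r : val (eps2 a *: hat_emb (pgen Sym (e a) * pgen Sym (e' a))) l r =
    eps2 a *: (if (l, r) == (0, `|(deg a).1|%N) then t a else 0).
  rewrite [LHS](_ : _ = eps2 a *: val (hat_emb (pgen Sym (e a) * pgen Sym (e' a))) l r)//.
  by rewrite hat_emb_val ucompE.
have qE l r : val (quadratic_tensor deg e e') l r = f l r.
  rewrite /quadratic_tensor /hat_sum [X in mkhat X](_ : _ = f).
    rewrite (@val_mkhat _ _ _ _ _ _ [:: 0])// => [l' r'|l' r'].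
      rewrite /f; case: eqP => [->|_]; last exact: lspan0.
      rewrite big_seq; elim/big_ind: _ => [|u v|a]; [exact: lspan0|exact: lspanD|].
      by rewrite mem_shell => /eqP <-; apply: lspanZ; have [] := ht a.
    by rewrite inE /f => /negbTE ->.
  apply/funext => l'; apply/funext => r'; rewrite /f.
  rewrite (fsum_seq (shell_uniq r')) => [|a]; last first.
    by rewrite mem_shell termE xpair_eqE eq_sym => /negbTE ->; rewrite andbF scaler0.
  case: eqP => [->|/eqP l0]; last first.
    by rewrite big1// => a _; rewrite termE xpair_eqE (negbTE l0) scaler0.
  apply: eq_big_seq => a; rewrite mem_shell termE xpair_eqE eqxx /= eq_sym => ->.
  by [].
pose f' (l : int * G) (r : nat) : tsplit Univ L := qtens (f l r).
have f'0 l r : l != 0 -> f' l r = 0.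
  by move=> l0; rewrite /f' /f (negbTE l0) (lin0 qtens_linear).
have cE : val (casimir deg e e') = f'.
  rewrite /casimir /normal_order.
  rewrite [X in mkhat X](_ : _ = f'); last first.
    by apply/funext => l; apply/funext => r; rewrite qE.
  apply: (@val_mkhat _ _ _ _ _ _ [:: 0]) => [l r|l r]; last by rewrite inE; apply: f'0.
  have [->|l0] := eqVneq l 0; last by rewrite f'0//; apply: lspan0.
  rewrite /f' /f eqxx (lin_sum qtens_linear) big_seq.
  elim/big_ind: _ => [|u v|a]; [exact: lspan0|exact: lspanD|].
  rewrite mem_shell (linZ qtens_linear) => /eqP <-; apply: lspanZ.
  by have [] := ht a.
split=> [l r l0|r]; rewrite cE; first exact: f'0.
rewrite /f' /f eqxx (lin_sum qtens_linear) (lin_sum (@multmap_linear _ _ _ _ _)).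
apply: eq_bigr => a _; rewrite (linZ qtens_linear) (linZ (@multmap_linear _ _ _ _ _)).
by have [_ _ _ ->] := ht a.
Qed.

Let gg_l y : linear (fun z : L => g z * g y : U).
Proof. by move=> a u v; rewrite pgen_linear mulrDl -scalerAl. Qed.
Let gg_r z : linear (fun y : L => g z * g y : U).
Proof. by move=> a u v; rewrite pgen_linear mulrDr -scalerAr. Qed.

Let swap s : \sum_(a <- layer s) eps2 a *: (g (e a) * g (e' a) : U) =
  lcas deg e e' (- s).
Proof. exact: (layer_swap B_quadratic e_dual fin_dim gg_l gg_r s). Qed.

(** The two orders in the symmetrized terms each sum to C_0, by [swap] for one of them, and the
    factor 1/2 averages them. *)
Lemma casimir_comp0 : multmap (val (casimir deg e e') 0 0) = lcas deg e e' 0.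
Proof.
have [_ ->] := casimir_shell; rewrite /shell.
transitivity (2%:R^-1 *: (lcas deg e e' (- 0) + lcas deg e e' 0)); last first.
  by rewrite oppr0 -mulr2n -scaler_nat scalerA mulVf// scale1r.
rewrite -[X in _ *: (X + _)]swap -big_split scaler_sumr; apply: eq_big_seq => a.
rewrite in_layer /normal_term => /eqP ->; rewrite ltxx.
have e2 := eps2_sq a; move: 2%:R^-1 => c /=.
by lmodule K U; ring: e2.
Qed.

(** The layers of degrees r+1 and -(r+1) each contribute one copy of C_{r+1}, the latter through
    [swap]. *)
Lemma casimir_compS r :
  multmap (val (casimir deg e e') 0 r.+1) = lcas deg e e' r.+1%:Z *+ 2.
Proof.
have [_ ->] := casimir_shell; rewrite /shell big_cat mulr2n; congr (_ + _).
  apply: eq_big_seq => a; rewrite in_layer /normal_term => /eqP ->.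
  by rewrite scalerA eps2_sq scale1r.
rewrite -[r.+1%:Z]opprK -swap opprK; apply: eq_big_seq => a.
by rewrite in_layer /normal_term => /eqP ->.
Qed.

End Casimir.

(** * The commutator with the Casimir element *)

Section Main.
Variables (K : fieldType) (G : zmodType) (eps : commfactor K G) (L : zclie eps).
Hypothesis char0 : [pchar K] =i pred0.
Variables (B : L -> L -> K) (B_quadratic : quadratic_form B).
Variables (I : choiceType) (deg : I -> int * G) (e e' : I -> L).
Hypothesis e_dual : dual_bases B deg e e'.
Hypothesis fin_dim : finite_dim_pieces L.
Variable Psi : L -> L.
Hypothesis Psi_KP : is_KP_endomorphism B deg e e' Psi.

Local Notation g := (pgen Univ).
Local Notation U := (palg Univ L).
Local Notation C := (lcas deg e e').
Local Notation D := (dcas deg e e').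
Local Notation omega r := (multmap (val (casimir deg e e') 0 r)).
Let ha a : homog (deg a) (e a) := db_homog e_dual a.
Let ha' a : homog (- deg a) (e' a) := dual_basis_homog B_quadratic e_dual a.
Let in_layer := mem_layer B_quadratic e_dual fin_dim.

Section Homogeneous.
Variables (k : int * G) (x : L) (hx : homog k x).

Lemma ucomp_dcas0 (s : int) l (t : nat) : t%:Z < s -> k.1 <= s ->
  ucomp (D x s : U) (l, t) = 0.
Proof.
move=> ts ks; rewrite (lin_sum (ucomp_linear _)) big_seq big1// => a.
rewrite in_layer => /eqP as_.
apply: (ucomp_mul0 (homog_br hx (ha' a)) (ha a)); rewrite ?fst_add /= as_ ?subr_le0//.
exact: le_lt_trans ts.
Qed.

Lemma ucomp_lcas_l0 (s : int) l (t : nat) :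
  t%:Z < s -> t%:Z < k.1 + s -> k.1 <= s -> ucomp (g x * C s : U) (l, t) = 0.
Proof.
move=> ts tks ks; rewrite mulr_sumr (lin_sum (ucomp_linear _)) big_seq big1// => a.
rewrite in_layer => /eqP as_.
by apply: (ucomp_mull0 (ha' a) (ha a) _ _ _ hx); rewrite /= ?as_//; lia.
Qed.

Lemma ucomp_lcas_r0 (s : int) l (t : nat) :
  t%:Z < s -> t%:Z < k.1 + s -> ucomp (C s * g x : U) (l, t) = 0.
Proof.
move=> ts tks; rewrite mulr_suml (lin_sum (ucomp_linear _)) big_seq big1// => a.
rewrite in_layer => /eqP as_.
by apply: (ucomp_mulr0 (ha' a) (ha a) _ _ _ hx); rewrite /= ?as_//; lia.
Qed.

Lemma commutator_sum N :
  \sum_(r < N.+1) (g x * omega r - omega r * g x) =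
  D x 0 - D x k.1 +
  \sum_(r < N) (D x r.+1%:Z - D x (r.+1%:Z + k.1)) *+ 2.
Proof.
rewrite big_ord_recl (casimir_comp0 char0 B_quadratic e_dual fin_dim).
rewrite (comm_lcas B_quadratic e_dual fin_dim hx) add0r; congr (_ + _).
apply: eq_bigr => r _.
rewrite [lift ord0 r : nat]/= (casimir_compS char0 B_quadratic e_dual fin_dim).
by rewrite mulrnAr mulrnAl -mulrnBl (comm_lcas B_quadratic e_dual fin_dim hx).
Qed.

(** After telescoping, the upper boundary consists of D_s with s > N - |n| when n < 0 and s > N when
    n >= 0, so the bound on [N] places it beyond [t]. The lower boundary is the sum of d_s found for
    2 Psi(x). *)
Lemma homog_Psi : homog k (2%:R *: Psi x) /\
  forall l t N, (t + `|k.1| <= N)%N ->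
    ucomp (\sum_(r < N.+1) (g x * omega r - omega r * g x)) (l, t) =
    ucomp (g (2%:R *: Psi x) : U) (l, t).
Proof.
have bh s : homog k (bcas deg e e' x s) by exact: (bcas_homog B_quadratic e_dual hx s).
have refl s := dcas_reflect B_quadratic e_dual fin_dim hx s.
have [n0|n0] := leP 0 k.1.
  have kE : k.1 = `|k.1|%N%:Z by rewrite gez0_abs.
  rewrite (KP_nonneg B_quadratic e_dual fin_dim char0 Psi_KP hx kE).
  move: kE; set m := `|k.1|%N => kE; split; first exact: homog_sum.
  move=> l t N tN; rewrite commutator_sum kE.
  rewrite (casimir_telescope (D x : int -> U)) (linB (ucomp_linear _)).
  rewrite [X in _ - X](_ : _ = 0) ?subr0; last first.
    rewrite mulr2n (linD (ucomp_linear _)) (lin_sum (ucomp_linear _)).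
    by rewrite big1 ?addr0// => s _; apply: ucomp_dcas0; lia.
  rewrite (lin_sum (@pgen_linear _ _ _ _ _)); congr ucomp.
  by apply: eq_bigr => s _; rewrite -refl kE.
have kE : k.1 = - `|k.1|%N%:Z by rewrite ltz0_abs// opprK.
rewrite (KP_neg B_quadratic e_dual fin_dim char0 Psi_KP hx kE).
move: kE; set m := `|k.1|%N => kE; split.
  by rewrite -scaleN1r; apply: homogZ; apply: homog_sum.
move=> l t N tN; rewrite commutator_sum kE.
(* For n = -m the index is shifted so that each difference runs from s to s + m as in
   [casimir_telescope]; this reverses the overall sign. *)
pose E (s : int) : U := D x (s - m%:Z).
transitivity (ucomp (- (E 0 - E m%:Z +
    \sum_(r < N) (E r.+1%:Z - E (r.+1%:Z + m%:Z)) *+ 2)) (l, t)).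
  congr ucomp; rewrite opprD opprB /E sub0r subrr; congr (_ + _).
  by rewrite -sumrN; apply: eq_bigr => r _; rewrite -mulNrn opprB addrK.
rewrite (casimir_telescope E) opprB (linB (ucomp_linear _)).
rewrite [X in X - _](_ : _ = 0) ?sub0r; last first.
  rewrite mulr2n (linD (ucomp_linear _)) (lin_sum (ucomp_linear _)).
  by rewrite big1 ?addr0// => s _; apply: ucomp_dcas0; lia.
rewrite -(linN (ucomp_linear _)) (linN (@pgen_linear _ _ _ _ _)).
rewrite (lin_sum (@pgen_linear _ _ _ _ _)); congr (ucomp (- _)).
apply: eq_bigr => s _; rewrite -refl kE addrC /E; congr (D x _ + D x _); lia.
Qed.

Lemma casimir_commutator :
  hat_mul (hat_emb (g x)) (casimir deg e e')
    - hat_mul (casimir deg e e') (hat_emb (g x)) = 2%:R *: hat_emb (g (Psi x)).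
Proof.
have [hPsi sumE] := homog_Psi.
have [om0 _] := casimir_shell char0 B_quadratic e_dual fin_dim.
rewrite -(linZ (@hat_emb_linear _ _ _ _ _)) -(linZ (@pgen_linear _ _ _ _ _)).
apply: (hat_commutator hx om0) => [l t lk|t]; first exact: ucomp_pgen hPsi lk.
(* Beyond this cut-off both s and s + n exceed [t] and n <= s, as the vanishing lemmas require;
   index 0, which is below it, drops out. *)
exists (t + `|k.1| + 1)%N.+1; split=> [[//|r] rN|]; last by apply: sumE; lia.
rewrite (casimir_compS char0 B_quadratic e_dual fin_dim) mulrnAr mulrnAl !mulr2n.
rewrite !(linD (ucomp_linear _)) ucomp_lcas_l0 ?ucomp_lcas_r0 ?addr0//; lia.
Qed.

End Homogeneous.

Lemma hat_adj_casimir x :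
  hat_adj x (casimir deg e e') = 2%:R *: hat_emb (g (Psi x)).
Proof.
have [om0 _] := casimir_shell char0 B_quadratic e_dual fin_dim.
have [Psi_lin _] := Psi_KP.
rewrite (hat_adj_deg0 x om0).
under eq_fsbigr => k _ do rewrite (casimir_commutator (homog_pr k x)).
have lin : linear (fun z => 2%:R *: hat_emb (g (Psi z)) : hat Univ L).
  move=> a u v; rewrite Psi_lin pgen_linear hat_emb_linear scalerDr !scalerA.
  by rewrite [a * _]mulrC.
by rewrite -(lin_fsum lin (zc_pr_finite x)) -zc_pr_sum.
Qed.

End Main.

Theorem theorem42 (R : realType) (G : zmodType) (eps : commfactor (complex R) G)
    (L : zclie eps) (B : L -> L -> complex R)
    (fin_dim : finite_dim_pieces L) (B_quadratic : quadratic_form B)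
    (I : choiceType) (deg : I -> int * G) (e e' : I -> L)
    (e_dual : dual_bases B deg e e')
    (Psi : L -> L) (Psi_KP : is_KP_endomorphism B deg e e' Psi) (x : L) :
  hat_adj x (casimir deg e e') = 2%:R *: hat_emb (pgen Univ (Psi x)).
Proof.
exact: (hat_adj_casimir (@pchar_num _) B_quadratic e_dual fin_dim Psi_KP).
Qed.
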